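(* Let $G$ be a locally compact Hausdorff groupoid with Haar system $\alpha$ and let $L$ be a Fell line bundle over $G$ with associated circle extension $\Sigma$. For $f\in C_c(G,L)$ define $\tilde f\colon\Sigma\to\mathbb C$ by $\tilde f(x)=x^*\cdot f(g)$ for $g\in G$, $x\in L_g\cap\Sigma$. The map $C_c(G,L)\to C_c(\Sigma)_1$, $f\mapsto\tilde f$, is a $*$-isomorphism. It extends to a $*$-isomorphism $C^*(G,L)\cong C^*(\Sigma)_1$.
   Context: Notation. $G$ has unit space $G^0$ (units identified with identity arrows), source and range maps $s,r$; $G^2$ is the space of composable pairs; $G_x=s^{-1}(x)$; $\mathbb T=\{z\in\mathbb C:|z|=1\}$. $\alpha=(\alpha^x)$ is left invariant and $\tilde\alpha_x(S)=\alpha^x(S^{-1})$ for $S\subseteq G_x$. A Fell line bundle $L=(L_g)_{g\in G}$ over $G$ is a continuous, locally trivial field of one-dimensional Banach spaces over $G$ with continuous bilinear maps $L_g\times L_h\to L_{gh}$ for $(g,h)\in G^2$ and continuous conjugate-linear maps $L_g\to L_{g^{-1}}$, $a\mapsto a^*$, such that multiplication is associative, $(ab)^*=b^*a^*$, $a^{**}=a$, $\|ab\|\le\|a\|\|b\|$, $\|a^*a\|=\|a\|^2$, and $a^*a\ge0$ in $L_{s(g)}\cong\mathbb C$ for $a\in L_g$. The restriction of $L$ to $G^0$ is canonically $G^0\times\mathbb C$. $C_c(G,L)$ (compactly supported continuous sections) is a $*$-algebra with $(\xi*\eta)(g)=\int\xi(h)\eta(h^{-1}g)\,d\alpha^{r(g)}(h)$,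 $\xi^*(g)=\xi(g^{-1})^*$, and $C^*(G,L)$ is its completion in the largest $C^*$-seminorm bounded by the $I$-norm $\|\xi\|_I=\max\{\sup_x\int\|\xi\|\,d\alpha^x,\ \sup_x\int\|\xi\|\,d\tilde\alpha_x\}$. $\Sigma=\{y\in\bigsqcup_gL_g:\ y^*y=1\in L_{s(g)}\cong\mathbb C\text{ for }y\in L_g\}$ is a locally compact groupoid with the multiplication and topology of $L$, unit space $G^0$ and $s(y)=s(g)$, $r(y)=r(g)$ for $y\in L_g$; $\mathbb T$ acts freely by scalar multiplication with $\Sigma/\mathbb T\cong G$. It carries the Haar system $f\mapsto\int_{G^x}\int_{\mathbb T}f(z\cdot y_g)\,dz\,d\alpha^x(g)$ ($y_g\in L_g\cap\Sigma$ arbitrary, $dz$ normalised Haar measure). $C_c(\Sigma)$ is the convolution $*$-algebra of $\Sigma$ (with $f^*(y)=\overline{f(y^{-1})}$) and $C^*(\Sigma)$ is its completion in the largest $C^*$-seminorm bounded by the $I$-norm. For $z\in\mathbb T$, $(\mu_zf)(x)=f(z^{-1}x)$ on $C_c(\Sigma)$ extends to a central unitary multiplier of $C^*(\Sigma)$. $C_c(\Sigma)_1=\{f\in C_c(\Sigma):\mu_z(f)=zf\ \forall z\in\mathbb T\}$ and $C^*(\Sigma)_1=\{f\in C^*(\Sigma):\mu_z(f)=zf\ \forall z\in\mathbb T\}$. *)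

(* Defs.v *)
From HB Require Import structures.
From mathcomp Require Import all_boot all_order all_algebra complex.
From mathcomp Require Import all_classical all_reals all_analysis.

Set Implicit Arguments.
Unset Strict Implicit.
Unset Printing Implicit Defensive.

Import Order.TTheory GRing.Theory Num.Theory.
Import numFieldNormedType.Exports.

Local Open Scope classical_set_scope.
Local Open Scope ring_scope.

Definition Cx (R : realType) : numClosedFieldType := R[i]%C.

(* Norms of a normed module over [Cx R] live in [Cx R]; this is the same number
   in [R]. *)
Definition rnorm (R : realType) (V : normedModType (Cx R)) (v : V) : R :=
  complex.Re (`|v| : Cx R).

(* Integrals of complex functions are meant for integrable functions only. *)
Definition cint (R : realType) d (T : measurableType d) (mu : {measure set T -> \bar R})
    (D : set T) (f : T -> Cx R) : Cx R :=
  (Rintegral mu D (fun x => complex.Re (f x)) +i*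
   Rintegral mu D (fun x => complex.Im (f x)))%C.

(* The integral of a vector-valued function, characterised by
   phi (int F) = int (phi o F) for all linear functionals phi; it is used for
   one-dimensional V only. *)
Definition vint (R : realType) d (T : measurableType d) (mu : {measure set T -> \bar R})
    (D : set T) (V : normedModType (Cx R)) (F : T -> V) : V :=
  xget 0 [set v | forall phi : {scalar V},
                    phi v = cint mu D (fun x => phi (F x))].

Definition Cc (R : realType) (X : topologicalType) : set (X -> Cx R) :=
  [set f | continuous f /\ compact (closure [set x | f x != 0])].

(* Pointwise module structure on dependent functions. *)
Section DependentFunctions.
Variables (K : pzRingType) (I : Type) (V : I -> lmodType K).

Definition dfun := forall i, V i.

HB.instance Definition _ := gen_eqMixin dfun.
HB.instance Definition _ := gen_choiceMixin dfun.

Implicit Types f g h : dfun.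

Let dadd f g : dfun := fun i => f i + g i.
Let dzero : dfun := fun i => 0.
Let dopp f : dfun := fun i => - f i.
Let dscale (a : K) f : dfun := fun i => a *: f i.

Let daddA : associative dadd.
Proof. by move=> f g h; apply/functional_extensionality_dep => i; exact: addrA. Qed.

Let daddC : commutative dadd.
Proof. by move=> f g; apply/functional_extensionality_dep => i; exact: addrC. Qed.

Let dadd0 : left_id dzero dadd.
Proof. by move=> f; apply/functional_extensionality_dep => i; exact: add0r. Qed.

Let daddN : left_inverse dzero dopp dadd.
Proof. by move=> f; apply/functional_extensionality_dep => i; exact: addNr. Qed.

HB.instance Definition _ := GRing.isZmodule.Build dfun daddA daddC dadd0 daddN.

Let dscaleA a b f : dscale a (dscale b f) = dscale (a * b) f.
Proof. by apply/functional_extensionality_dep => i; exact: scalerA. Qed.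

Let dscale1 : left_id 1 dscale.
Proof. by move=> f; apply/functional_extensionality_dep => i; exact: scale1r. Qed.

Let dscaleDr : right_distributive dscale +%R.
Proof. by move=> a f g; apply/functional_extensionality_dep => i; exact: scalerDr. Qed.

Let dscaleDl f : {morph dscale^~ f : a b / a + b}.
Proof. by move=> a b; apply/functional_extensionality_dep => i; exact: scalerDl. Qed.

HB.instance Definition _ :=
  GRing.Zmodule_isLmodule.Build K dfun dscaleA dscale1 dscaleDr dscaleDl.

End DependentFunctions.

(* Units are identified with identity arrows, so [src] and [rng] take values in
   arrows; [gcomp g h] is meaningful only when [src g = rng h]. *)
Record lc_groupoid := LCGroupoid {
  arrow :> ptopologicalType;
  src : arrow -> arrow;
  rng : arrow -> arrow;
  ginv : arrow -> arrow;
  gcomp : arrow -> arrow -> arrow;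
  src_src : forall g, src (src g) = src g;
  rng_src : forall g, rng (src g) = src g;
  src_rng : forall g, src (rng g) = rng g;
  rng_rng : forall g, rng (rng g) = rng g;
  src_gcomp : forall g h, src g = rng h -> src (gcomp g h) = src h;
  rng_gcomp : forall g h, src g = rng h -> rng (gcomp g h) = rng g;
  compA : forall g h k, src g = rng h -> src h = rng k ->
    gcomp g (gcomp h k) = gcomp (gcomp g h) k;
  comp_rng : forall g, gcomp (rng g) g = g;
  comp_src : forall g, gcomp g (src g) = g;
  src_inv : forall g, src (ginv g) = rng g;
  rng_inv : forall g, rng (ginv g) = src g;
  comp_inv_l : forall g, gcomp (ginv g) g = src g;
  comp_inv_r : forall g, gcomp g (ginv g) = rng g;
  groupoid_hausdorff : hausdorff_space arrow;
  groupoid_locally_compact : locally_compact [set: arrow];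
  src_continuous : continuous src;
  rng_continuous : continuous rng;
  inv_continuous : continuous ginv;
  comp_continuous : {within [set p : arrow * arrow | src p.1 = rng p.2],
    continuous (fun p => gcomp p.1 p.2)}
}.

Definition units (G : lc_groupoid) : set G := [set x | rng x = x].
Definition rfiber (G : lc_groupoid) (x : G) : set G := [set g | rng g = x].
Definition sfiber (G : lc_groupoid) (x : G) : set G := [set g | src g = x].

Definition borel (X : ptopologicalType) : measurableType _ :=
  g_sigma_algebraType (@open X).

Definition radon (R : realType) (X : ptopologicalType)
    (mu : {measure set (borel X) -> \bar R}) : Prop :=
  [/\ forall K : set X, compact K -> (mu K < +oo)%E,
      forall A : set (borel X), measurable A ->
        mu A = ereal_inf [set mu U | U in [set U : set X | open U /\ A `<=` U]]
    & forall U : set X, open U ->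
        mu U = ereal_sup [set mu K | K in [set K : set X | compact K /\ K `<=` U]]].

(* The measure [haar x] is relevant only for units x. *)
Record haar_system (R : realType) (G : lc_groupoid) := HaarSystem {
  haar :> G -> {measure set (borel G) -> \bar R};
  haar_radon : forall x, units x -> radon (haar x);
  haar_support : forall x, units x -> forall U : set G, open U ->
    (haar x U = 0%E <-> U `&` rfiber x = set0);
  haar_continuous : forall f : G -> Cx R, Cc f ->
    {within @units G, continuous (fun x => cint (haar x) (rfiber x) f)};
  haar_invariant : forall f : G -> Cx R, Cc f -> forall g,
    cint (haar (src g)) (rfiber (src g)) (fun h => f (gcomp g h)) =
    cint (haar (rng g)) (rfiber (rng g)) f
}.

(* S |-> alpha^x (S^-1) *)
Definition haar_tilde (R : realType) (G : lc_groupoid) (alpha : haar_system R G)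
    (x : G) : set (borel G) -> \bar R :=
  pushforward (alpha x) (@ginv G : borel G -> borel G).

(* [total_space] is the disjoint union of the fibres, with the topology of the field:
   [pt g] includes the fibre over g, and [vec y] is the point y seen in the fibre
   over [base y].  In [lb_trivial], e is a local frame and k its coordinate: they
   give mutually inverse, fibrewise linear homeomorphisms between U x C and the
   part of [total_space] over U.  In particular every fibre is one-dimensional, hence
   complete. *)
Record line_bundle (R : realType) (X : topologicalType) := LineBundle {
  fib : X -> normedModType (Cx R);
  total_space : topologicalType;
  pt : forall g, fib g -> total_space;
  base : total_space -> X;
  vec : forall y : total_space, fib (base y);
  base_pt : forall g (a : fib g), base (pt a) = g;
  pt_vec : forall y, pt (vec y) = y;
  pt_inj : forall g, injective (@pt g);
  base_continuous : continuous base;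
  norm_continuous : continuous (fun y => `|vec y| : Cx R);
  lb_trivial : forall g0 : X,
    exists (U : set X) (e : forall g, fib g) (k : total_space -> Cx R),
    [/\ open U /\ U g0,
        {within U `*` [set: Cx R],
          continuous (fun p : X * Cx R => pt (p.2 *: e p.1))},
        {within base @^-1` U, continuous k},
        forall y, U (base y) -> pt (k y *: e (base y)) = y
      & forall g c, U g -> k (pt (c *: e g)) = c]
}.

Arguments pt {R X l} [g].
Arguments base {R X l}.
Arguments vec {R X l}.

(* The vector of the fibre over g given by a point y over g. *)
Definition fib_at (R : realType) (X : topologicalType) (L : line_bundle R X)
    (g : X) (y : total_space L) : fib L g :=
  match pselect (base y = g) with
  | left e => eq_rect (base y) (fun h => fib L h : Type) (vec y) g e
  | right _ => 0
  end.

(* The unit of the one-dimensional C*-algebra L_x, x a unit: it is the only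
   nonzero idempotent, and c |-> c *: 1_x is the identification of L_x with the
   complex numbers. *)
Definition unit_vec (R : realType) (G : lc_groupoid) (L : line_bundle R G)
    (mul : forall g h, fib L g -> fib L h -> fib L (gcomp g h)) (x : G) : fib L x :=
  xget 0 [set e | e != 0 /\ pt (mul x x e e) = pt e].

(* For composable g and h, [fmul] is the map L_g x L_h -> L_gh; its values are
   irrelevant otherwise.  Identities between vectors in fibres over provably
   equal arrows are stated in the total space. *)
Record fell_line_bundle (R : realType) (G : lc_groupoid) := FellLineBundle {
  bundle :> line_bundle R G;
  fmul : forall g h, fib bundle g -> fib bundle h -> fib bundle (gcomp g h);
  fstar : forall g, fib bundle g -> fib bundle (ginv g);
  fmul_linear_l : forall g h, src g = rng h -> forall c (a a' : fib bundle g) b,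
    fmul (c *: a + a') b = c *: fmul a b + fmul (h := h) a' b;
  fmul_linear_r : forall g h, src g = rng h -> forall c a (b b' : fib bundle h),
    fmul a (c *: b + b') = c *: fmul a b + fmul (g := g) a b';
  fstar_conj_linear : forall g c (a b : fib bundle g),
    fstar (c *: a + b) = Num.conj c *: fstar a + fstar b;
  fmul_continuous :
    {within [set p : total_space bundle * total_space bundle | src (base p.1) = rng (base p.2)],
      continuous (fun p => pt (fmul (vec p.1) (vec p.2)))};
  fstar_continuous : continuous (fun y : total_space bundle => pt (fstar (vec y)));
  fmulA : forall g h k, src g = rng h -> src h = rng k ->
    forall (a : fib bundle g) (b : fib bundle h) (c : fib bundle k),
    pt (fmul a (fmul b c)) = pt (fmul (fmul a b) c);
  fstar_mul : forall g h, src g = rng h ->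
    forall (a : fib bundle g) (b : fib bundle h),
    pt (fstar (fmul a b)) = pt (fmul (fstar b) (fstar a));
  fstarK : forall g (a : fib bundle g), pt (fstar (fstar a)) = pt a;
  fmul_norm : forall g h, src g = rng h ->
    forall (a : fib bundle g) (b : fib bundle h), `|fmul a b| <= `|a| * `|b|;
  fmul_star_norm : forall g (a : fib bundle g), `|fmul (fstar a) a| = `|a| ^+ 2;
  fmul_star_ge0 : forall g (a : fib bundle g), exists2 t : Cx R, 0 <= t &
    pt (fmul (fstar a) a) = pt (t *: unit_vec fmul (src g))
}.

(* The complex number c such that y = c 1_x, for y over a unit x. *)
Definition fib_scalar (R : realType) (G : lc_groupoid) (L : fell_line_bundle R G)
    (y : total_space L) : Cx R :=
  xget 0 [set c | pt (c *: unit_vec (@fmul _ _ L) (base y)) = y].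

(* A *-algebra is given by its set of elements [sa_dom] inside a vector space on
   which total operations are defined; the operations are meaningful on [sa_dom]
   only. *)
Record star_algebra (R : realType) := StarAlgebra {
  sa_car :> lmodType (Cx R);
  sa_dom : set sa_car;
  sa_mul : sa_car -> sa_car -> sa_car;
  sa_star : sa_car -> sa_car
}.

Arguments sa_dom {R} s _.

Definition star_hom (R : realType) (P Q : star_algebra R) (phi : P -> Q) : Prop :=
  [/\ set_fun (sa_dom P) (sa_dom Q) phi,
      forall c f g, sa_dom P f -> sa_dom P g -> phi (c *: f + g) = c *: phi f + phi g,
      forall f g, sa_dom P f -> sa_dom P g ->
        phi (sa_mul f g) = sa_mul (phi f) (phi g)
    & forall f, sa_dom P f -> phi (sa_star f) = sa_star (phi f)].

Definition star_iso (R : realType) (P Q : star_algebra R) (phi : P -> Q) : Prop :=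
  star_hom phi /\ set_bij (sa_dom P) (sa_dom Q) phi.

Record cstar_algebra (R : realType) := CStarAlgebra {
  ca_car :> completeNormedModType (Cx R);
  ca_mul : ca_car -> ca_car -> ca_car;
  ca_star : ca_car -> ca_car;
  ca_mul_linear_l : forall c a a' b,
    ca_mul (c *: a + a') b = c *: ca_mul a b + ca_mul a' b;
  ca_mul_linear_r : forall c a b b',
    ca_mul a (c *: b + b') = c *: ca_mul a b + ca_mul a b';
  ca_mulA : associative ca_mul;
  ca_star_conj_linear : forall c a b,
    ca_star (c *: a + b) = Num.conj c *: ca_star a + ca_star b;
  ca_starK : involutive ca_star;
  ca_star_mul : forall a b, ca_star (ca_mul a b) = ca_mul (ca_star b) (ca_star a);
  ca_mul_norm : forall a b, `|ca_mul a b| <= `|a| * `|b|;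
  ca_star_norm : forall a, `|ca_mul (ca_star a) a| = `|a| ^+ 2
}.

Definition cstar_sub (R : realType) (A : cstar_algebra R) (D : set A) :
    star_algebra R :=
  StarAlgebra D (@ca_mul _ A) (@ca_star _ A).

Definition cstar_seminorm (R : realType) (P : star_algebra R) (N : P -> R) : Prop :=
  [/\ forall f, sa_dom P f -> 0 <= N f,
      forall f g, sa_dom P f -> sa_dom P g -> N (f + g) <= N f + N g,
      forall (c : Cx R) f, sa_dom P f -> N (c *: f) = rnorm c * N f,
      forall f g, sa_dom P f -> sa_dom P g -> N (sa_mul f g) <= N f * N g
    & forall f, sa_dom P f -> N (sa_mul (sa_star f) f) = N f ^+ 2].

Definition bounded_cstar_seminorm (R : realType) (P : star_algebra R)
    (Inorm : P -> \bar R) (N : P -> R) : Prop :=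
  cstar_seminorm N /\ forall f, sa_dom P f -> ((N f)%:E <= Inorm f)%E.

Record cstar_completion (R : realType) (P : star_algebra R) (Inorm : P -> \bar R) :=
  CStarCompletion {
  completed :> cstar_algebra R;
  embed : P -> completed;
  embed_hom : star_hom (Q := cstar_sub [set: completed]) embed;
  embed_dense : dense (embed @` sa_dom P);
  embed_seminorm : bounded_cstar_seminorm Inorm (fun f => rnorm (embed f));
  embed_largest : forall N, bounded_cstar_seminorm Inorm N ->
    forall f, sa_dom P f -> N f <= rnorm (embed f)
}.

Section BundleAlgebra.
Variables (R : realType) (G : lc_groupoid) (alpha : haar_system R G).
Variable L : fell_line_bundle R G.

Definition Sect := dfun (fun g : G => fib L g : lmodType (Cx R)).

Definition Cc_sect : set Sect :=
  [set f | continuous (fun g => pt (f g)) /\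
           compact (closure [set g | f g != 0])].

(* (xi * eta)(g) = int xi(h) eta(h^-1 g) d alpha^{r(g)}(h) *)
Definition sect_conv (xi eta : Sect) : Sect := fun g =>
  vint (alpha (rng g)) (rfiber (rng g))
    (fun h => fib_at g (pt (fmul (xi h) (eta (gcomp (ginv h) g))))).

(* xi^*(g) = xi(g^-1)^* *)
Definition sect_star (xi : Sect) : Sect := fun g =>
  fib_at g (pt (fstar (xi (ginv g)))).

Definition sect_Inorm (xi : Sect) : \bar R :=
  maxe
    (ereal_sup [set (\int[alpha x]_(g in rfiber x) (rnorm (xi g))%:E)%E
               | x in @units G])
    (ereal_sup [set (\int[haar_tilde alpha x]_(g in sfiber x) (rnorm (xi g))%:E)%E
               | x in @units G]).

Definition CcGL : star_algebra R := StarAlgebra Cc_sect sect_conv sect_star.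

End BundleAlgebra.

Section CircleExtension.
Variables (R : realType) (G : lc_groupoid) (alpha : haar_system R G).
Variable L : fell_line_bundle R G.

Definition Sigma_set : set (total_space L) :=
  [set y | pt (fmul (fstar (vec y)) (vec y)) =
           pt (unit_vec (@fmul _ _ L) (src (base y)))].

(* The subspace topology is that of [set_type]. *)
Definition Sigma : topologicalType := set_type Sigma_set.

Definition sig_base (y : Sigma) : G := base (val y : total_space L).

(* Sigma is closed under these operations (for composable y and w, and for z in
   the circle), so that the default value of [insubd] is not used. *)
Definition sig_mul (y w : Sigma) : Sigma :=
  insubd y (pt (fmul (vec (val y : total_space L)) (vec (val w : total_space L)))).
Definition sig_inv (y : Sigma) : Sigma :=
  insubd y (pt (fstar (vec (val y : total_space L)))).
Definition sig_act (z : Cx R) (y : Sigma) : Sigma :=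
  insubd y (pt (z *: vec (val y : total_space L))).

Definition circle : set (Cx R) := [set z | `|z| = 1].

Definition circle_int (F : Cx R -> Cx R) : Cx R :=
  cint lebesgue_measure `[0%R, 1%R]
    (fun t : R => F (cos (2 * pi * t) +i* sin (2 * pi * t))%C).

(* The integral over the circle of F(z . y) for any y of Sigma over g: it does
   not depend on y. *)
Definition sig_fibre_int (F : Sigma -> Cx R) (g : G) : Cx R :=
  xget 0 [set c | exists2 y : Sigma, sig_base y = g &
                    c = circle_int (fun z => F (sig_act z y))].

Definition sig_haar (x : G) (F : Sigma -> Cx R) : Cx R :=
  cint (alpha x) (rfiber x) (sig_fibre_int F).

Definition sig_conv (F H : Sigma -> Cx R) : Sigma -> Cx R := fun y =>
  sig_haar (rng (sig_base y)) (fun w => F w * H (sig_mul (sig_inv w) y)).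

Definition sig_star (F : Sigma -> Cx R) : Sigma -> Cx R := fun y =>
  Num.conj (F (sig_inv y)).

Definition sig_Inorm (F : Sigma -> Cx R) : \bar R :=
  maxe
    (ereal_sup [set (complex.Re (sig_haar x (fun y => `|F y| : Cx R)))%:E
               | x in @units G])
    (ereal_sup [set (complex.Re (sig_haar x (fun y => `|F (sig_inv y)|)))%:E
               | x in @units G]).

Definition CcSigma : star_algebra R :=
  StarAlgebra (@Cc R Sigma : set (Sigma -> Cx R)) sig_conv sig_star.

Definition mu_shift (z : Cx R) (F : Sigma -> Cx R) : Sigma -> Cx R := fun y =>
  F (sig_act z^-1 y).

Definition CcSigma1 : star_algebra R :=
  StarAlgebra
    [set F : Sigma -> Cx R | Cc F /\ forall z, circle z -> mu_shift z F = z *: F]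
    sig_conv sig_star.

Section Completed.
Variable B : cstar_completion (P := CcSigma) sig_Inorm.

(* The continuous extension of mu_z to C*(Sigma), unique by density. *)
Definition mu_ext (z : Cx R) : B -> B :=
  xget (id : B -> B) [set m : B -> B | continuous m /\
    forall F, sa_dom CcSigma F -> m (embed B F) = embed B (mu_shift z F)].

Definition CstarSigma1 : star_algebra R :=
  cstar_sub [set b : B | forall z, circle z -> mu_ext z b = z *: b].

End Completed.

(* f~(x) = x^* f(g) for x over g *)
Definition tilde (f : Sect L) : Sigma -> Cx R := fun x =>
  fib_scalar (pt (fmul (fstar (vec (val x : total_space L))) (f (sig_base x)))).

End CircleExtension.

(* Main.v *)
Require Import Defs.
From HB Require Import structures.
From mathcomp Require Import all_boot all_order all_algebra complex.
From mathcomp Require Import all_classical all_reals all_analysis.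
From mathcomp Require Import measurable_realfun ring lra.

Set Implicit Arguments.
Unset Strict Implicit.
Unset Printing Implicit Defensive.

Import Order.TTheory GRing.Theory Num.Theory.
Import numFieldNormedType.Exports.

Local Open Scope classical_set_scope.
Local Open Scope ring_scope.

(** An element y of Sigma over g is a unit vector of the line L_g, hence a basis,
    and tilde f y is the coordinate of f g in that basis (tildeE).  Rotating y by z
    divides the coordinate by z, and conversely a function on Sigma with this
    equivariance is the coordinate function of one section (untilde).  So the
    transform is a bijection between sections and equivariant functions; local
    frames of L show that it preserves continuity, and properness of Sigma -> G,
    whose fibres are circles, that it preserves compact supports.  It preserves
    products because f(h) g(h^-1 k) = F(w) H(w^-1 y) y for w over h and y over k,
    where F and H are the transforms (tilde_conv): the coefficient is constant
    along the orbit of w, so that the integral over the circle in the Haar system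
    of Sigma does nothing.  That these products are again compactly supported and
    continuous comes from the continuity axiom of Haar systems, after an extension
    of the integrand from one range fibre to the groupoid (conv_continuous).

    For the completions, let deg1 F be the component of F of degree one for the
    action of the circle.  It is a *-homomorphism from all of C_c(Sigma) onto the
    equivariant functions which fixes these (deg1_conv, deg1_star, deg1_id) and, by
    the triangle inequality for the integral over the circle, does not increase the
    I-norm; nor does the transform.  Both C*-norms are the largest ones bounded by
    their I-norms.  Pulling the norm of C*(Sigma) back along the transform, and the
    norm of C*(G, L) back along untilde composed with deg1, therefore gives the two
    inequalities which say that the transform is isometric (rnorm_embed_tilde).  It
    extends by density to an isometric *-homomorphism into the degree one part.

    The extension is onto (CstarSigma1_approx): an element b on which every rotation
    mu_z is multiplication by z equals the mean of z^-1 mu_z(b) over any finite group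
    of roots of unity.  Apply the same mean to an approximation F of b in
    C_c(Sigma).  Rotations are isometric, so the result still approximates b; as the
    order of the roots of unity grows, the means of F converge to deg1 F uniformly,
    with supports over a fixed compact set of arrows.  Haar measures of a compact
    set are bounded uniformly over the units (haar_compact_bound), so this is
    convergence in the I-norm, and b is a limit of transforms.

    Integrals over the circle are treated throughout through their means over roots
    of unity, which are exactly invariant under inversion and under the rotations
    of the corresponding finite group. *)

(** * Norms and complex numbers *)
Section RealNorm.
Variables (R : realType) (V : normedModType (Cx R)).
Implicit Types (v w : V) (c : Cx R).

Lemma normE v : `|v| = (rnorm v)%:C%C :> Cx R.
Proof. by rewrite /rnorm RRe_real// normr_real. Qed.

Lemma rnorm_ge0 v : 0 <= rnorm v.
Proof. by have := normr_ge0 v; rewrite normE; rewrite (_ : 0 = 0%:C%C)// lecR. Qed.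

Lemma rnorm0 : rnorm (0 : V) = 0.
Proof. by rewrite /rnorm normr0. Qed.

Lemma rnorm_eq0 v : rnorm v = 0 -> v = 0.
Proof. by move=> v0; apply/eqP; rewrite -normr_eq0 normE v0. Qed.

Lemma rnormD v w : rnorm (v + w) <= rnorm v + rnorm w.
Proof. by have := ler_normD v w; rewrite !normE -raddfD/= lecR. Qed.

Lemma rnormN v : rnorm (- v) = rnorm v.
Proof. by rewrite /rnorm normrN. Qed.

Lemma rnormB v w : rnorm (v - w) <= rnorm v + rnorm w.
Proof. by rewrite -(rnormN w); exact: rnormD. Qed.

Lemma rnormZ c v : rnorm (c *: v) = rnorm c * rnorm v.
Proof.
have := normrZ c v; rewrite !normE -rmorphM/= => /complexI ->//.
Qed.

Lemma rnorm_distD u v w : rnorm (v - w) <= rnorm (v - u) + rnorm (u - w).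
Proof. by rewrite -[v - w](subrKA u) ; exact: rnormD. Qed.

Lemma rnorm_distC v w : rnorm (v - w) = rnorm (w - v).
Proof. by rewrite -rnormN opprB. Qed.

Lemma rnorm_dist_dist v w : `|rnorm v - rnorm w| <= rnorm (v - w).
Proof.
have h1 := rnormD (v - w) w; have h2 := rnormD (w - v) v.
move: h1 h2; rewrite !subrK (rnorm_distC w v) => h1 h2.
by rewrite ler_norml; apply/andP; split; lra.
Qed.

Lemma cvg_rnormP (T : Type) (F : set_system T) {FF : Filter F} (f : T -> V) v :
  f @ F --> v <-> forall e : R, 0 < e -> \forall x \near F, rnorm (v - f x) < e.
Proof.
split=> [/cvgrPdist_lt fv e e0|fv].
  have /fv : 0 < e%:C%C :> Cx R by rewrite (_ : 0 = 0%:C%C)// ltcR.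
  by apply: filterS => x; rewrite normE ltcR.
apply/cvgrPdist_lt => /= e; rewrite ltcE/= => /andP[/eqP ie re].
apply: filterS (fv _ re) => x; rewrite normE.
by rewrite ltcE/= ie eqxx.
Qed.

Lemma near_rnorm v (e : R) : 0 < e -> \forall w \near v, rnorm (v - w) < e.
Proof. by move=> e0; have [/(_ cvg_id) + _] := @cvg_rnormP V (nbhs v) _ id v; exact. Qed.

End RealNorm.

Section ComplexNumbers.
Variable R : realType.
Implicit Types (a b z w : Cx R) (r s : R).

Lemma rnormM z w : rnorm (z * w) = rnorm z * rnorm w.
Proof. exact: (rnormZ (V := Cx R)). Qed.

Lemma rnorm1 : rnorm (1 : Cx R) = 1.
Proof. by rewrite /rnorm normr1. Qed.

Lemma rnormV z : rnorm z^-1 = (rnorm z)^-1.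
Proof.
have [->|z0] := eqVneq z 0; first by rewrite invr0 rnorm0 invr0.
have r0 : rnorm z != 0 by apply: contra_neq z0 => /rnorm_eq0.
by apply: (mulfI r0); rewrite -rnormM !divff// rnorm1.
Qed.

Lemma rnormE z : rnorm z = Num.sqrt (complex.Re z ^+ 2 + complex.Im z ^+ 2).
Proof. by rewrite /rnorm normc_def. Qed.

Lemma rnorm_real r : rnorm (r%:C%C : Cx R) = `|r|.
Proof. by rewrite rnormE /= expr0n addr0 sqrtr_sqr. Qed.

Lemma le_Re_rnorm z : `|complex.Re z| <= rnorm z.
Proof. by rewrite rnormE -sqrtr_sqr ler_wsqrtr// lerDl sqr_ge0. Qed.

Lemma le_Im_rnorm z : `|complex.Im z| <= rnorm z.
Proof. by rewrite rnormE -sqrtr_sqr ler_wsqrtr// lerDr sqr_ge0. Qed.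

Lemma rnorm_le_ReIm z : rnorm z <= `|complex.Re z| + `|complex.Im z|.
Proof.
rewrite [z in leLHS]complexE; apply: (le_trans (rnormD (_ : Cx R) _)).
by rewrite rnormM !rnorm_real rnormE/= expr0n expr1n add0r sqrtr1 mul1r.
Qed.

Lemma rnorm_conj z : rnorm (Num.conj z) = rnorm z.
Proof. by rewrite /rnorm; congr complex.Re; exact: norm_conjC. Qed.

Lemma Re_add : forall z w, complex.Re (z + w) = complex.Re z + complex.Re w.
Proof. by move=> [a b] [c d]. Qed.
Lemma Im_add : forall z w, complex.Im (z + w) = complex.Im z + complex.Im w.
Proof. by move=> [a b] [c d]. Qed.
Lemma Re_opp : forall z, complex.Re (- z) = - complex.Re z.
Proof. by move=> [a b]. Qed.
Lemma Im_opp : forall z, complex.Im (- z) = - complex.Im z.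
Proof. by move=> [a b]. Qed.
Lemma Re_mul z w : complex.Re (z * w) = complex.Re z * complex.Re w - complex.Im z * complex.Im w.
Proof. by case: z w => [a b] [c d]. Qed.
Lemma Im_mul z w : complex.Im (z * w) = complex.Re z * complex.Im w + complex.Im z * complex.Re w.
Proof. by case: z w => [a b] [c d]. Qed.

Lemma Cx_ext z w : complex.Re z = complex.Re w -> complex.Im z = complex.Im w -> z = w.
Proof. by case: z w => [a b] [c d] /= -> ->. Qed.

Lemma continuous_Re : continuous (fun z : Cx R => complex.Re z : R).
Proof.
move=> z; apply/(@cvgrPdist_lt _ _ _ (nbhs z) (nbhs_filter z)) => e e0.
apply: filterS (near_rnorm (V := Cx R) z e0) => w; apply: le_lt_trans; rewrite -Re_opp -Re_add; exact: le_Re_rnorm.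
Qed.

Lemma continuous_Im : continuous (fun z : Cx R => complex.Im z : R).
Proof.
move=> z; apply/(@cvgrPdist_lt _ _ _ (nbhs z) (nbhs_filter z)) => e e0.
apply: filterS (near_rnorm (V := Cx R) z e0) => w; apply: le_lt_trans; rewrite -Im_opp -Im_add; exact: le_Im_rnorm.
Qed.

Lemma cvg_complex (T : Type) (F : set_system T) {FF : Filter F} (f g : T -> R) r s :
  f @ F --> r -> g @ F --> s ->
  (fun x => (f x +i* g x)%C : Cx R) @ F --> ((r +i* s)%C : Cx R).
Proof.
move=> /cvgrPdist_lt fr /cvgrPdist_lt gs; apply/cvg_rnormP => e e0.
have e2 : 0 < e / 2 by lra.
near=> x; apply: (le_lt_trans (rnorm_le_ReIm _)) => /=.
have : `|r - f x| < e / 2 by near: x; exact: fr.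
have : `|s - g x| < e / 2 by near: x; exact: gs.
lra.
Unshelve. all: by end_near.
Qed.

Lemma continuous_rnorm (V : normedModType (Cx R)) : continuous (fun v : V => rnorm v : R).
Proof.
move=> v; apply/cvgrPdist_lt => /= e e0.
by apply: filterS (near_rnorm v e0) => w; apply: le_lt_trans; exact: rnorm_dist_dist.
Qed.

End ComplexNumbers.

(** * Integration over the circle *)
Section CirclePath.
Variable R : realType.
Implicit Types (s t : R) (z w : Cx R).

(** The path along which circle integrals are defined: parameter 1 is one full turn. *)
Definition turn t : Cx R := (cos (2 * pi * t) +i* sin (2 * pi * t))%C.

Lemma turnD s t : turn (s + t) = turn s * turn t.
Proof.
apply: Cx_ext; rewrite ?Re_mul ?Im_mul/= mulrDr ?cosD// sinD; lra.
Qed.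

Lemma turn0 : turn 0 = 1.
Proof. by apply: Cx_ext; rewrite /= mulr0 ?cos0 ?sin0. Qed.

Lemma turn1 : turn 1 = 1.
Proof.
by apply: Cx_ext; rewrite /= mulr1 mulr_natl ?cos2pi ?sin2pi.
Qed.

Lemma circleP z : circle z <-> rnorm z = 1.
Proof.
split; first by rewrite /circle/= /rnorm => ->.
move=> z1; rewrite /circle/=.
by have := normE (V := Cx R) z; rewrite z1.
Qed.

Lemma circle_turn t : circle (turn t).
Proof. by apply/circleP; rewrite rnormE/= cos2Dsin2 sqrtr1. Qed.

Lemma circleM z w : circle z -> circle w -> circle (z * w).
Proof. by move=> /circleP z1 /circleP w1; apply/circleP; rewrite rnormM z1 w1 mulr1. Qed.

Lemma circleV z : circle z -> circle z^-1.
Proof. by move=> /circleP z1; apply/circleP; rewrite rnormV z1 invr1. Qed.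

Lemma circle1 : circle (1 : Cx R).
Proof. by apply/circleP; rewrite rnorm1. Qed.

Lemma circle_neq0 z : circle z -> z != 0.
Proof.
move=> /circleP z1; apply/eqP => z0; move: z1; rewrite z0 rnorm0 => /eqP.
by rewrite eq_sym oner_eq0.
Qed.

Lemma circle_conj z : circle z -> Num.conj z = z^-1.
Proof.
move=> z1; apply: (mulfI (circle_neq0 z1)); rewrite divff ?circle_neq0//.
by have := normCK z; rewrite z1 expr1n => <-.
Qed.

Lemma turnN t : turn (- t) = (turn t)^-1.
Proof.
apply: (mulfI (circle_neq0 (circle_turn t))).
by rewrite -turnD subrr turn0 divff// circle_neq0//; exact: circle_turn.
Qed.

Lemma circle_turn_surj z : circle z -> exists2 t, 0 <= t <= 1 & z = turn t.
Proof.
case: z => a b /circleP; rewrite rnormE/= => ab.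
have ab1 : a ^+ 2 + b ^+ 2 = 1.
  by rewrite -[LHS]sqr_sqrtr ?ab ?expr1n// addr_ge0// sqr_ge0.
have pi0 : 0 < pi :> R by exact: pi_gt0.
have p2 : 2 * pi != 0 :> R by rewrite gt_eqF//; lra.
have a1 : -1 <= a <= 1.
  rewrite -ler_norml -(@ler_pXn2r _ 2)// ?nnegrE// expr1n -normrX ger0_norm ?sqr_ge0//.
  by rewrite -ab1 lerDl sqr_ge0.
have sa : Num.sqrt (1 - a ^+ 2) = `|b|.
  by rewrite -sqrtr_sqr; congr Num.sqrt; lra.
have ca : cos (acos a) = a by rewrite acosK// in_itv.
have ge0 := acos_ge0 a1; have lepi := acos_lepi a1.
have [b0|b0] := leP 0 b.
  exists (acos a / (2 * pi)).
    by rewrite divr_ge0 ?ler_pdivrMr; lra.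
  rewrite /turn [2 * pi * _]mulrC divfK//.
  by rewrite ca sin_acos// sa ger0_norm.
exists (1 - acos a / (2 * pi)).
  have : 0 <= acos a / (2 * pi) by rewrite divr_ge0; lra.
  have : acos a / (2 * pi) <= 1 by rewrite ler_pdivrMr; lra.
  lra.
rewrite /turn mulrBr mulr1 [2 * pi * (_ / _)]mulrC divfK//.
rewrite addrC mulr_natl cosD2pi sinD2pi cosN sinN ca sin_acos// sa ltr0_norm//.
by rewrite opprK.
Qed.

Lemma continuous_turn : continuous turn.
Proof.
move=> t; apply: cvg_complex.
  apply: (@continuous_comp _ _ _ (fun t => 2 * pi * t) cos); last exact: continuous_cos.
  exact: mulrl_continuous.
apply: (@continuous_comp _ _ _ (fun t => 2 * pi * t) sin); last exact: continuous_sin.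
exact: mulrl_continuous.
Qed.

Lemma circle_compact : compact (@circle R).
Proof.
have -> : @circle R = turn @` `[0%R, 1%R].
  apply/seteqP; split=> [z /circle_turn_surj[t t01 ->]|_ [t _ <-]]; last exact: circle_turn.
  by exists t => //=; rewrite in_itv.
apply: continuous_compact; last exact: segment_compact.
by apply: continuous_subspaceT; exact: continuous_turn.
Qed.

End CirclePath.

Section RiemannSums.
Variable R : realType.
Implicit Types (f : R -> R).

Lemma continuous_itv_integrable f (a b : R) : continuous f ->
  (@lebesgue_measure R).-integrable `[a, b] (EFin \o f).
Proof.
move=> cf; apply: continuous_compact_integrable; first exact: segment_compact.
exact: continuous_subspaceT.
Qed.

Lemma Rintegral_near_cst f (a h e : R) : continuous f -> 0 <= h ->
  (forall t, a <= t <= a + h -> `|f t - f a| <= e) ->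
  `|Rintegral (@lebesgue_measure R) `]a, a + h] f - h * f a| <= e * h.
Proof.
move=> cf h0 fe.
have mh : fine (lebesgue_measure `]a, (a + h)]) = h.
  rewrite lebesgue_measure_itv/= lte_fin; case: ltP => [ah|ah] /=; lra.
have itg g : continuous g -> (@lebesgue_measure R).-integrable `]a, a + h] (EFin \o g).
  move=> cg; apply: integrableS (continuous_itv_integrable a (a + h) cg) => //.
  exact: subset_itv_oc_cc.
have -> : h * f a = Rintegral (@lebesgue_measure R) `]a, a + h] (fun=> f a).
  by rewrite Rintegral_cst// mh mulrC.
have cfa : continuous (fun x => f x - f a).
  by move=> x; apply: cvgB; [exact: cf|exact: cvg_cst].
rewrite -RintegralB//; [|exact: itg|by apply: itg; exact: cst_continuous].
apply: (le_trans (le_normr_Rintegral _ _)) => //; first by apply: itg; exact: cfa.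
have -> : e * h = Rintegral (@lebesgue_measure R) `]a, a + h] (fun=> e).
  by rewrite Rintegral_cst// mh.
apply: le_Rintegral => //; [|by apply: itg; exact: cst_continuous|].
  by apply: itg => x; apply: (@cvg_norm _ _ _ (nbhs x)); exact: cfa.
by move=> t /=; rewrite in_itv/= => /andP[/ltW ? ?]; apply: fe; apply/andP.
Qed.

Lemma riemann_sum_le f (h e : R) (m : nat) : continuous f -> 0 <= h ->
  (forall s t, `|s - t| <= h -> `|f s - f t| <= e) ->
  `|Rintegral (@lebesgue_measure R) `[0, m%:R * h] f - \sum_(j < m) h * f (j%:R * h)|
    <= e * (m%:R * h).
Proof.
move=> cf h0 fe; elim: m => [|m IH].
  by rewrite big_ord0 !mul0r set_itv1 Rintegral_set1 subrr normr0 mulr0.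
have mh0 : 0 <= m%:R * h by rewrite mulr_ge0.
rewrite big_ord_recr/= -natr1 mulrDl mul1r.
have step := @Rintegral_itvB R f (BLeft 0) (BRight (m%:R * h + h)) (m%:R * h)
  (continuous_itv_integrable _ _ cf) _ _.
have := @Rintegral_near_cst f (m%:R * h) h e cf h0.
rewrite -step ?bnd_simp ?lerDl//.
set A := Rintegral _ _ _; set B := Rintegral _ _ _ in IH *; set S := \sum_(_ < _) _ in IH *.
move=> H; have {}H : `|A - B - h * f (m%:R * h)| <= e * h.
  by apply: H => t /andP[t1 t2]; apply: fe; rewrite ger0_norm; lra.
have -> : A - (S + h * f (m%:R * h)) = (B - S) + (A - B - h * f (m%:R * h)) by lra.
apply: (le_trans (ler_normD _ _)); lra.
Qed.

End RiemannSums.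

Section CircleMean.
Variable R : realType.
Implicit Types (s t d e : R) (z w : Cx R) (P Q : Cx R -> Cx R).

(** A modulus of continuity along rotations.  It passes unchanged to rotated and
    inverted functions, and one modulus can serve all orbits of a circle action. *)
Definition modulus P d e := forall s, `|s| < d ->
  forall z, circle z -> rnorm (P (turn s * z) - P z) <= e.

Definition circle_unif P := forall e, 0 < e -> exists2 d, 0 < d & modulus P d e.

Definition root_mean (n : nat) P : Cx R := n%:R^-1 * \sum_(j < n) P (turn (j%:R / n%:R)).

Lemma circle_intE P : circle_int P = cint (@lebesgue_measure R) `[0, 1] (fun t => P (turn t)).
Proof. by []. Qed.

Lemma circle_unif_continuous P : circle_unif P -> continuous (fun t => P (turn t)).
Proof.
move=> uP t; apply/(@cvg_rnormP R (Cx R) _ (nbhs t) (nbhs_filter t)) => e e0.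
have e2 : 0 < e / 2 by lra.
have [d d0 Pd] := uP _ e2; near=> s.
have := Pd (t - s) _ (turn s) (circle_turn s); rewrite -turnD subrK => H.
suff : rnorm (P (turn t) - P (turn s)) <= e / 2 by lra.
apply: H; near: s; exact: (@cvgr_dist_lt _ _ _ (nbhs t) _ id t cvg_id).
Unshelve. all: by end_near.
Qed.

(** The mean over the n-th roots of unity is a Riemann sum.  The factor 2 comes from
    treating real and imaginary parts separately. *)
Lemma circle_int_root_mean P d e n : circle_unif P -> modulus P d e -> (0 < n)%N -> n%:R^-1 < d ->
  rnorm (circle_int P - root_mean n P) <= 2 * e.
Proof.
move=> uP Pd n0 nd.
have cP := circle_unif_continuous uP.
have n0' : (n%:R : R) != 0 by rewrite pnatr_eq0 -lt0n.
have h0 : 0 <= (n%:R^-1 : R) by rewrite invr_ge0.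
have nh : n%:R * n%:R^-1 = 1 :> R by rewrite divff.
have key (g : Cx R -> R) : continuous g -> (forall z, `|g z| <= rnorm z) ->
    (forall z w, g (z - w) = g z - g w) ->
    `|Rintegral lebesgue_measure `[0, 1] (fun t => g (P (turn t))) -
      \sum_(j < n) n%:R^-1 * g (P (turn (j%:R / n%:R)))| <= e.
  move=> cg ng gB.
  have cgP : continuous (fun t => g (P (turn t))).
    by move=> t; apply: continuous_comp; [exact: cP|exact: cg].
  have := riemann_sum_le n (e := e) cgP h0; rewrite nh mulr1; apply => s t st.
  rewrite -gB; apply: (le_trans (ng _)).
  have := Pd (s - t) _ (turn t) (circle_turn t); rewrite -turnD subrK; apply.
  exact: le_lt_trans nd.
apply: (le_trans (rnorm_le_ReIm _)); rewrite mulr_natl mulr2n.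
have nRe : complex.Re (n%:R^-1 : Cx R) = n%:R^-1 /\ complex.Im (n%:R^-1 : Cx R) = 0.
  by rewrite -(rmorph_nat (real_complex R)) -fmorphV.
have sumRe (F : 'I_n -> Cx R) : complex.Re (\sum_(j < n) F j) = \sum_(j < n) complex.Re (F j).
  exact: (big_morph (fun z : Cx R => complex.Re z) (@Re_add R)).
have sumIm (F : 'I_n -> Cx R) : complex.Im (\sum_(j < n) F j) = \sum_(j < n) complex.Im (F j).
  exact: (big_morph (fun z : Cx R => complex.Im z) (@Im_add R)).
rewrite Re_add Im_add Re_opp Im_opp /root_mean Re_mul Im_mul nRe.1 nRe.2 !mul0r subr0 addr0 sumRe sumIm !mulr_sumr.
apply: lerD; apply: key.
- exact: continuous_Re.
- exact: le_Re_rnorm.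
- by move=> z w; rewrite Re_add Re_opp.
- exact: continuous_Im.
- exact: le_Im_rnorm.
- by move=> z w; rewrite Im_add Im_opp.
Qed.

End CircleMean.

Section CircleIntegral.
Variable R : realType.
Implicit Types (s t d e : R) (z w c : Cx R) (P Q : Cx R -> Cx R).

Lemma small_inv_nat d : 0 < d -> exists2 n, (0 < n)%N & n%:R^-1 < d.
Proof.
move=> d0; exists (Num.bound d^-1).
  by rewrite -(ltr_nat R) (le_lt_trans _ (archi_boundP _))// invr_ge0 ltW.
by rewrite invf_plt ?posrE ?archi_boundP ?invr_ge0 ?ltW.
Qed.

Lemma rnorm_le_eps (V : normedModType (Cx R)) (v : V) :
  (forall e, 0 < e -> rnorm v <= e) -> v = 0.
Proof.
move=> ve; apply: rnorm_eq0; apply/eqP; rewrite eq_le rnorm_ge0 andbT.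
by apply/ler_addgt0Pr => e e0; rewrite add0r ve.
Qed.

Lemma rnorm_nat n : rnorm (n%:R : Cx R) = n%:R.
Proof. by rewrite -(rmorph_nat (real_complex R)) rnorm_real normr_nat. Qed.

Lemma rnorm_sum n (F : 'I_n -> Cx R) : rnorm (\sum_(j < n) F j) <= \sum_(j < n) rnorm (F j).
Proof.
elim/big_ind2 : _ => [|a x b y ax b_y|//]; first by rewrite rnorm0.
by apply: (le_trans (rnormD _ _)); exact: lerD.
Qed.

Lemma rnorm_root_mean n P e : (0 < n)%N -> (forall z, circle z -> rnorm (P z) <= e) ->
  rnorm (root_mean n P) <= e.
Proof.
move=> n0 Pe; rewrite /root_mean rnormM rnormV rnorm_nat ler_pdivrMl ?ltr0n//.
apply: (le_trans (rnorm_sum _)); apply: (@le_trans _ _ (\sum_(j < n) e)).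
  by apply: ler_sum => j _; apply: Pe; exact: circle_turn.
by rewrite sumr_const card_ord mulr_natl.
Qed.

Lemma root_meanB n P Q : root_mean n P - root_mean n Q = root_mean n (fun z => P z - Q z).
Proof. by rewrite /root_mean -mulrBr sumrB. Qed.

Lemma root_meanZD n c P Q : root_mean n (fun z => c * P z + Q z) = c * root_mean n P + root_mean n Q.
Proof. by rewrite /root_mean big_split/= mulrDr -mulr_sumr mulrCA. Qed.

Lemma eq_root_mean n P Q : (forall z, circle z -> P z = Q z) -> root_mean n P = root_mean n Q.
Proof.
by move=> PQ; congr (_ * _); apply: eq_bigr => j _; apply: PQ; exact: circle_turn.
Qed.

Lemma root_mean_cst n P c : (0 < n)%N -> (forall z, circle z -> P z = c) -> root_mean n P = c.
Proof.
move=> n0 Pc; rewrite (eq_root_mean _ (Q := fun=> c))// /root_mean sumr_const card_ord -[c *+ n]mulr_natl mulrA.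
by rewrite mulVf ?mul1r// pnatr_eq0 -lt0n.
Qed.

Lemma eq_circle_int P Q : (forall z, circle z -> P z = Q z) -> circle_int P = circle_int Q.
Proof.
move=> PQ; rewrite !circle_intE.
by congr cint; apply/funext => t; apply: PQ; exact: circle_turn.
Qed.

Lemma sum_shift n (g : nat -> Cx R) k : (forall j, g (j + n)%N = g j) ->
  \sum_(j < n) g (j + k)%N = \sum_(j < n) g j.
Proof.
move=> gn; elim: k => [|k <-]; first by apply: eq_bigr => j _; rewrite addn0.
case: n gn => [|n] gn; first by rewrite !big_ord0.
rewrite big_ord_recr/= [RHS]big_ord_recl/= addrC; congr (_ + _).
  by rewrite addnS -addSn addnC gn add0n.
by apply: eq_bigr => j _; rewrite /bump/= add1n addnS addSn.
Qed.

Lemma root_mean_rot n P k : (0 < n)%N -> root_mean n (fun z => P (turn (k%:R / n%:R) * z)) = root_mean n P.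
Proof.
move=> n0; congr (_ * _); pose g (j : nat) := P (turn (j%:R / n%:R)).
have n0' : (n%:R : R) != 0 by rewrite pnatr_eq0 -lt0n.
rewrite -[RHS](@sum_shift n g k).
  by apply: eq_bigr => j _; rewrite /g -turnD -mulrDl -natrD addnC.
by move=> j; rewrite /g natrD mulrDl divff// turnD turn1 mulr1.
Qed.

Lemma root_mean_inv n P : (0 < n)%N -> root_mean n (fun z => P z^-1) = root_mean n P.
Proof.
move=> n0; congr (_ * _); pose g (j : nat) := P (turn (j%:R / n%:R)).
have n0' : (n%:R : R) != 0 by rewrite pnatr_eq0 -lt0n.
rewrite -[RHS](@sum_shift n g 1).
  rewrite (reindex_inj rev_ord_inj)/=; apply: eq_bigr => j _.
  rewrite /g -turnN addn1.
  have -> : (j.+1%:R / n%:R : R) = - ((n - j.+1)%:R / n%:R) + 1.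
    by rewrite natrB// mulrBl divff//; lra.
  by rewrite turnD turn1 mulr1.
by move=> j; rewrite /g natrD mulrDl divff// turnD turn1 mulr1.
Qed.

Lemma modulus_rot P d e w : circle w -> modulus P d e -> modulus (fun z => P (w * z)) d e.
Proof.
move=> w1 Pd s sd z z1; rewrite mulrCA; apply: Pd => //; exact: circleM.
Qed.

Lemma modulus_inv P d e : modulus P d e -> modulus (fun z => P z^-1) d e.
Proof.
move=> Pd s sd z z1; rewrite invfM -turnN; apply: Pd; first by rewrite normrN.
exact: circleV.
Qed.

Lemma circle_unif_rot P w : circle w -> circle_unif P -> circle_unif (fun z => P (w * z)).
Proof. by move=> w1 uP e /uP[d d0 Pd]; exists d => //; exact: modulus_rot. Qed.

Lemma circle_unif_inv P : circle_unif P -> circle_unif (fun z => P z^-1).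
Proof. by move=> uP e /uP[d d0 Pd]; exists d => //; exact: modulus_inv. Qed.

(** Unlike the modulus itself, this form of the approximation applies to several
    functions at once. *)
Lemma root_mean_approx P : circle_unif P -> forall e, 0 < e -> exists2 d : R, 0 < d &
  forall n, (0 < n)%N -> n%:R^-1 < d -> rnorm (circle_int P - root_mean n P) <= e.
Proof.
move=> uP e e0; have e2 : 0 < e / 2 by lra.
have [d d0 Pd] := uP _ e2; exists d => // n n0 nd.
apply: (le_trans (circle_int_root_mean uP Pd n0 nd)); lra.
Qed.

(** Both integrals are limits of the means, for the same sequence of n. *)
Lemma circle_int_eq_root_mean P Q : circle_unif P -> circle_unif Q ->
  (forall n, (0 < n)%N -> root_mean n P = root_mean n Q) -> circle_int P = circle_int Q.
Proof.
move=> uP uQ PQ; apply/eqP; rewrite -subr_eq0; apply/eqP; apply: rnorm_le_eps => e e0.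
have e2 : 0 < e / 2 by lra.
have [d d0 Pd] := root_mean_approx uP e2; have [d' d'0 Qd] := root_mean_approx uQ e2.
have [n n0 nd] : exists2 n, (0 < n)%N & n%:R^-1 < Num.min d d'.
  by apply: small_inv_nat; rewrite lt_min d0.
move: nd; rewrite lt_min => /andP[nd nd'].
apply: (le_trans (rnorm_distD (root_mean n P) _ _)).
rewrite {2}PQ// (rnorm_distC (root_mean n Q)); have := Pd _ n0 nd; have := Qd _ n0 nd'; lra.
Qed.

Lemma circle_int_inv P : circle_unif P -> circle_int (fun z => P z^-1) = circle_int P.
Proof.
by move=> uP; apply: circle_int_eq_root_mean => //; [exact: circle_unif_inv|move=> n n0; exact: root_mean_inv].
Qed.

(** The means over n-th roots of unity are exactly invariant under multiples of 1/n
    of a turn, and any rotation is close to such a multiple. *)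
Lemma circle_int_rot w P : circle w -> circle_unif P -> circle_int (fun z => P (w * z)) = circle_int P.
Proof.
move=> w1 uP; apply/eqP; rewrite -subr_eq0; apply/eqP; apply: rnorm_le_eps => e e0.
(* two Riemann sums cost 2 * (e / 5) each, rounding the rotation costs e / 5 *)
have e5 : 0 < e / 5 by lra.
have [d d0 Pd] := uP _ e5; have [n n0 nd] := small_inv_nat d0.
have [s /andP[s0 _] ws] := circle_turn_surj w1.
have n0' : (0 : R) < n%:R by rewrite ltr0n.
(* the multiple k/n of a turn just below the given rotation *)
pose k := Num.truncn (s * n%:R).
have kn : `|s - k%:R / n%:R| < d.
  have /andP[k1 k2] : k%:R <= s * n%:R < k.+1%:R by apply: truncn_itv; rewrite mulr_ge0// ltW.
  rewrite ger0_norm; last by rewrite subr_ge0 ler_pdivrMr.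
  apply: le_lt_trans nd; rewrite lerBlDr -[X in X + _]mul1r -mulrDl ler_pdivlMr//.
  by rewrite addrC natr1 ltW.
have h1 := circle_int_root_mean (circle_unif_rot w1 uP) (modulus_rot w1 Pd) n0 nd.
have h2 := circle_int_root_mean uP Pd n0 nd.
have h3 : rnorm (root_mean n (fun z => P (w * z)) - root_mean n P) <= e / 5.
  rewrite -(root_mean_rot P k n0) root_meanB; apply: rnorm_root_mean => // z z1.
  have -> : w * z = turn (s - k%:R / n%:R) * (turn (k%:R / n%:R) * z).
    by rewrite mulrA -turnD subrK ws.
  by apply: Pd => //; apply: circleM => //; exact: circle_turn.
apply: (le_trans (rnorm_distD (root_mean n (fun z => P (w * z))) _ _)).
have := rnorm_distD (root_mean n P) (root_mean n (fun z => P (w * z))) (circle_int P).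
rewrite (rnorm_distC (root_mean n P)); lra.
Qed.

Lemma circle_unifZD c P Q : circle_unif P -> circle_unif Q -> circle_unif (fun z => c * P z + Q z).
Proof.
move=> uP uQ e e0; have c0 : 0 < rnorm c + 1 by have := rnorm_ge0 (V := Cx R) c; lra.
have e1' : 0 < e / (2 * (rnorm c + 1)) by rewrite divr_gt0//; lra.
have e2 : 0 < e / 2 by lra.
have [d d0 Pd] := uP _ e1'; have [d' d'0 Qd] := uQ _ e2.
exists (Num.min d d'); first by rewrite lt_min d0.
move=> s; rewrite lt_min => /andP[sd sd'] z z1.
have -> : c * P (turn s * z) + Q (turn s * z) - (c * P z + Q z) =
  c * (P (turn s * z) - P z) + (Q (turn s * z) - Q z) by ring.
apply: (le_trans (rnormD (_ : Cx R) _)); rewrite rnormM.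
have : rnorm c * rnorm (P (turn s * z) - P z) <= e / 2.
  have := Pd s sd z z1; rewrite ler_pdivlMr; last lra.
  have := rnorm_ge0 (P (turn s * z) - P z : Cx R).
  nra.
have := Qd s sd' z z1; lra.
Qed.

Lemma circle_intZD c P Q : circle_unif P -> circle_unif Q ->
  circle_int (fun z => c * P z + Q z) = c * circle_int P + circle_int Q.
Proof.
move=> uP uQ; apply/eqP; rewrite -subr_eq0; apply/eqP; apply: rnorm_le_eps => e e0.
have c0 : 0 < rnorm c + 2 by have := rnorm_ge0 (V := Cx R) c; lra.
have e1' : 0 < e / (rnorm c + 2) by rewrite divr_gt0.
have [d d0 Pd] := root_mean_approx uP e1'; have [d' d'0 Qd] := root_mean_approx uQ e1'.
have [d2 d20 Sd] := root_mean_approx (circle_unifZD c uP uQ) e1'.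
have [n n0 nd] : exists2 n, (0 < n)%N & n%:R^-1 < Num.min (Num.min d d') d2.
  by apply: small_inv_nat; rewrite !lt_min d0 d'0.
move: nd; rewrite !lt_min => /andP[/andP[nd nd'] nd2].
have := Sd _ n0 nd2; have := Pd _ n0 nd; have := Qd _ n0 nd'.
rewrite root_meanZD; set I := circle_int (fun z => _ + _); set IP := circle_int P; set IQ := circle_int Q.
set p := root_mean n P; set q := root_mean n Q => hq hp hI.
have -> : I - (c * IP + IQ) = (I - (c * p + q)) + ((q - IQ) + c * (p - IP)) by ring.
apply: (le_trans (rnormD (_ : Cx R) _)).
apply: (@le_trans _ _ (e / (rnorm c + 2) + (e / (rnorm c + 2) + rnorm c * (e / (rnorm c + 2))))).
  apply: lerD => //; apply: (le_trans (rnormD (_ : Cx R) _)); apply: lerD; first by rewrite rnorm_distC.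
  by rewrite rnormM ler_wpM2l ?rnorm_ge0// rnorm_distC.
have -> : e / (rnorm c + 2) + (e / (rnorm c + 2) + rnorm c * (e / (rnorm c + 2))) =
  (e / (rnorm c + 2)) * (rnorm c + 2) by ring.
by rewrite divfK ?gt_eqF.
Qed.

Lemma circle_unif_cst c : circle_unif (fun=> c).
Proof. by move=> e e0; exists 1 => // s _ z _; rewrite subrr rnorm0 ltW. Qed.

Lemma circle_int_cst P c : (forall z, circle z -> P z = c) -> circle_int P = c.
Proof.
move=> Pc; rewrite (eq_circle_int (Q := fun=> c))//.
apply/eqP; rewrite -subr_eq0; apply/eqP; apply: rnorm_le_eps => e e0.
have [d d0 Pd] := root_mean_approx (circle_unif_cst c) e0; have [n n0 nd] := small_inv_nat d0.
by have := Pd n n0 nd; rewrite (@root_mean_cst n _ c).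
Qed.

Lemma circle_unif_norm P : circle_unif P -> circle_unif (fun z => (rnorm (P z))%:C%C).
Proof.
move=> uP e /uP[d d0 Pd]; exists d => // s sd z z1.
rewrite -raddfB/= rnorm_real; apply: (le_trans (rnorm_dist_dist _ _)); exact: Pd.
Qed.

Lemma rnorm_circle_int P : circle_unif P ->
  rnorm (circle_int P) <= complex.Re (circle_int (fun z => (rnorm (P z))%:C%C)).
Proof.
move=> uP; apply/ler_addgt0Pr => e e0; have e2 : 0 < e / 2 by lra.
have [d d0 Pd] := root_mean_approx uP e2; have [d' d'0 Qd] := root_mean_approx (circle_unif_norm uP) e2.
have [n n0 nd] : exists2 n, (0 < n)%N & n%:R^-1 < Num.min d d'.
  by apply: small_inv_nat; rewrite lt_min d0.
move: nd; rewrite lt_min => /andP[nd nd'].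
have := Pd _ n0 nd; have := Qd _ n0 nd'.
set I := circle_int (fun z => _%:C%C); set J := circle_int P; set p := root_mean n P.
set q := root_mean n _ => hq hp.
have pq : rnorm p <= complex.Re q.
  have -> : q = (n%:R^-1 * \sum_(j < n) rnorm (P (turn (j%:R / n%:R))))%:C%C.
    by rewrite rmorphM fmorphV rmorph_nat rmorph_sum.
  rewrite /p /root_mean rnormM rnormV rnorm_nat.
  by rewrite ler_wpM2l ?invr_ge0//; exact: rnorm_sum.
have h1 : rnorm J <= rnorm (J - p) + rnorm p by rewrite -{1}(subrK p J); exact: rnormD.
have h2 : complex.Re q - complex.Re I <= e / 2.
  by have := le_Re_rnorm (I - q); rewrite Re_add Re_opp ler_norml => /andP[? _]; lra.
lra.
Qed.

Lemma le_rnorm_circle_int P e : circle_unif P -> (forall z, circle z -> rnorm (P z) <= e) ->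
  rnorm (circle_int P) <= e.
Proof.
move=> uP Pe; apply/ler_addgt0Pr => e' e0.
have [d d0 Pd] := root_mean_approx uP e0; have [n n0 nd] := small_inv_nat d0.
have := Pd n n0 nd; have := rnorm_root_mean n0 Pe => h1 h2.
have := rnormD (circle_int P - root_mean n P) (root_mean n P); rewrite subrK; lra.
Qed.

End CircleIntegral.

(** * The total space of a Fell line bundle as an algebraic structure *)
Section TotalSpaceModule.
Variables (R : realType) (X : topologicalType) (L : line_bundle R X).
Implicit Types (p q y : total_space L) (c : Cx R) (g : X).

(** A point of the total space is a dependent pair; this is the elimination
    rule for the pair made from a vector. *)
Lemma vec_pt (S : Type) (F : forall g, fib L g -> S) g (a : fib L g) :
  F (base (pt a)) (vec (pt a)) = F g a.
Proof.
have := base_pt a; have := pt_vec (pt a); move: (vec (pt a)).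
move: (base (pt a)) => h v hv hg; case: _ / hg a hv => a hv.
by rewrite (pt_inj hv).
Qed.

(** Scaling, norm, product, star and units are transported from the fibres to the
    total space, where identities between vectors over equal but not convertible
    arrows are plain equations. *)
Definition tscale c y : total_space L := pt (c *: vec y).
Definition tnorm y : R := rnorm (vec y).

Lemma tscale_pt c g (a : fib L g) : tscale c (pt a) = pt (c *: a).
Proof. exact: (vec_pt (fun h (b : fib L h) => pt (c *: b))). Qed.

Lemma tnorm_pt g (a : fib L g) : tnorm (pt a) = rnorm a.
Proof. exact: (vec_pt (fun h (b : fib L h) => rnorm b)). Qed.

Lemma base_tscale c y : base (tscale c y) = base y.
Proof. exact: base_pt. Qed.

Lemma tscaleA c d y : tscale c (tscale d y) = tscale (c * d) y.
Proof. by rewrite {2}/tscale tscale_pt scalerA. Qed.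

Lemma tscale1 y : tscale 1 y = y.
Proof. by rewrite /tscale scale1r pt_vec. Qed.

Lemma tnorm_tscale c y : tnorm (tscale c y) = rnorm c * tnorm y.
Proof. by rewrite /tscale tnorm_pt rnormZ. Qed.

Lemma tnorm_ge0 y : 0 <= tnorm y.
Proof. exact: rnorm_ge0. Qed.

Lemma pt_fib_at g y : base y = g -> pt (fib_at g y) = y.
Proof.
move=> yg; rewrite /fib_at; case: pselect => // e.
by case: _ / e; rewrite /= pt_vec.
Qed.

Lemma fib_at_pt g (a : fib L g) : fib_at g (pt a) = a.
Proof. by apply: (@pt_inj _ _ L); rewrite pt_fib_at// base_pt. Qed.

Lemma fib_at_tscale c g y : base y = g -> fib_at g (tscale c y) = c *: fib_at g y.
Proof.
move=> yg; rewrite -{1}(pt_fib_at yg) tscale_pt; exact: fib_at_pt.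
Qed.

(** A local coordinate is injective on each fibre, so the fibres are lines. *)
Lemma fib_span y q : base q = base y -> tnorm y != 0 -> exists c, q = tscale c y.
Proof.
have [U [e [k [[oU Uy] _ _ ke _]]]] := lb_trivial L (base y).
move=> qy y0.
have ky := ke y Uy; have kq := ke q; rewrite qy in kq; have {}kq := kq Uy.
have k0 : k y != 0.
  by apply: contra_neq y0 => k0; rewrite -ky k0 tnorm_pt scale0r rnorm0.
exists (k q / k y).
by rewrite -ky tscale_pt scalerA ky divfK.
Qed.

Lemma tscale_inj c d y : tnorm y != 0 -> tscale c y = tscale d y -> c = d.
Proof.
move=> y0 /pt_inj /eqP; rewrite -subr_eq0 -scalerBl => /eqP /(congr1 (@rnorm _ _)).
rewrite rnormZ rnorm0 => /eqP; rewrite mulf_eq0 (negPf y0) orbF => /eqP /rnorm_eq0 /eqP.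
by rewrite subr_eq0 => /eqP.
Qed.

Lemma tnorm_neq0_exists g : exists2 y, base y = g & tnorm y != 0.
Proof.
have [U [e [k [[oU Ug] _ _ _ ke]]]] := lb_trivial L g.
exists (pt (e g)); first exact: base_pt.
rewrite tnorm_pt; apply/eqP => /rnorm_eq0 e0.
have := ke g 0 Ug; have := ke g 1 Ug; rewrite e0 !scaler0 => -> /eqP.
by rewrite oner_eq0.
Qed.

End TotalSpaceModule.

Section TotalSpaceAlgebra.
Variables (R : realType) (G : lc_groupoid) (L : fell_line_bundle R G).
Local Notation T := (total_space L).
Implicit Types (p q y : T) (c : Cx R) (g h x : G).

Definition tmul p q : T := pt (fmul (vec p) (vec q)).
Definition tstar p : T := pt (fstar (vec p)).

Lemma tmul_pt g h (a : fib L g) (b : fib L h) : tmul (pt a) (pt b) = pt (fmul a b).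
Proof.
rewrite /tmul (vec_pt (fun g' (a' : fib L g') => pt (fmul a' (vec (pt b))))).
exact: (vec_pt (fun h' (b' : fib L h') => pt (fmul a b'))).
Qed.

Lemma tstar_pt g (a : fib L g) : tstar (pt a) = pt (fstar a).
Proof. exact: (vec_pt (fun h (b : fib L h) => pt (fstar b))). Qed.

Lemma base_tmul p q : base (tmul p q) = gcomp (base p) (base q).
Proof. exact: base_pt. Qed.

Lemma base_tstar p : base (tstar p) = ginv (base p).
Proof. exact: base_pt. Qed.

Lemma tmulA p q y : src (base p) = rng (base q) -> src (base q) = rng (base y) ->
  tmul p (tmul q y) = tmul (tmul p q) y.
Proof.
move=> pq qy; rewrite -(pt_vec p) -(pt_vec q) -(pt_vec y) !tmul_pt; exact: fmulA.
Qed.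

Lemma tstarK p : tstar (tstar p) = p.
Proof. by rewrite {2}/tstar tstar_pt fstarK pt_vec. Qed.

Lemma tstar_tmul p q : src (base p) = rng (base q) -> tstar (tmul p q) = tmul (tstar q) (tstar p).
Proof. by move=> pq; rewrite /tmul tstar_pt fstar_mul// -tmul_pt. Qed.

Lemma fmulZl g h c (a : fib L g) (b : fib L h) : src g = rng h ->
  fmul (c *: a) b = c *: fmul a b.
Proof.
move=> gh; have f0 : fmul (0 : fib L g) b = 0.
  have := fmul_linear_l gh 1 (0 : fib L g) 0 b.
  by rewrite !scale1r addr0 => /(congr1 (fun v => v - fmul 0 b)); rewrite subrr addrK.
by have := fmul_linear_l gh c a 0 b; rewrite !addr0 f0 addr0.
Qed.

Lemma fmulZr g h c (a : fib L g) (b : fib L h) : src g = rng h ->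
  fmul a (c *: b) = c *: fmul a b.
Proof.
move=> gh; have f0 : fmul a (0 : fib L h) = 0.
  have := fmul_linear_r gh 1 a (0 : fib L h) 0.
  by rewrite !scale1r addr0 => /(congr1 (fun v => v - fmul a 0)); rewrite subrr addrK.
by have := fmul_linear_r gh c a b 0; rewrite !addr0 f0 addr0.
Qed.

Lemma fstarZ g c (a : fib L g) : fstar (c *: a) = Num.conj c *: fstar a.
Proof.
have f0 : fstar (0 : fib L g) = 0.
  have := fstar_conj_linear 1 (0 : fib L g) 0.
  by rewrite rmorph1 !scale1r addr0 => /(congr1 (fun v => v - fstar 0)); rewrite subrr addrK.
by have := fstar_conj_linear c a 0; rewrite !addr0 f0 addr0.
Qed.

Lemma tmul_tscalel c p q : src (base p) = rng (base q) -> tmul (tscale c p) q = tscale c (tmul p q).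
Proof.
move=> pq; rewrite -{1}(pt_vec p) tscale_pt -{1}(pt_vec q) tmul_pt fmulZl//.
by rewrite -tscale_pt -tmul_pt !pt_vec.
Qed.

Lemma tmul_tscaler c p q : src (base p) = rng (base q) -> tmul p (tscale c q) = tscale c (tmul p q).
Proof.
move=> pq; rewrite -{1}(pt_vec q) tscale_pt -{1}(pt_vec p) tmul_pt fmulZr//.
by rewrite -tscale_pt -tmul_pt !pt_vec.
Qed.

Lemma tstar_tscale c p : tstar (tscale c p) = tscale (Num.conj c) (tstar p).
Proof. by rewrite /tscale tstar_pt fstarZ -tscale_pt. Qed.

Lemma tnorm_tmul_starl p : tnorm (tmul (tstar p) p) = tnorm p ^+ 2.
Proof.
rewrite -{2}(pt_vec p) /tstar tmul_pt tnorm_pt; have := fmul_star_norm (vec p).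
by rewrite !normE -rmorphXn/= => /complexI.
Qed.

Lemma tnorm_tmul p q : src (base p) = rng (base q) -> tnorm (tmul p q) <= tnorm p * tnorm q.
Proof.
move=> pq; rewrite /tmul tnorm_pt; have := fmul_norm pq (vec p) (vec q).
by rewrite !normE -rmorphM/= lecR.
Qed.

Lemma src_unit x : units x -> src x = x.
Proof. by rewrite /units/= => <-; rewrite src_rng. Qed.

Lemma comp_unit x : units x -> gcomp x x = x.
Proof. by move=> ux; rewrite -{1}ux comp_rng. Qed.

Lemma inv_unit x : units x -> ginv x = x.
Proof.
by move=> ux; rewrite -(comp_rng (ginv x)) rng_inv src_unit// comp_inv_r.
Qed.

Lemma units_rng g : units (rng g).
Proof. exact: rng_rng. Qed.

Lemma units_src g : units (src g).
Proof. exact: rng_src. Qed.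

Definition tunit x : T := pt (unit_vec (@fmul _ _ L) x).

Lemma base_tunit x : base (tunit x) = x.
Proof. exact: base_pt. Qed.

(** Existence of the unit of L_x: for y spanning the fibre, y y = c y with c nonzero
    because the norm of y^* y is the square of that of y, and then y / c is
    idempotent. *)
Lemma tunit_spec x : units x -> tnorm (tunit x) != 0 /\ tmul (tunit x) (tunit x) = tunit x.
Proof.
move=> ux; suff : unit_vec (@fmul _ _ L) x != 0 /\
    pt (fmul (unit_vec (@fmul _ _ L) x) (unit_vec (@fmul _ _ L) x)) = pt (unit_vec (@fmul _ _ L) x).
  move=> [u0 uu]; split; last by rewrite /tunit tmul_pt.
  by rewrite /tunit tnorm_pt; apply: contra_neq u0 => /rnorm_eq0.
pose S := [set e : fib L x | e != 0 /\ pt (fmul e e) = pt e].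
apply: (@xgetPex _ 0 S).
have [y yx y0] := tnorm_neq0_exists L x.
have cyy : src (base y) = rng (base y) by rewrite yx ux src_unit.
have [s sE] : exists s, tstar y = tscale s y.
  by apply: fib_span => //; rewrite base_tstar yx inv_unit.
have [c cE] : exists c, tmul y y = tscale c y.
  by apply: fib_span => //; rewrite base_tmul yx comp_unit.
have c0 : c != 0.
  apply/eqP => c0; have := tnorm_tmul_starl y; rewrite sE tmul_tscalel// cE c0 !tnorm_tscale rnorm0 mul0r mulr0.
  by move/eqP; rewrite eq_sym sqrf_eq0 (negPf y0).
pose e := tscale c^-1 y.
have be : base e = x by rewrite base_tscale.
have ee : tmul e e = e by rewrite tmul_tscalel ?tmul_tscaler ?base_tscale// cE !tscaleA; congr (tscale _ y); field.
exists (fib_at x e); split.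
  apply/eqP => e0; have := pt_fib_at be; rewrite e0 => /(congr1 (@tnorm _ _ _)).
  rewrite tnorm_pt rnorm0 tnorm_tscale => /esym/eqP; rewrite mulf_eq0 (negPf y0) orbF => /eqP.
  by move=> /rnorm_eq0/eqP; rewrite invr_eq0 (negPf c0).
by rewrite -tmul_pt pt_fib_at.
Qed.

Lemma tmul_tstar_ge0 p : exists2 t : Cx R, 0 <= t & tmul (tstar p) p = tscale t (tunit (src (base p))).
Proof.
have [t t0 tE] := fmul_star_ge0 (vec p); exists t => //.
by rewrite -{2}(pt_vec p) /tstar tmul_pt tE -tscale_pt.
Qed.

(** The star of the idempotent is a scalar multiple of it.  By positivity the scalar
    is nonnegative, and its square is 1 because the star is an involution. *)
Lemma tunit_norm x : units x -> tnorm (tunit x) = 1 /\ tstar (tunit x) = tunit x.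
Proof.
move=> ux; have [u0 uu] := tunit_spec ux.
have cuu : src (base (tunit x)) = rng (base (tunit x)) by rewrite base_tunit ux src_unit.
have [s sE] : exists s, tstar (tunit x) = tscale s (tunit x).
  by apply: fib_span => //; rewrite base_tstar base_tunit inv_unit.
have [t t0 tE] := tmul_tstar_ge0 (tunit x).
have st : s = t.
  move: tE; rewrite sE tmul_tscalel// uu base_tunit src_unit//; exact: tscale_inj.
have tt : t * t = 1.
  have := tstarK (tunit x); rewrite sE tstar_tscale sE tscaleA st geC0_conj// => H.
  by apply: (@tscale_inj _ _ L _ _ (tunit x) u0); rewrite H tscale1.
have t1 : t = 1.
  apply/eqP; rewrite -(@pexpr_eq1 _ t 2)// ; apply/eqP; rewrite expr2 tt//.
have sU : tstar (tunit x) = tunit x by rewrite sE st t1 tscale1.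
split => //.
have := tnorm_tmul_starl (tunit x); rewrite sU uu => /eqP; rewrite expr2 -{1}[tnorm _]mulr1.
by move=> /eqP /(mulfI u0).
Qed.

Lemma tnorm_tstar p : tnorm (tstar p) = tnorm p.
Proof.
have le q : tnorm q <= tnorm (tstar q).
  have [->|q0] := eqVneq (tnorm q) 0; first exact: tnorm_ge0.
  have q0' : 0 < tnorm q by rewrite lt0r q0 tnorm_ge0.
  rewrite -(ler_pM2r q0') -expr2 -tnorm_tmul_starl; apply: tnorm_tmul.
  by rewrite base_tstar src_inv.
by apply/eqP; rewrite eq_le le andbT -{2}(tstarK p) le.
Qed.

(** Positivity determines y^* y from its norm. *)
Lemma tmul_starl p : tmul (tstar p) p = tscale (tnorm p ^+ 2)%:C%C (tunit (src (base p))).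
Proof.
have [t t0 tE] := tmul_tstar_ge0 p; rewrite tE.
have := tnorm_tmul_starl p; rewrite tE tnorm_tscale (tunit_norm (units_src _)).1 mulr1 => <-.
by rewrite -normE ger0_norm.
Qed.

Lemma tmul_starr p : tmul p (tstar p) = tscale (tnorm p ^+ 2)%:C%C (tunit (rng (base p))).
Proof. by rewrite -{1}(tstarK p) tmul_starl tnorm_tstar base_tstar src_inv. Qed.

(** Multiplication by the unit scales p by some c; multiplying with the star of p,
    which gives a nonzero multiple of the unit, shows that c = 1. *)
Lemma tmul_tunitl p : tmul (tunit (rng (base p))) p = p.
Proof.
have ur := units_rng (base p); have [u0 uu] := tunit_spec ur.
set u := tunit _ in u0 uu *.
have cu : src (base u) = rng (base p) by rewrite base_tunit src_rng.
have [p0|p0] := eqVneq (tnorm p) 0.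
  have p00 : p = tscale 0 p.
    by rewrite -{1}(pt_vec p) (rnorm_eq0 p0) /tscale scale0r.
  have [q bq q0] := tnorm_neq0_exists L (base p).
  have pt0 b (y : T) : base y = b -> tnorm y = 0 -> y = pt (0 : fib L b).
    by move=> <- /rnorm_eq0 y0; rewrite -{1}(pt_vec y) y0.
  rewrite [RHS](pt0 (base p))//; apply: pt0; first by rewrite base_tmul base_tunit comp_rng.
  rewrite p00 tmul_tscaler ?base_tscale// tnorm_tscale rnorm0 mul0r//.
have [c cE] : exists c, tmul u p = tscale c p.
  by apply: fib_span => //; rewrite base_tmul base_tunit comp_rng.
have : tmul u (tmul p (tstar p)) = tmul (tmul u p) (tstar p).
  by rewrite tmulA// base_tstar rng_inv.
rewrite cE tmul_tscalel ?base_tstar ?rng_inv// tmul_starr tmul_tscaler ?base_tunit ?rng_rng ?src_rng//.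
rewrite uu tscaleA => H.
have pp0 : (tnorm p ^+ 2)%:C%C != 0 :> Cx R.
  by rewrite (_ : 0 = 0%:C%C)// (inj_eq (@complexI _)) sqrf_eq0.
have -> : c = 1 by apply: (mulIf pp0); rewrite mul1r -(tscale_inj u0 H).
by rewrite tscale1.
Qed.

End TotalSpaceAlgebra.

(** * Topology of the total space and of the circle extension *)
Lemma cvg_within_comp (X Y : topologicalType) (A : set X) (f : X -> Y) (x : X)
    (I : Type) (F : set_system I) {FF : Filter F} (h : I -> X) :
  {within A, continuous f} -> A x -> h @ F --> x -> (\forall i \near F, A (h i)) ->
  (fun i => f (h i)) @ F --> f x.
Proof.
move=> /subspace_continuousP /(_ x) fA Ax hx Ah.
have hw : h @ F --> within A (nbhs x).
  move=> B; rewrite /within/= => xB.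
  have hB : \forall i \near F, A (h i) -> B (h i).
    exact: (hx (fun t => A t -> B t)).
  suff : \forall i \near F, B (h i) by [].
  near=> i; have Ai : A (h i) by near: i.
  by move: Ai; near: i.
exact: (cvg_trans (cvg_app f hw) (fA Ax)).
Unshelve. all: by end_near.
Qed.

Lemma cvg_near_eq (Y : topologicalType) (I : Type) (F : set_system I) {FF : Filter F}
    (f g : I -> Y) (l : Y) :
  (\forall i \near F, f i = g i) -> f @ F --> l -> g @ F --> l.
Proof.
move=> fg; apply: cvg_trans; apply: near_eq_cvg.
by apply: filterS fg => i ->.
Qed.

Lemma ultra_fmap (X Y : Type) (f : X -> Y) (F : set_system X) :
  UltraFilter F -> UltraFilter (f @ F).
Proof.
move=> UF; split=> [|H PH FH]; first exact: fmap_proper_filter.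
apply/seteqP; split=> A HA; last exact: FH.
have [//|FnA] := in_ultra_setVsetC (f @^-1` A) UF.
have HnA : H (~` A) by exact: FH.
by have [y []] := filter_ex (filterI HA HnA).
Qed.

Section TotalSpaceTopology.
Variables (R : realType) (X : topologicalType) (L : line_bundle R X).
Local Notation T := (total_space L).
Variables (I : Type) (F : set_system I).
Context {FF : Filter F}.
Implicit Types (y : I -> T) (c : I -> Cx R).

(** The topology of the total space is known through local frames only, and in a
    frame scaling is multiplication of coordinates. *)
Lemma cvg_tscale c y (c0 : Cx R) (y0 : T) : c @ F --> c0 -> y @ F --> y0 ->
  (fun i => tscale (c i) (y i)) @ F --> tscale c0 y0.
Proof.
move=> cc yy.
have [U [e [k [[oU Uy] Ec kc ke _]]]] := lb_trivial L (base y0).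
have by0 : (fun i => base (y i)) @ F --> base y0.
  exact: (cvg_comp y base yy (@base_continuous _ _ L y0)).
have nU : \forall i \near F, U (base (y i)) by apply: by0; exact: open_nbhs_nbhs.
have ky : (fun i => k (y i)) @ F --> k y0.
  exact: (cvg_within_comp kc).
have tzE a (y1 : T) : U (base y1) -> tscale a y1 = pt ((a * k y1) *: e (base y1)).
  by move=> Uy1; rewrite -[in LHS](ke y1)// tscale_pt scalerA.
rewrite tzE//.
have : (fun i => pt ((c i * k (y i)) *: e (base (y i)))) @ F -->
    (pt ((c0 * k y0) *: e (base y0)) : T).
  apply: (@cvg_within_comp _ _ _ _ (base y0, c0 * k y0) _ _ _
    (fun i => (base (y i), c i * k (y i))) Ec) => //.
    exact: (cvg_pair by0 (cvgM cc ky)).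
  by apply: filterS nU => i Ui; split.
apply: cvg_near_eq; apply: filterS nU => i Ui; by rewrite tzE.
Qed.

Lemma cvg_tnorm y (y0 : T) : y @ F --> y0 -> (fun i => tnorm (y i)) @ F --> tnorm y0.
Proof.
move=> yy; have := cvg_comp y _ yy (Defs.norm_continuous (l := L) (x := y0)) => h.
exact: (cvg_comp _ (fun z : Cx R => complex.Re z) h (@continuous_Re R _)).
Qed.

End TotalSpaceTopology.

Section CircleExtensionPoints.
Variables (R : realType) (G : lc_groupoid) (L : fell_line_bundle R G).
Local Notation T := (total_space L).
Local Notation S := (Sigma L).
Implicit Types (p q : T) (y w : S) (z c : Cx R) (g : G).

Lemma Sigma_setP p : Sigma_set (L := L) p <-> tnorm p = 1.
Proof.
have -> : Sigma_set p = (tmul (tstar p) p = tunit L (src (base p))).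
  rewrite /Sigma_set/= -[in RHS](pt_vec p) -/(tstar p) /tstar.
  by rewrite tmul_pt pt_vec.
have [u0 _] := tunit_spec L (units_src (base p)).
rewrite tmul_starl; split=> [|->]; last by rewrite expr1n tscale1.
rewrite -[RHS]tscale1 => /(tscale_inj u0) /(congr1 (fun c : Cx R => complex.Re c)) /= h.
by apply/eqP; rewrite -(@pexpr_eq1 _ _ 2)// ?tnorm_ge0// h.
Qed.

Lemma tnorm_val y : tnorm (val y : T) = 1.
Proof. by apply/Sigma_setP; have := valP y; rewrite inE. Qed.

Lemma val_insubd_Sigma y p : tnorm p = 1 -> val (insubd y p : S) = p.
Proof. by move=> p1; rewrite insubdK// inE; apply/Sigma_setP. Qed.

Definition sig_of p (p1 : tnorm p = 1) : S := exist _ p (mem_set (iffRL (Sigma_setP p) p1)).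

Lemma base_val y : base (val y : T) = sig_base y.
Proof. by []. Qed.

Lemma val_act z y : circle z -> val (sig_act z y) = tscale z (val y).
Proof. by move=> /circleP z1; apply: val_insubd_Sigma; rewrite tnorm_tscale tnorm_val z1 mulr1. Qed.

Lemma val_inv y : val (sig_inv y) = tstar (val y).
Proof. by apply: val_insubd_Sigma; rewrite tnorm_tstar tnorm_val. Qed.

(** For unit vectors (p q)^* (p q) = q^* (p^* p) q = q^* q; the submultiplicativity
    axiom alone gives one inequality. *)
Lemma tnorm_tmul1 p q : src (base p) = rng (base q) -> tnorm p = 1 -> tnorm q = 1 -> tnorm (tmul p q) = 1.
Proof.
move=> pq p1 q1; have [u1 _] := tunit_norm L (units_src (base q)).
apply/eqP; rewrite -(@pexpr_eq1 _ _ 2)// ?tnorm_ge0// -tnorm_tmul_starl tstar_tmul//.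
have -> : tmul (tmul (tstar q) (tstar p)) (tmul p q) = tmul (tstar q) q.
  rewrite -tmulA ?base_tmul ?base_tstar ?src_inv ?rng_inv ?rng_gcomp//.
  congr (tmul _ _); rewrite tmulA ?base_tstar ?src_inv// tmul_starl p1 expr1n tscale1.
  by rewrite pq tmul_tunitl.
by rewrite tnorm_tmul_starl q1 expr1n.
Qed.

Lemma val_mul y w : src (sig_base y) = rng (sig_base w) ->
  val (sig_mul y w) = tmul (val y) (val w).
Proof. by move=> yw; apply: val_insubd_Sigma; apply: tnorm_tmul1 => //; exact: tnorm_val. Qed.

Lemma sig_base_act z y : circle z -> sig_base (sig_act z y) = sig_base y.
Proof. by move=> z1; rewrite /sig_base val_act// base_tscale. Qed.

Lemma sig_base_inv y : sig_base (sig_inv y) = ginv (sig_base y).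
Proof. by rewrite /sig_base val_inv base_tstar. Qed.

Lemma sig_base_mul y w : src (sig_base y) = rng (sig_base w) ->
  sig_base (sig_mul y w) = gcomp (sig_base y) (sig_base w).
Proof. by move=> yw; rewrite /sig_base val_mul// base_tmul. Qed.

Lemma sig_actA z c y : circle z -> circle c -> sig_act z (sig_act c y) = sig_act (z * c) y.
Proof.
by move=> z1 c1; apply: val_inj; rewrite !val_act// ?tscaleA//; exact: circleM.
Qed.

Lemma sig_act1 y : sig_act 1 y = y.
Proof. by apply: val_inj; rewrite val_act ?tscale1//; exact: circle1. Qed.

Lemma sig_invK : involutive (@sig_inv R G L).
Proof. by move=> y; apply: val_inj; rewrite !val_inv tstarK. Qed.

Lemma sig_inv_act z y : circle z -> sig_inv (sig_act z y) = sig_act z^-1 (sig_inv y).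
Proof.
move=> z1; apply: val_inj; rewrite val_inv !val_act//; last exact: circleV.
by rewrite tstar_tscale circle_conj// val_inv.
Qed.

Lemma sig_mul_actl z y w : circle z -> src (sig_base y) = rng (sig_base w) ->
  sig_mul (sig_act z y) w = sig_act z (sig_mul y w).
Proof.
move=> z1 yw; apply: val_inj.
by rewrite val_mul ?sig_base_act// !val_act// val_mul// tmul_tscalel.
Qed.

Lemma sig_mul_actr z y w : circle z -> src (sig_base y) = rng (sig_base w) ->
  sig_mul y (sig_act z w) = sig_act z (sig_mul y w).
Proof.
move=> z1 yw; apply: val_inj.
by rewrite val_mul ?sig_base_act// !val_act// val_mul// tmul_tscaler.
Qed.

(** The fibres of the extension are single orbits of the circle. *)
Lemma sig_act_span y w : sig_base y = sig_base w -> exists2 z, circle z & y = sig_act z w.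
Proof.
move=> yw; have w0 : tnorm (val w : T) != 0 by rewrite tnorm_val oner_eq0.
have [z zE] := fib_span (yw : base (val y) = base (val w)) w0.
have z1 : circle z.
  by apply/circleP; have := tnorm_val y; rewrite zE tnorm_tscale tnorm_val mulr1.
by exists z => //; apply: val_inj; rewrite val_act.
Qed.

Lemma sig_over g : exists y : S, sig_base y = g.
Proof.
have [p pg p0] := tnorm_neq0_exists L g.
have p1 : tnorm (tscale ((tnorm p)^-1)%:C%C p) = 1.
  by rewrite tnorm_tscale rnorm_real ger0_norm ?invr_ge0 ?tnorm_ge0// mulVf.
by exists (sig_of p1); rewrite /sig_base/= base_tscale.
Qed.

(** An arbitrary choice of points, in general discontinuous; arguments about
    continuity use section_at instead. *)
Definition sig_pt g : S := sval (cid (sig_over g)).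

Lemma sig_base_pt g : sig_base (sig_pt g) = g.
Proof. exact: svalP (cid (sig_over g)). Qed.

Lemma sig_inv_mulK y w : rng (sig_base w) = rng (sig_base y) ->
  tmul (val w) (val (sig_mul (sig_inv w) y)) = val y.
Proof.
move=> wy; rewrite val_mul; last by rewrite sig_base_inv src_inv.
rewrite val_inv tmulA ?base_tstar ?rng_inv// ?src_inv//.
by rewrite tmul_starr tnorm_val expr1n tscale1 base_val wy tmul_tunitl.
Qed.

Section Convergence.
Variables (I : Type) (F : set_system I).
Context {FF : Filter F}.
Implicit Types (u v : I -> S).

Lemma continuous_val_Sigma : continuous (val : S -> T).
Proof. exact: initial_continuous. Qed.

Lemma cvg_Sigma u y : (fun i => val (u i) : T) @ F --> (val y : T) -> u @ F --> y.
Proof.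
move=> uy B; rewrite nbhsE => -[W [[V oV <-] Vy] VB].
have : \forall i \near F, V (val (u i)) by apply: uy; exact: open_nbhs_nbhs.
by apply: filterS => i Vi; exact: VB.
Qed.

Lemma cvg_val_Sigma u y : u @ F --> y -> (fun i => val (u i) : T) @ F --> (val y : T).
Proof. by move=> uy; exact: (cvg_comp u _ uy (@continuous_val_Sigma y)). Qed.

Lemma cvg_sig_act (z : I -> Cx R) u z0 y : (forall i, circle (z i)) -> circle z0 ->
  z @ F --> z0 -> u @ F --> y -> (fun i => sig_act (z i) (u i)) @ F --> sig_act z0 y.
Proof.
move=> z1 z01 zz uy; apply: cvg_Sigma; rewrite val_act//.
under eq_fun => i do rewrite (val_act _ (z1 i)).
by apply: cvg_tscale => //; exact: cvg_val_Sigma.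
Qed.

Lemma cvg_sig_inv u y : u @ F --> y -> (fun i => sig_inv (u i)) @ F --> sig_inv y.
Proof.
move=> uy; apply: cvg_Sigma; rewrite val_inv.
under eq_fun => i do rewrite val_inv.
exact: (cvg_comp _ _ (cvg_val_Sigma uy) (@fstar_continuous _ _ L (val y : T))).
Qed.

Lemma cvg_sig_mul u v y w : (\forall i \near F, src (sig_base (u i)) = rng (sig_base (v i))) ->
  src (sig_base y) = rng (sig_base w) ->
  u @ F --> y -> v @ F --> w -> (fun i => sig_mul (u i) (v i)) @ F --> sig_mul y w.
Proof.
move=> cuv cyw uy vw; apply: cvg_Sigma; rewrite val_mul//.
have H : (fun i => tmul (val (u i)) (val (v i))) @ F --> tmul (val y) (val w).
  apply: (@cvg_within_comp _ _ _ _ (val y, val w) _ _ _ (fun i => (val (u i), val (v i)))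
    (@fmul_continuous _ _ L)) => //.
  by apply: cvg_pair => /=; exact: cvg_val_Sigma.
apply: cvg_near_eq H; apply: filterS cuv => i ci.
by rewrite val_mul.
Qed.

End Convergence.

Lemma continuous_sig_base : continuous (@sig_base R G L).
Proof.
move=> y; exact: (cvg_comp _ _ (@continuous_val_Sigma y) (@base_continuous _ _ L _)).
Qed.

(** Locally Sigma has sections, namely normalised frames of the bundle. *)
Lemma section_at g : exists2 s : G -> S, (forall h, sig_base (s h) = h) & s @ g --> s g.
Proof.
have [U [e [k [[oU Ug] Ec _ _ kec]]]] := lb_trivial L g.
pose n h : R := tnorm (pt (e h) : T).
have n0 h : U h -> n h != 0.
  move=> Uh; rewrite /n tnorm_pt; apply/eqP => /rnorm_eq0 e0.
  have := kec h 0 Uh; have := kec h 1 Uh; rewrite e0 !scaler0 => -> /eqP.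
  by rewrite oner_eq0.
have p1 h : U h -> tnorm (tscale ((n h)^-1)%:C%C (pt (e h)) : T) = 1.
  by move=> Uh; rewrite tnorm_tscale rnorm_real ger0_norm ?invr_ge0 ?tnorm_ge0// mulVf// n0.
pose s h : S := if pselect (U h) is left Uh then sig_of (p1 h Uh) else sig_pt h.
exists s.
  move=> h; rewrite /s; case: pselect => [Uh|_]; last exact: sig_base_pt.
  by rewrite /sig_base/= base_tscale base_pt.
have nU : \forall h \near g, U h by exact: open_nbhs_nbhs.
have vs h : U h -> val (s h) = tscale ((n h)^-1)%:C%C (pt (e h)).
  by rewrite /s; case: pselect.
have ec : (fun h => pt (e h) : T) @ g --> (pt (e g) : T).
  have -> : (fun h => pt (e h) : T) = (fun h => pt (1 *: e h)).
    by apply/funext => h; rewrite scale1r.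
  rewrite -[in X in _ --> X](scale1r (e g)).
  have := @cvg_within_comp _ _ _ _ (g, 1 : Cx R) G (nbhs g) _ (fun h => (h, 1 : Cx R)) Ec.
  apply => //; first exact: (cvg_pair cvg_id (cvg_cst _)).
  by apply: filterS nU => h Uh; split.
apply: cvg_Sigma; rewrite vs//.
have H : (fun h => tscale ((n h)^-1)%:C%C (pt (e h)) : T) @ g --> tscale ((n g)^-1)%:C%C (pt (e g)).
  apply: cvg_tscale => //; apply: cvg_complex; last exact: cvg_cst.
  by apply: cvgV; [exact: n0|exact: cvg_tnorm].
apply: cvg_near_eq H; apply: filterS nU => h Uh.
by rewrite vs.
Qed.

(** The projection is proper: its fibres are circles, and over a point where a
    section is continuous a limit of arrows and a limit of phases give a limit
    in the extension. *)
Lemma compact_sig_base (K : set G) : compact K -> compact (@sig_base R G L @^-1` K).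
Proof.
rewrite !compact_ultra => cK F UF FK.
have [g [Kg Fg]] := cK (@sig_base R G L @ F) (ultra_fmap _ UF) FK.
have [s sb sc] := section_at g.
pose z y : Cx R := sval (cid2 (sig_act_span (esym (sb (sig_base y))))).
have z1 y : circle (z y) by rewrite /z; case: cid2.
have zE y : y = sig_act (z y) (s (sig_base y)) by rewrite /z; case: cid2.
have := @circle_compact R; rewrite compact_ultra => cc.
have [|z0 [z01 Fz]] := cc (z @ F) (ultra_fmap _ UF).
  by rewrite nbhs_filterE /fmap/=; apply: filterS filterT => y _; exact: z1.
exists (sig_act z0 (s g)); split; first by rewrite /= sig_base_act// sb.
have : (fun y => sig_act (z y) (s (sig_base y))) @ F --> sig_act z0 (s g).
  by apply: cvg_sig_act => //; exact: (cvg_comp _ _ Fg sc).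
by under eq_fun => y do rewrite -zE.
Qed.

End CircleExtensionPoints.

(** * Sections as equivariant functions *)
Section Support.
Variables (R : realType) (X : topologicalType).
Implicit Types (F H : X -> Cx R).

Lemma Cc_of_support F (K : set X) : continuous F -> compact K -> closed K ->
  (forall x, F x != 0 -> K x) -> Cc F.
Proof.
move=> cF cK clK FK; split => //; apply: (subclosed_compact _ cK).
  exact: closed_closure.
by rewrite [X in _ `<=` X](iffLR (closure_id K))//; exact: closure_subset.
Qed.

Lemma Cc_lin (c : Cx R) F H : Cc F -> Cc H -> Cc (c *: F + H).
Proof.
move=> [cF kF] [cH kH].
apply: (@Cc_of_support _ (closure [set x | F x != 0] `|` closure [set x | H x != 0])).
- move=> x; apply: (@cvgD _ _ _ (nbhs x)); last exact: cH.
  apply: (@cvgZ _ _ _ (nbhs x) _ (fun=> c) F); [exact: cvg_cst|exact: cF].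
- exact: compactU.
- by apply: closedU; exact: closed_closure.
- move=> x /= nz; have [F0|F0] := eqVneq (F x) 0; last by left; exact: (@subset_closure _ [set x | F x != 0]).
  right; apply: (@subset_closure _ [set x | H x != 0]) => /=; apply: contra_neq nz => H0.
  by rewrite /GRing.scale/= /Algebra.add/= F0 H0 scaler0 addr0.
Qed.

Lemma Cc_support F x : F x != 0 -> closure [set x | F x != 0] x.
Proof. by move=> Fx; exact: (@subset_closure _ [set x | F x != 0]). Qed.

Lemma Cc_bounded F : Cc F -> exists2 b : R, 0 <= b & forall x, rnorm (F x) <= b.
Proof.
move=> [cF kF].
have cN : continuous (fun x => rnorm (F x)).
  by move=> x; exact: (cvg_comp _ (fun v : Cx R => rnorm v) (@cF x) (@continuous_rnorm R (Cx R) _)).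
have := @continuous_compact _ _ (fun x => rnorm (F x)) _ (continuous_subspaceT cN) kF.
move=> /compact_bounded [M [_ /(_ (Num.max M 0 + 1))]].
have -> : M < Num.max M 0 + 1 by rewrite ltr_pwDr// le_max lexx.
move=> /(_ isT) Mb; have M0 : 0 <= Num.max M 0 by rewrite le_max lexx orbT.
exists (Num.max M 0 + 1); first by rewrite addr_ge0.
move=> x; have [->|F0] := eqVneq (F x) 0; first by rewrite rnorm0 addr_ge0.
have := Mb (rnorm (F x)); rewrite /= ger0_norm ?rnorm_ge0//; apply.
by exists x => //; exact: Cc_support.
Qed.

End Support.

Section Tilde.
Variables (R : realType) (G : lc_groupoid) (L : fell_line_bundle R G).
Local Notation T := (total_space L).
Local Notation S := (Sigma L).
Implicit Types (p q : T) (y w : S) (z c : Cx R) (g : G) (f : Sect L) (F H : S -> Cx R).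

Lemma fib_scalarE c g : units g -> fib_scalar (tscale c (tunit L g)) = c.
Proof.
move=> ug; have [u0 _] := tunit_spec L ug.
have E d : pt (d *: unit_vec (@fmul _ _ L) (base (tscale c (tunit L g)))) = tscale d (tunit L g).
  by rewrite -tscale_pt -/(tunit L _) base_tscale base_tunit.
apply: xget_unique => [|d]; rewrite /= E//; exact: tscale_inj.
Qed.

(** The value of the transform at y is the coordinate of the section in the
    basis y of the fibre: from f = c y follows y^* f = c y^* y = c. *)
Lemma tilde_unique f y c : pt (f (sig_base y)) = tscale c (val y) -> tilde f y = c.
Proof.
move=> fE; rewrite /tilde -tmul_pt -/(tstar (val y)) fE.
rewrite tmul_tscaler ?base_tstar ?src_inv// tmul_starl tnorm_val expr1n tscale1.
exact: fib_scalarE (units_src _).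
Qed.

Lemma tildeE f y : pt (f (sig_base y)) = tscale (tilde f y) (val y).
Proof.
have y0 : tnorm (val y : T) != 0 by rewrite tnorm_val oner_eq0.
have [|c cE] := @fib_span _ _ L (val y) (pt (f (sig_base y))) _ y0; first exact: base_pt.
by rewrite cE; congr (tscale _ _); apply/esym; exact: tilde_unique.
Qed.

Lemma rnorm_tilde f y : rnorm (tilde f y) = rnorm (f (sig_base y)).
Proof. by rewrite -[RHS]tnorm_pt tildeE tnorm_tscale tnorm_val mulr1. Qed.

Lemma tilde_lin c f f' : tilde (c *: f + f') = c *: tilde f + tilde f'.
Proof.
apply/funext => y; apply: tilde_unique.
have E1 := congr1 (fib_at (sig_base y)) (tildeE f y).
have E2 := congr1 (fib_at (sig_base y)) (tildeE f' y).
move: E1 E2; rewrite !(fib_at_tscale _ (base_val y)) !fib_at_pt => E1 E2.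
rewrite -[val y in RHS](pt_fib_at (erefl (sig_base y))) tscale_pt; congr pt.
by rewrite scalerDl -scalerA -E1 -E2.
Qed.

Lemma tilde_equiv f z : circle z -> mu_shift z (tilde f) = z *: tilde f.
Proof.
move=> z1; apply/funext => y; apply: tilde_unique.
rewrite sig_base_act ?val_act ?tscaleA//; try exact: circleV.
by rewrite tildeE /GRing.scale/= mulrAC divff ?mul1r// circle_neq0.
Qed.

Definition equivariant F := forall z, circle z -> mu_shift z F = z *: F.

Lemma equivariantP F : equivariant F <-> forall z y, circle z -> F (sig_act z y) = z^-1 * F y.
Proof.
split=> eF z => [y z1|z1]; last first.
  apply/funext => y; rewrite /mu_shift eF ?invrK//; exact: circleV.
have := congr1 (fun H => H y) (eF _ (circleV z1)).
by rewrite /mu_shift invrK.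
Qed.

Definition untilde F : Sect L := fun g => fib_at g (tscale (F (sig_pt L g)) (val (sig_pt L g))).

Lemma untildeK f : untilde (tilde f) = f.
Proof.
apply/functional_extensionality_dep => g; rewrite /untilde -tildeE.
move: (sig_base_pt L g); move: (sig_base (sig_pt L g)) => h e.
by case: _ / e; rewrite fib_at_pt.
Qed.

Lemma tilde_untilde F : equivariant F -> tilde (untilde F) = F.
Proof.
move=> /equivariantP eF; apply/funext => y; apply: tilde_unique; rewrite /untilde.
set y' := sig_pt L _; have by' : sig_base y' = sig_base y by exact: sig_base_pt.
rewrite pt_fib_at ?base_tscale//.
have [z z1 ->] := sig_act_span by'.
by rewrite val_act// tscaleA eF// mulrAC mulVf ?mul1r// circle_neq0.
Qed.

Lemma compact_closedG (K : set G) : compact K -> closed K.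
Proof. by apply: compact_closed; exact: groupoid_hausdorff. Qed.

Lemma Cc_Sigma_support F (K : set G) : continuous F -> compact K ->
  (forall y, F y != 0 -> K (sig_base y)) -> Cc F.
Proof.
move=> cF cK FK; apply: (@Cc_of_support _ _ _ (@sig_base R G L @^-1` K)) => //.
  exact: compact_sig_base.
apply: closed_comp; last exact: compact_closedG.
by move=> y _; exact: continuous_sig_base.
Qed.

(** Supports are measured in the groupoid, where the action of the circle does not
    move them. *)
Definition gsupp F : set G := @sig_base R G L @` closure [set y | F y != 0].

Lemma gsupp_compact F : Cc F -> compact (gsupp F).
Proof.
move=> [cF kF]; apply: continuous_compact => //.
apply: continuous_subspaceT; exact: continuous_sig_base.
Qed.

Lemma gsuppP F y : F y != 0 -> gsupp F (sig_base y).
Proof. by move=> Fy; exists y => //; exact: Cc_support. Qed.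

(** In a local frame the transform is a quotient of two coordinates, that of the
    section and that of the point. *)
Lemma tilde_continuous f : continuous (fun g => pt (f g)) -> continuous (tilde f).
Proof.
move=> cf y; have [U [e [k [[oU Uy] _ kc ke kec]]]] := lb_trivial L (sig_base y).
have nU : \forall w \near y, U (sig_base w).
  by apply: continuous_sig_base; exact: open_nbhs_nbhs.
have tE (w : S) : U (sig_base w) -> tilde f w = k (pt (f (sig_base w))) / k (val w).
  move=> Uw; have kw := ke (val w) Uw.
  have kw0 : k (val w) != 0.
    apply/eqP => k0; have := tnorm_val w; rewrite -kw k0 tnorm_pt scale0r rnorm0 => /eqP.
    by rewrite eq_sym oner_eq0.
  by rewrite tildeE -[in X in k X]kw tscale_pt scalerA kec// mulfK.
have Uy' : U (base (val y : T)) by [].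
have ky0 : k (val y) != 0.
  apply/eqP => k0; have := tnorm_val y; rewrite -(ke (val y))// k0 tnorm_pt scale0r rnorm0 => /eqP.
  by rewrite eq_sym oner_eq0.
have cfy : (fun w : S => pt (f (sig_base w)) : T) @ y --> (pt (f (sig_base y)) : T).
  exact: (cvg_comp _ _ (@continuous_sig_base _ _ L y) (cf (sig_base y))).
have H : (fun w : S => k (pt (f (sig_base w))) * (k (val w))^-1) @ y -->
    k (pt (f (sig_base y))) * (k (val y))^-1.
  apply: (@cvgM _ _ (nbhs y)).
    apply: (cvg_within_comp kc _ cfy); first by rewrite /= base_pt.
    by apply: filterS nU => w; rewrite /= base_pt.
  apply: (@cvgV _ _ (nbhs y)) => //.
  by apply: (cvg_within_comp kc _ (@continuous_val_Sigma _ _ _ y)).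
rewrite -(tE y Uy) in H; apply: (@cvg_near_eq _ _ (nbhs y) _ _ _ _ _ H).
by apply: filterS nU => w Uw; rewrite tE.
Qed.

Lemma Cc_tilde f : Cc_sect f -> Cc (tilde f).
Proof.
move=> [cf kf]; apply: (Cc_Sigma_support (tilde_continuous cf) kf) => y ty.
apply: subset_closure => /=; apply: contra_neq ty => f0.
by apply: rnorm_eq0; rewrite rnorm_tilde f0 rnorm0.
Qed.

Lemma pt_untilde F y : equivariant F -> pt (untilde F (sig_base y)) = tscale (F y) (val y).
Proof. by move=> eF; rewrite tildeE tilde_untilde. Qed.

(** Near g the section is F (s h) s(h), for a section s of Sigma continuous at g. *)
Lemma Cc_untilde F : Cc F -> equivariant F -> Cc_sect (untilde F).
Proof.
move=> CF eF; have [cF _] := CF; split.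
  move=> g; have [s sb sc] := section_at L g.
  have -> : (fun h => pt (untilde F h)) = (fun h => tscale (F (s h)) (val (s h))).
    by apply/funext => h; rewrite -(pt_untilde _ eF) sb.
  apply: (@cvg_tscale _ _ _ _ (nbhs g)); last exact: cvg_val_Sigma.
  exact: (cvg_comp _ _ sc (cF _)).
apply: (subclosed_compact _ (gsupp_compact CF)); first exact: closed_closure.
have cl := compact_closedG (gsupp_compact CF).
rewrite [X in _ `<=` X](iffLR (closure_id (gsupp F)) cl).
apply: closure_subset => g /= fg; rewrite -(sig_base_pt L g); apply: gsuppP.
apply: contra_neq fg => F0; rewrite /untilde F0 fib_at_tscale ?scale0r//.
by rewrite base_val sig_base_pt.
Qed.

Lemma tilde_inj : injective (@tilde R G L).
Proof. exact: (can_inj untildeK). Qed.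

Lemma tilde_star f : tilde (sect_star f) = sig_star (tilde f).
Proof.
apply/funext => y; apply: tilde_unique; rewrite /sect_star /sig_star.
have bi : sig_base y = ginv (sig_base (sig_inv y)) by rewrite -sig_base_inv sig_invK.
rewrite pt_fib_at; last by rewrite base_pt -sig_base_inv -bi.
by rewrite -tstar_pt -sig_base_inv tildeE tstar_tscale -val_inv sig_invK.
Qed.

End Tilde.

(** * Integration on a locally compact space and on its circle extension *)
Section BorelIntegration.
Variables (R : realType) (G : ptopologicalType).
Implicit Types (D K : set G) (mu : {measure set (borel G) -> \bar R}).

Lemma open_borel (U : set G) : open U -> measurable (U : set (borel G)).
Proof. by move=> oU; apply: sub_sigma_algebra. Qed.

Lemma closed_borel K : closed K -> measurable (K : set (borel G)).
Proof. by move=> cK; rewrite -[K]setCK; apply: measurableC; apply: open_borel; exact: closed_openC. Qed.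

Lemma within_continuous_measurable D (f : G -> R) : closed D ->
  {within D, continuous f} -> measurable_fun (D : set (borel G)) (f : borel G -> R).
Proof.
move=> cD /continuousP cf; apply: (measurability _ (measurable_realfun.RGenOpens.measurableE R)).
move=> _ [_ [a [b ->] <-]].
have /open_subspaceP [V oV VE] := cf _ (@interval_open R (BRight a) (BLeft b) isT isT).
rewrite setIC (_ : _ `&` D = V `&` D); last by rewrite VE.
by apply: measurableI; [exact: open_borel|exact: closed_borel].
Qed.

(** The integrands of convolutions, as functions of the inner variable, are only
    continuous along the range fibre D over which they are integrated. *)
Definition cpt_cont D (phi : G -> Cx R) :=
  {within D, continuous phi} /\ exists2 K, compact K & forall g, D g -> phi g != 0 -> K g.

Lemma integrable_indic mu D K : measurable (D : set (borel G)) ->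
  measurable (K : set (borel G)) -> (mu K < +oo)%E ->
  mu.-integrable (D : set (borel G)) (fun g => (\1_K g)%:E).
Proof.
move=> mD mK muK; apply: integrableS (measurableT) mD _ _ => //.
apply/integrableP; split; first exact/measurable_EFinP/measurable_indic.
rewrite (eq_integral (fun x : borel G => (\1_K x)%:E)); last first.
  by move=> x _; rewrite gee0_abs// lee_fin.
by rewrite integral_indic// setIT.
Qed.

Hypothesis hausG : hausdorff_space G.

Lemma integrable_cpt mu D K (f : G -> R) : radon mu -> closed D -> compact K ->
  {within D, continuous f} -> (forall g, D g -> f g != 0 -> K g) ->
  mu.-integrable (D : set (borel G)) (EFin \o (f : borel G -> R)).
Proof.
move=> [muK _ _] cD cK cf fK.
have mD := closed_borel cD; have mK := closed_borel (compact_closed hausG cK).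
have [b0 b00 fb] : exists2 b0 : R, 0 <= b0 & forall g, D g -> K g -> `|f g| <= b0.
  have cDK : compact (D `&` K).
    by apply: (subclosed_compact _ cK); [apply: closedI => //; exact: compact_closed|exact: subIsetr].
  have cf' : {within D `&` K, continuous f} by apply: continuous_subspaceW cf; exact: subIsetl.
  have /compact_bounded [M [_ /(_ (Num.max M 0 + 1))]] := continuous_compact cf' cDK.
  have -> : M < Num.max M 0 + 1 by rewrite ltr_pwDr// le_max lexx.
  move=> /(_ isT) Mb; exists (Num.max M 0 + 1).
    by rewrite addr_ge0// le_max lexx orbT.
  by move=> g Dg Kg; apply: Mb; exists g.
apply: (@le_integrable _ _ _ mu D mD _ (fun x => (b0%:E * (\1_K x)%:E)%E)).
- by apply/measurable_EFinP; exact: within_continuous_measurable.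
- move=> g Dg /=; rewrite lee_fin normrM (ger0_norm b00) indicE.
  have [gK|gK] := boolP (g \in K).
    by rewrite normr1 mulr1 fb//; exact: set_mem.
  have -> : f g = 0.
    by apply/eqP; apply: contraNT gK => f0; rewrite inE; exact: fK.
  by rewrite normr0 mulr0.
- by apply: integrableZl => //; apply: integrable_indic => //; exact: muK.
Qed.

Definition cintegrable mu D (phi : G -> Cx R) :=
  mu.-integrable (D : set (borel G)) (EFin \o (fun g : borel G => complex.Re (phi g))) /\
  mu.-integrable (D : set (borel G)) (EFin \o (fun g : borel G => complex.Im (phi g))).

Lemma cpt_cont_integrable mu D phi : radon mu -> closed D -> cpt_cont D phi -> cintegrable mu D phi.
Proof.
move=> rmu cD [cphi [K cK phiK]]; split.
  apply: (@integrable_cpt mu D K (fun g => complex.Re (phi g))) => //.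
    move=> g; exact: (cvg_comp _ (fun z : Cx R => complex.Re z) (@cphi g) (@continuous_Re R _)).
  by move=> g Dg f0; apply: phiK => //; apply: contra_neq f0 => ->.
apply: (@integrable_cpt mu D K (fun g => complex.Im (phi g))) => //.
  move=> g; exact: (cvg_comp _ (fun z : Cx R => complex.Im z) (@cphi g) (@continuous_Im R _)).
by move=> g Dg f0; apply: phiK => //; apply: contra_neq f0 => ->.
Qed.

Section ComplexIntegral.
Variables (mu : {measure set (borel G) -> \bar R}) (D : set G).
Hypothesis cD : closed D.
Implicit Types (phi psi : G -> Cx R) (c : Cx R).
Let mD : measurable (D : set (borel G)) := closed_borel cD.

Lemma eq_cint phi psi : (forall g, D g -> phi g = psi g) -> cint mu D phi = cint mu D psi.
Proof.
move=> pp; apply: Cx_ext => /=; apply: eq_Rintegral => g /set_mem Dg; by rewrite pp.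
Qed.

Lemma cint_lin c phi psi : cintegrable mu D phi -> cintegrable mu D psi ->
  cint mu D (fun g => c * phi g + psi g) = c * cint mu D phi + cint mu D psi.
Proof.
move=> [pr pi] [qr qi].
have Z (a : R) f : mu.-integrable (D : set (borel G)) (EFin \o f) ->
    mu.-integrable (D : set (borel G)) (EFin \o (fun g => a * f g)).
  move=> fi; have := integrableZl mD a fi; apply: eq_integrable => //.
have B f f' : mu.-integrable (D : set (borel G)) (EFin \o f) ->
    mu.-integrable (D : set (borel G)) (EFin \o f') ->
    mu.-integrable (D : set (borel G)) (EFin \o (fun g => f g - f' g)).
  move=> fi f'i; have := integrableB mD fi f'i; apply: eq_integrable => //.
have A f f' : mu.-integrable (D : set (borel G)) (EFin \o f) ->
    mu.-integrable (D : set (borel G)) (EFin \o f') ->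
    mu.-integrable (D : set (borel G)) (EFin \o (fun g => f g + f' g)).
  move=> fi f'i; have := integrableD mD fi f'i; apply: eq_integrable => //.
apply: Cx_ext; rewrite /= ?Re_add ?Im_add ?Re_mul ?Im_mul /=.
  under eq_Rintegral do rewrite Re_add Re_mul.
  rewrite RintegralD//; last by apply: B; exact: Z.
  by rewrite RintegralB ?RintegralZl//; exact: Z.
under eq_Rintegral do rewrite Im_add Im_mul.
rewrite RintegralD//; last by apply: A; exact: Z.
by rewrite RintegralD ?RintegralZl//; exact: Z.
Qed.

Lemma cint0 : cint mu D (fun=> 0) = 0.
Proof. by apply: Cx_ext; rewrite /= Rintegral_cst ?mul0r. Qed.

Lemma cintegrable0 : cintegrable mu D (fun=> 0).
Proof. by split; exact: integrable0. Qed.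

Lemma cintZ c phi : cintegrable mu D phi -> cint mu D (fun g => c * phi g) = c * cint mu D phi.
Proof.
move=> ip; have := cint_lin c ip cintegrable0; rewrite cint0 addr0 => <-.
by apply: eq_cint => g _; rewrite addr0.
Qed.

(** The factor 2 is the price of estimating real and imaginary parts separately. *)
Lemma rnorm_cint_le phi K (b : R) : cintegrable mu D phi -> compact K -> (mu K < +oo)%E ->
  0 <= b -> (forall g, D g -> rnorm (phi g) <= b) -> (forall g, D g -> phi g != 0 -> K g) ->
  rnorm (cint mu D phi) <= 2 * (b * fine (mu (K `&` D))).
Proof.
move=> [ir ii] cK muK b0 phib phiK.
have mK := closed_borel (compact_closed hausG cK).
have iK : mu.-integrable (D : set (borel G)) (EFin \o (fun g => b * \1_K g)).
  suff : mu.-integrable (D : set (borel G)) (fun g => (b%:E * (\1_K g)%:E)%E).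
    by apply: eq_integrable.
  by apply: integrableZl => //; exact: integrable_indic.
have IK : Rintegral mu (D : set (borel G)) (fun g => b * \1_K g) <= b * fine (mu (K `&` D)).
  rewrite RintegralZl//; last exact: integrable_indic.
  by rewrite /Rintegral integral_indic.
have key (f : G -> R) : mu.-integrable (D : set (borel G)) (EFin \o f) ->
    (forall g, `|f g| <= rnorm (phi g)) -> `|Rintegral mu (D : set (borel G)) f| <= b * fine (mu (K `&` D)).
  move=> fi fphi; apply: le_trans IK; apply: (le_trans (le_normr_Rintegral _ _)) => //.
  apply: le_Rintegral => //; first exact: integrable_norm.
  move=> g Dg; apply: (le_trans (fphi g)); rewrite indicE.
  have [gK|gK] := boolP (g \in K); first by rewrite mulr1 phib.
  have -> : phi g = 0.
    by apply/eqP; apply: contraNT gK => f0; rewrite inE; exact: phiK.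
  by rewrite mulr0 rnorm0.
apply: (le_trans (rnorm_le_ReIm _)); rewrite mulr_natl mulr2n.
by apply: lerD; apply: key => // g; [exact: le_Re_rnorm|exact: le_Im_rnorm].
Qed.

End ComplexIntegral.

End BorelIntegration.

Section FibreCoordinate.
Variables (R : realType) (X : topologicalType) (L : line_bundle R X).
Variables (y : total_space L) (y0 : tnorm y != 0).

(** A linear functional on the fibre, as vector-valued integrals are characterised
    by functionals. *)
Definition coord (v : fib L (base y)) : Cx R :=
  sval (cid (@fib_span _ _ L y (pt v) (base_pt v) y0)).

Lemma coordE v : pt v = tscale (coord v) y.
Proof. exact: svalP (cid (@fib_span _ _ L y (pt v) (base_pt v) y0)). Qed.

Lemma coord_vec v : v = coord v *: vec y.
Proof. exact: (@pt_inj _ _ L _ _ _ (coordE v)). Qed.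

Lemma coord_is_linear : linear (coord : fib L (base y) -> (Cx R)^o).
Proof.
move=> a u v; apply: (tscale_inj y0); rewrite -coordE {1}(coord_vec u) {1}(coord_vec v).
by rewrite scalerA -scalerDl.
Qed.

HB.instance Definition _ := GRing.isLinear.Build (Cx R) (fib L (base y)) (Cx R)^o _ coord coord_is_linear.

End FibreCoordinate.

Section VectorIntegral.
Variables (R : realType) (G : ptopologicalType) (L : line_bundle R G).
Variables (mu : {measure set (borel G) -> \bar R}) (D : set G).
Hypothesis cD : closed D.

(** The vector on the right satisfies the defining property by linearity, and one
    nonzero functional, the coordinate, separates the points of a line. *)
Lemma vint_line (y : total_space L) (phi : G -> Cx R) : tnorm y != 0 -> cintegrable mu D phi ->
  vint mu (D : set (borel G)) (fun g : borel G => phi g *: vec y) = cint mu D phi *: vec y.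
Proof.
move=> y0 iphi.
have E (l : {scalar fib L (base y)}) :
    cint mu D (fun g => l (phi g *: vec y)) = cint mu D phi * l (vec y).
  rewrite mulrC -cintZ//; apply: eq_cint => g _.
  by rewrite linearZ mulrC.
apply: xget_unique => [l|v vP]; first by rewrite E linearZ.
pose l : {scalar fib L (base y)} := coord y0.
have := vP l; rewrite E => lv.
by rewrite (coord_vec y0 v) -[coord y0 v]/(l v) lv -scalerA -coord_vec.
Qed.

End VectorIntegral.

Section FibreIntegral.
Variables (R : realType) (G : lc_groupoid) (L : fell_line_bundle R G).
Local Notation T := (total_space L).
Local Notation S := (Sigma L).
Implicit Types (y w : S) (z c : Cx R) (g : G) (F H P Q : S -> Cx R) (D K : set G).

(** Integrals over the orbits vary continuously when their approximations by means
    over roots of unity are uniform, which takes a modulus common to all orbits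
    over D. *)
Definition orbit_unif D P := forall e : R, 0 < e -> exists2 d : R, 0 < d &
  forall s, `|s| < d -> forall y, D (sig_base y) -> rnorm (P (sig_act (turn s) y) - P y) <= e.

(** The functions to which the Haar system of Sigma is applied over the arrows in D.
    The set D is there because convolution integrands are meaningful over a single
    range fibre only. *)
Definition admissible D P :=
  [/\ {within @sig_base R G L @^-1` D, continuous P}, orbit_unif D P &
      exists2 K, compact K & forall y, D (sig_base y) -> P y != 0 -> K (sig_base y)].

Lemma orbit_unif_modulus D P (d e : R) y : D (sig_base y) ->
  (forall s, `|s| < d -> forall w, D (sig_base w) -> rnorm (P (sig_act (turn s) w) - P w) <= e) ->
  modulus (fun z => P (sig_act z y)) d e.
Proof.
move=> Dy Pd s sd z z1; rewrite -sig_actA//; last exact: circle_turn.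
by apply: Pd => //; rewrite sig_base_act.
Qed.

Lemma orbit_unif_circle D P y : D (sig_base y) -> orbit_unif D P -> circle_unif (fun z => P (sig_act z y)).
Proof. by move=> Dy uP e /uP[d d0 Pd]; exists d => //; exact: orbit_unif_modulus Dy Pd. Qed.

(** Two points over the same arrow differ by a rotation, which preserves the integral. *)
Lemma sig_fibre_intE D P y : D (sig_base y) -> orbit_unif D P ->
  sig_fibre_int P (sig_base y) = circle_int (fun z => P (sig_act z y)).
Proof.
move=> Dy uP; apply: xget_unique => [|c [w wy ->]]; first by exists y.
have [u u1 ->] := sig_act_span wy.
rewrite -(circle_int_rot u1 (orbit_unif_circle Dy uP)); apply: eq_circle_int => z z1.
by rewrite sig_actA// mulrC.
Qed.

Lemma sig_fibre_int_eq P Q g : (forall y, sig_base y = g -> P y = Q y) ->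
  sig_fibre_int P g = sig_fibre_int Q g.
Proof.
move=> PQ; congr xget; apply/seteqP; split => c [y yg ->]; exists y => //;
  by apply: eq_circle_int => z z1; rewrite PQ// sig_base_act.
Qed.

Lemma sig_fibre_int_inv_cst P y c : (forall w, sig_base w = sig_base y -> P w = c) ->
  sig_fibre_int P (sig_base y) = c.
Proof.
move=> Pc; apply: xget_unique => [|d [w wy ->]].
  by exists y => //; apply/esym/circle_int_cst => z z1; rewrite Pc// sig_base_act.
by apply: circle_int_cst => z z1; rewrite Pc// sig_base_act.
Qed.

Lemma cvg_root_mean (I : Type) (E : set_system I) {EE : Filter E} (p : I -> Cx R -> Cx R)
    (p0 : Cx R -> Cx R) n : (forall z, circle z -> p ^~ z @ E --> p0 z) ->
  (fun i => root_mean n (p i)) @ E --> root_mean n p0.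
Proof.
move=> pp; apply: cvgM; first exact: cvg_cst.
by apply: cvg_big => [|j _]; [exact: add_continuous|apply: pp; exact: circle_turn].
Qed.

(** The fibre integral is a uniform limit over D of means over roots of unity, and
    each mean is continuous at g when computed along a section continuous at g. *)
Lemma sig_fibre_int_cpt_cont D P : admissible D P -> cpt_cont D (sig_fibre_int P).
Proof.
move=> [cP uP [K cK PK]]; split; last first.
  exists K => // g Dg; apply: contraNP => nKg; apply/eqP.
  rewrite -(sig_base_pt L g); apply: sig_fibre_int_inv_cst => w wg.
  apply/eqP; apply: contra_notT nKg => Pw; rewrite -(sig_base_pt L g) -wg.
  by apply: PK => //; rewrite wg sig_base_pt.
apply/subspace_continuousP => g Dg.
have [s sb sc] := section_at L g.
have phiE h : D h -> sig_fibre_int P h = circle_int (fun z => P (sig_act z (s h))).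
  by move=> Dh; rewrite -{1}(sb h); apply: sig_fibre_intE uP; rewrite sb.
apply/cvg_rnormP => e e0; have e8 : 0 < e / 8 by lra.
have [d d0 Pd] := uP _ e8; have [n n0 nd] := small_inv_nat d0.
have approx h : D h ->
    rnorm (sig_fibre_int P h - root_mean n (fun z => P (sig_act z (s h)))) <= 2 * (e / 8).
  move=> Dh; rewrite phiE//; have Dsh : D (sig_base (s h)) by rewrite sb.
  exact: (circle_int_root_mean (orbit_unif_circle Dsh uP) (orbit_unif_modulus Dsh Pd)).
have WF : Filter (within D (nbhs g)) by exact: within_filter.
have nD : \forall h \near within D (nbhs g), D h by exact: withinT.
have scW : s @ within D (nbhs g) --> s g.
  by apply: cvg_trans sc; apply: cvg_app; exact: cvg_within.
have rc : (fun h => root_mean n (fun z => P (sig_act z (s h)))) @ within D (nbhs g) -->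
    root_mean n (fun z => P (sig_act z (s g))).
  apply: cvg_root_mean => z z1; apply: (cvg_within_comp cP).
  - by rewrite /= sig_base_act// sb.
  - by apply: cvg_sig_act => //; exact: cvg_cst.
  - by apply: filterS nD => h Dh; rewrite /= sig_base_act// sb.
have e4 : 0 < e / 4 by lra.
have nR := iffLR (cvg_rnormP _ _) rc _ e4.
near=> h; have Dh : D h by near: h.
have H3 : rnorm (root_mean n (fun z => P (sig_act z (s g))) -
    root_mean n (fun z => P (sig_act z (s h)))) < e / 4 by near: h; exact: nR.
move: H3 (approx h Dh) (approx g Dg).
rewrite /from_subspace; set a := sig_fibre_int P g; set b := sig_fibre_int P h.
set u := root_mean n _; set v := root_mean n _ => H3 H2 H1.
have := rnorm_distD u a b; have := rnorm_distD v u b; rewrite (rnorm_distC v b); lra.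
Unshelve. all: by end_near.
Qed.

Lemma admissible_lin D c P Q : admissible D P -> admissible D Q -> admissible D (fun y => c * P y + Q y).
Proof.
move=> [cP uP [K cK PK]] [cQ uQ [K' cK' QK]]; split.
- move=> y; apply: cvgD; last exact: cQ.
  by apply: cvgM; [exact: cvg_cst|exact: cP].
- move=> e e0; have c0 : 0 < rnorm c + 1 by have := rnorm_ge0 (V := Cx R) c; lra.
  have e1' : 0 < e / (2 * (rnorm c + 1)) by rewrite divr_gt0//; lra.
  have e2 : 0 < e / 2 by lra.
  have [d d0 Pd] := uP _ e1'; have [d' d'0 Qd] := uQ _ e2.
  exists (Num.min d d'); first by rewrite lt_min d0.
  move=> s; rewrite lt_min => /andP[sd sd'] y Dy.
  have -> : c * P (sig_act (turn s) y) + Q (sig_act (turn s) y) - (c * P y + Q y) =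
    c * (P (sig_act (turn s) y) - P y) + (Q (sig_act (turn s) y) - Q y) by ring.
  apply: (le_trans (rnormD (_ : Cx R) _)); rewrite rnormM.
  have : rnorm c * rnorm (P (sig_act (turn s) y) - P y) <= e / 2.
    have := Pd s sd y Dy; rewrite ler_pdivlMr; last lra.
    have := rnorm_ge0 (P (sig_act (turn s) y) - P y : Cx R).
    nra.
  have := Qd s sd' y Dy; lra.
- exists (K `|` K'); first exact: compactU.
  move=> y Dy; have [P0|P0 _] := eqVneq (P y) 0; last by left; exact: PK.
  by rewrite P0 mulr0 add0r => Q0; right; exact: QK.
Qed.

Lemma sig_fibre_int_lin D c P Q g : D g -> orbit_unif D P -> orbit_unif D Q -> orbit_unif D (fun y => c * P y + Q y) ->
  sig_fibre_int (fun y => c * P y + Q y) g = c * sig_fibre_int P g + sig_fibre_int Q g.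
Proof.
move=> Dg uP uQ uPQ; rewrite -(sig_base_pt L g) in Dg *.
rewrite !(sig_fibre_intE Dg)//.
by rewrite -circle_intZD//; exact: orbit_unif_circle Dg _.
Qed.

Lemma admissible_norm D P : admissible D P -> admissible D (fun y => (rnorm (P y))%:C%C).
Proof.
move=> [cP uP [K cK PK]]; split.
- move=> y; apply: cvg_complex; last exact: cvg_cst.
  exact: (cvg_comp _ (fun v : Cx R => rnorm v) (@cP y) (@continuous_rnorm R (Cx R) _)).
- move=> e /uP[d d0 Pd]; exists d => // s sd y Dy.
  rewrite -raddfB/= rnorm_real; apply: (le_trans (rnorm_dist_dist _ _)); exact: Pd.
- exists K => // y Dy P0; apply: PK => //; apply: contra_neq P0 => ->.
  by rewrite rnorm0.
Qed.

(** Continuity of the action, made uniform by the compactness of the preimage in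
    Sigma of a compact set of arrows. *)
Lemma Cc_orbit_unif F : Cc F -> orbit_unif setT F.
Proof.
move=> CF e e0; have [cF _] := CF.
have /compact_near_coveringP cov := compact_sig_base (L := L) (gsupp_compact CF).
have e2 : 0 < e / 2 by lra.
have : \forall s \near (0 : R), forall y : S, (@sig_base R G L @^-1` gsupp F) y ->
    rnorm (F (sig_act (turn s) y) - F y) < e.
  apply: (cov R (nbhs (0 : R)) (fun s y => rnorm (F (sig_act (turn s) y) - F y) < e)) => y _.
  have c1 : (fun p : S * R => F (sig_act (turn p.2) p.1)) @ filter_prod (nbhs y) (nbhs (0 : R)) --> F y.
    have -> : F y = F (sig_act (turn 0) y) by rewrite turn0 sig_act1.
    apply: (cvg_comp (fun p : S * R => sig_act (turn p.2) p.1) F _ (cF (sig_act (turn 0) y))).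
    apply: (@cvg_sig_act _ _ _ _ _ _ (fun p : S * R => turn p.2)).
    + by move=> p; exact: circle_turn.
    + exact: circle_turn.
    + apply: (@cvg_comp _ _ _ snd (@turn R) _ (nbhs (0 : R))); [exact: cvg_snd|exact: continuous_turn].
    + exact: cvg_fst.
  have c2 : (fun p : S * R => F p.1) @ filter_prod (nbhs y) (nbhs (0 : R)) --> F y.
    apply: (@cvg_comp _ _ _ fst F _ (nbhs y)); first exact: cvg_fst.
    exact: (cF y).
  have n1 := iffLR (cvg_rnormP _ _) c1 _ e2; have n2 := iffLR (cvg_rnormP _ _) c2 _ e2.
  near=> p; have h1 : rnorm (F y - F (sig_act (turn p.2) p.1)) < e / 2 by near: p; exact: n1.
  have h2 : rnorm (F y - F p.1) < e / 2 by near: p; exact: n2.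
  have := rnorm_distD (F y) (F (sig_act (turn p.2) p.1)) (F p.1).
  rewrite (rnorm_distC _ (F y)); lra.
move=> /nbhs_ballP [d /= d0 dP]; exists d => // s sd y _.
have [Ky|nKy] := pselect (gsupp F (sig_base y)).
  by apply/ltW/dP => //; rewrite /ball/= sub0r normrN.
have F0 : forall w, sig_base w = sig_base y -> F w = 0.
  by move=> w wy; apply/eqP; apply: contra_notT nKy => /gsuppP; rewrite wy.
by rewrite !F0 ?subrr ?rnorm0 ?ltW// sig_base_act//; exact: circle_turn.
Unshelve. all: by end_near.
Qed.

Lemma admissible_Cc F D : Cc F -> admissible D F.
Proof.
move=> CF; split.
- by apply: continuous_subspaceT; case: CF.
- by move=> e /(Cc_orbit_unif CF)[d d0 Fd]; exists d => // s sd y _; exact: Fd.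
- by exists (gsupp F); [exact: gsupp_compact|move=> y _; exact: gsuppP].
Qed.

(** Rotating w by z rotates w^-1 y by z^-1, so the moduli of the two factors
    combine. *)
Lemma admissible_conv F H y : Cc F -> Cc H ->
  admissible (rfiber (rng (sig_base y))) (fun w => F w * H (sig_mul (sig_inv w) y)).
Proof.
move=> CF CH; have [cF _] := CF; have [cH _] := CH.
have [a a0 Fa] := Cc_bounded CF; have [b b0 Hb] := Cc_bounded CH.
split.
- apply/subspace_continuousP => w /= Dw; apply: cvgM.
    exact: (cvg_trans (cvg_app _ (cvg_within _)) (cF w)).
  apply: (cvg_comp (fun w => sig_mul (sig_inv w) y) H _ (cH _)).
  have WF : Filter (within (@sig_base R G L @^-1` rfiber (rng (sig_base y))) (nbhs w)).
    exact: within_filter.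
  apply: cvg_sig_mul.
  + by near=> w' => /=; rewrite sig_base_inv src_inv; near: w'; exact: withinT.
  + by rewrite sig_base_inv src_inv.
  + by apply: cvg_sig_inv; exact: cvg_within.
  + exact: cvg_cst.
- move=> e e0; have e1' : 0 < e / (2 * (b + 1)) by rewrite divr_gt0//; lra.
  have e2' : 0 < e / (2 * (a + 1)) by rewrite divr_gt0//; lra.
  have [d d0 Fd] := Cc_orbit_unif CF e1'; have [d' d'0 Hd] := Cc_orbit_unif CH e2'.
  exists (Num.min d d'); first by rewrite lt_min d0.
  move=> s; rewrite lt_min => /andP[sd sd'] w Dw.
  have c1 : circle (turn s) by exact: circle_turn.
  rewrite sig_inv_act// -turnN sig_mul_actl; [|exact: circle_turn|by rewrite sig_base_inv src_inv].
  set u := sig_mul _ _; set w' := sig_act _ w; set u' := sig_act _ u.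
  have -> : F w' * H u' - F w * H u = (F w' - F w) * H u' + F w * (H u' - H u) by ring.
  apply: (le_trans (rnormD (_ : Cx R) _)); rewrite !rnormM.
  have h1 : rnorm (F w' - F w) * rnorm (H u') <= e / 2.
    have := Fd s sd w I; rewrite -/w' ler_pdivlMr; last lra.
    have := rnorm_ge0 (F w' - F w : Cx R); have := Hb u'; nra.
  have h2 : rnorm (F w) * rnorm (H u' - H u) <= e / 2.
    have := Hd (- s); rewrite normrN => /(_ sd' u I); rewrite -/u' ler_pdivlMr; last lra.
    have := rnorm_ge0 (H u' - H u : Cx R); have := Fa w; nra.
  lra.
- exists (gsupp F); first exact: gsupp_compact.
  move=> w _; rewrite mulf_eq0 negb_or => /andP[Fw _]; exact: gsuppP.
Unshelve. all: by end_near.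
Qed.

End FibreIntegral.

(** * Convolution *)
Lemma circle_intZ (R : realType) (c : Cx R) (P : Cx R -> Cx R) : circle_unif P ->
  circle_int (fun z => c * P z) = c * circle_int P.
Proof.
move=> uP; have := circle_intZD c uP (circle_unif_cst (0 : Cx R)).
rewrite (circle_int_cst (P := fun=> 0) (c := 0))// addr0 => <-.
by apply: eq_circle_int => z _; rewrite addr0.
Qed.

Section Convolution.
Variables (R : realType) (G : lc_groupoid) (alpha : haar_system R G) (L : fell_line_bundle R G).
Local Notation T := (total_space L).
Local Notation S := (Sigma L).
Local Notation conv := (@sig_conv R G alpha L).
Implicit Types (y w : S) (z c : Cx R) (g x : G) (F H P Q : S -> Cx R) (D K : set G).

Let hausG : hausdorff_space G := @groupoid_hausdorff G.

Lemma closed_rfiber x : closed (rfiber x).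
Proof.
apply: (@closed_comp _ _ (@rng G) [set x]).
  by move=> g _; exact: rng_continuous.
by apply: accessible_closed_set1; exact: hausdorff_accessible.
Qed.

Lemma sig_haar_integrable x P : units x -> admissible (rfiber x) P ->
  cintegrable (alpha x) (rfiber x) (sig_fibre_int P).
Proof.
move=> ux gP; apply: cpt_cont_integrable => //.
- exact: haar_radon.
- exact: closed_rfiber.
- exact: sig_fibre_int_cpt_cont.
Qed.

Lemma eq_sig_haar x P Q : (forall y, rng (sig_base y) = x -> P y = Q y) ->
  sig_haar alpha x P = sig_haar alpha x Q.
Proof.
move=> PQ; apply: eq_cint.
move=> g /= gx; apply: sig_fibre_int_eq => y yg; apply: PQ; by rewrite yg.
Qed.

Lemma sig_haar_lin x c P Q : units x -> admissible (rfiber x) P -> admissible (rfiber x) Q ->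
  sig_haar alpha x (fun y => c * P y + Q y) = c * sig_haar alpha x P + sig_haar alpha x Q.
Proof.
move=> ux gP gQ; rewrite /sig_haar -cint_lin//; try exact: sig_haar_integrable; last exact: closed_rfiber.
apply: eq_cint.
move=> g Dg; have [_ uP _] := gP; have [_ uQ _] := gQ; have [_ uPQ _] := admissible_lin c gP gQ.
exact: sig_fibre_int_lin Dg uP uQ uPQ.
Qed.

Lemma rnorm_sig_fibre_int D P (b : R) g : D g -> orbit_unif D P ->
  (forall y, D (sig_base y) -> rnorm (P y) <= b) -> rnorm (sig_fibre_int P g) <= b.
Proof.
move=> Dg uP Pb; rewrite -(sig_base_pt L g) in Dg *; rewrite (sig_fibre_intE Dg)//.
apply: le_rnorm_circle_int; first exact: orbit_unif_circle Dg uP.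
by move=> z z1; apply: Pb; rewrite sig_base_act.
Qed.

Lemma rnorm_sig_haar_le x P K (b : R) : units x -> admissible (rfiber x) P -> compact K -> 0 <= b ->
  (forall y, rng (sig_base y) = x -> rnorm (P y) <= b) ->
  (forall y, rng (sig_base y) = x -> P y != 0 -> K (sig_base y)) ->
  rnorm (sig_haar alpha x P) <= 2 * (b * fine (alpha x (K `&` rfiber x))).
Proof.
move=> ux gP cK b0 Pb PK; apply: rnorm_cint_le => //.
- exact: closed_rfiber.
- exact: sig_haar_integrable.
- by have [muK _ _] := haar_radon alpha ux; exact: muK.
- move=> g Dg; have [_ uP _] := gP; exact: rnorm_sig_fibre_int Dg uP Pb.
- move=> g Dg; apply: contraNP => nKg; apply/eqP.
  rewrite -(sig_base_pt L g); apply: sig_fibre_int_inv_cst => w wg.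
  apply/eqP; apply: contra_notT nKg => Pw; rewrite -(sig_base_pt L g) -wg.
  by apply: PK => //; rewrite wg sig_base_pt.
Qed.

Lemma eq_vint (mu : {measure set (borel G) -> \bar R}) D (V : normedModType (Cx R))
    (u v : borel G -> V) : (forall g, D g -> u g = v g) ->
  vint mu (D : set (borel G)) u = vint mu (D : set (borel G)) v.
Proof.
move=> uv; congr xget; apply/seteqP; split => a /= aE l; rewrite aE; apply: eq_cint => g Dg;
  by rewrite uv.
Qed.

Lemma tildeE_at (f : Sect L) y g : sig_base y = g -> pt (f g) = tscale (tilde f y) (val y).
Proof. by move=> <-; exact: tildeE. Qed.

(** Writing f(h) = F(w) w and g(h^-1 k) = H(w^-1 y) w^-1 y for w over h and y over
    k, the integrand of the convolution of sections is F(w) H(w^-1 y) times the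
    fixed vector y, and that coefficient does not depend on the choice of w. *)
Lemma tilde_conv (f g : Sect L) : Cc_sect f -> Cc_sect g ->
  tilde (sect_conv alpha f g) = conv (tilde f) (tilde g).
Proof.
move=> Cf Cg; apply/funext => y; apply: tilde_unique.
set F := tilde f; set H := tilde g; set k := sig_base y.
have tk : tnorm (val y : T) != 0 by rewrite tnorm_val oner_eq0.
have gFH := admissible_conv y (Cc_tilde Cf) (Cc_tilde Cg).
rewrite -/F -/H -/k in gFH.
set P := fun w => _ in gFH.
have iP := sig_haar_integrable (units_rng k) gFH.
rewrite /sect_conv (_ : vint _ _ _ = cint (alpha (rng k)) (rfiber (rng k)) (sig_fibre_int P) *: vec (val y : T)).
  by rewrite -tscale_pt pt_vec.
rewrite -(vint_line (closed_rfiber (x := _)) tk iP).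
apply: eq_vint => h /= hk; pose w := sig_pt L h; have wh : sig_base w = h by exact: sig_base_pt.
pose u := sig_mul (sig_inv w) y.
have cwy : src (sig_base (sig_inv w)) = rng (sig_base y) by rewrite sig_base_inv src_inv wh.
have bu : sig_base u = gcomp (ginv h) k by rewrite /u sig_base_mul// sig_base_inv wh.
have wk : rng (sig_base w) = rng (sig_base y) by rewrite wh.
have -> : sig_fibre_int P h = F w * H u.
  rewrite -{1}wh; apply: sig_fibre_int_inv_cst => w' w'w.
  have [z z1 ->] := sig_act_span w'w.
  have eF := iffLR (equivariantP F) (tilde_equiv f); have eH := iffLR (equivariantP H) (tilde_equiv g).
  rewrite /P sig_inv_act// sig_mul_actl; [|exact: circleV|by []].
  rewrite -/u eF// eH; last exact: circleV.
  by rewrite invrK mulrACA mulVf ?mul1r// circle_neq0.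
apply: (@pt_inj _ _ L); rewrite pt_fib_at; last first.
  rewrite base_pt -[RHS](comp_rng k) -hk -(comp_inv_r h) Defs.compA ?rng_inv ?src_inv//.
rewrite -tmul_pt (tildeE_at f wh) (tildeE_at g bu) tmul_tscalel ?tmul_tscaler ?base_tscale//.
- by rewrite tscaleA sig_inv_mulK// -tscale_pt pt_vec.
- by rewrite !base_val wh bu rng_gcomp ?rng_inv// src_inv.
- by rewrite !base_val wh bu rng_gcomp ?rng_inv// src_inv.
Qed.

Lemma sig_conv_linr F c H1 H2 y : Cc F -> Cc H1 -> Cc H2 ->
  conv F (fun w => c * H1 w + H2 w) y = c * conv F H1 y + conv F H2 y.
Proof.
move=> CF C1 C2; have g1 := admissible_conv y CF C1; have g2 := admissible_conv y CF C2.
rewrite /sig_conv -(sig_haar_lin c (units_rng _) g1 g2).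
by apply: eq_sig_haar => w _; rewrite mulrDr mulrCA.
Qed.

Lemma sig_conv0r F y : conv F (fun=> 0) y = 0.
Proof.
set x := rng (sig_base y); apply: (@eq_trans _ _ (cint (alpha x) (rfiber x) (fun=> 0))).
  apply: eq_cint => g _; rewrite -(sig_base_pt L g).
  apply: sig_fibre_int_inv_cst => w _; exact: mulr0.
exact/cint0/closed_rfiber.
Qed.

Lemma Cc0 : Cc (fun _ : S => 0 : Cx R).
Proof.
apply: (@Cc_Sigma_support _ _ _ _ set0); [exact: cst_continuous|exact: compact0|].
by move=> y; rewrite eqxx.
Qed.

Lemma Cc_sum n (c : nat -> Cx R) (H : nat -> S -> Cx R) : (forall j, Cc (H j)) ->
  Cc (fun w => \sum_(j < n) c j * H j w).
Proof.
move=> CH; elim: n => [|n IH].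
  under eq_fun do rewrite big_ord0; exact: Cc0.
under eq_fun do rewrite big_ord_recr/= addrC.
exact: (Cc_lin (c n) (CH n) IH).
Qed.

Lemma sig_conv_sumr F n (c : nat -> Cx R) (H : nat -> S -> Cx R) y : Cc F -> (forall j, Cc (H j)) ->
  conv F (fun w => \sum_(j < n) c j * H j w) y = \sum_(j < n) c j * conv F (H j) y.
Proof.
move=> CF CH; elim: n => [|n IH].
  rewrite big_ord0 -[RHS](sig_conv0r F y); congr (conv F _ y).
  by apply/funext => w; rewrite big_ord0.
rewrite big_ord_recr/= addrC -IH -(sig_conv_linr (c n) y CF (CH n) (Cc_sum n c CH)).
by congr (conv F _ y); apply/funext => w; rewrite big_ord_recr/= addrC.
Qed.

Lemma rnorm_sig_conv F H y (a b : R) : Cc F -> Cc H -> 0 <= a -> 0 <= b ->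
  (forall w, rnorm (F w) <= a) -> (forall w, rnorm (H w) <= b) ->
  rnorm (conv F H y) <= 2 * (a * b * fine (alpha (rng (sig_base y)) (gsupp F `&` rfiber (rng (sig_base y))))).
Proof.
move=> CF CH a0 b0 Fa Hb; apply: rnorm_sig_haar_le.
- exact: units_rng.
- exact: admissible_conv.
- exact: gsupp_compact.
- exact: mulr_ge0.
- by move=> w _; rewrite rnormM ler_pM ?rnorm_ge0.
- by move=> w _; rewrite mulf_eq0 negb_or => /andP[Fw _]; exact: gsuppP.
Qed.

End Convolution.

(** * The spectral projection onto degree one *)
Section Projection.
Variables (R : realType) (G : lc_groupoid) (alpha : haar_system R G) (L : fell_line_bundle R G).
Local Notation T := (total_space L).
Local Notation S := (Sigma L).
Local Notation conv := (@sig_conv R G alpha L).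
Implicit Types (y w : S) (z c : Cx R) (g x : G) (F H P Q : S -> Cx R).

Lemma modulus_le (P : Cx R -> Cx R) (d d' e : R) : d' <= d -> modulus P d e -> modulus P d' e.
Proof. by move=> dd Pd s sd; apply: Pd; exact: lt_le_trans dd. Qed.

Lemma modulus_mulz (P : Cx R -> Cx R) (b d e : R) : (forall z, circle z -> rnorm (P z) <= b) ->
  (forall s, `|s| < d -> rnorm (turn s - 1) * b <= e / 2) -> modulus P d (e / 2) ->
  modulus (fun z => z * P z) d e.
Proof.
move=> Pb db Pd s sd z z1; have z1' := iffLR (circleP z) z1.
have s1 := iffLR (circleP _) (circle_turn s).
have -> : turn s * z * P (turn s * z) - z * P z =
  (turn s - 1) * P z * z + turn s * z * (P (turn s * z) - P z) by ring.
apply: (le_trans (rnormD (_ : Cx R) _)); rewrite !rnormM z1' s1 mulr1 !mul1r.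
have := Pd s sd z z1; have := db s sd.
have : rnorm (turn s - 1) * rnorm (P z) <= rnorm (turn s - 1) * b.
  by rewrite ler_wpM2l ?rnorm_ge0// Pb.
lra.
Qed.

Lemma turn_near1 (e : R) : 0 < e -> exists2 d, 0 < d & forall s, `|s| < d -> rnorm (turn s - 1) <= e.
Proof.
move=> e0; have H := iffLR (cvg_rnormP _ _) (@continuous_turn R 0) _ e0.
have : \forall s \near (0 : R), rnorm (1 - turn s) < e by rewrite -turn0; exact: H.
move=> /nbhs_ballP[d /= d0 dP]; exists d => // s sd.
by rewrite rnorm_distC; apply/ltW/dP; rewrite /ball/= sub0r normrN.
Qed.

(** One modulus for all orbits, by boundedness of F and orbit_unif. *)
Lemma Cc_modulus F : Cc F -> forall e : R, 0 < e -> exists2 d, 0 < d &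
  forall y, modulus (fun z => z * F (sig_act z y)) d e.
Proof.
move=> CF e e0; have [b b0 Fb] := Cc_bounded CF.
have e2 : 0 < e / 2 by lra.
have e2b : 0 < e / 2 / (b + 1) by rewrite divr_gt0//; lra.
have [d d0 Fd] := Cc_orbit_unif CF e2; have [d' d'0 d'P] := turn_near1 e2b.
exists (Num.min d d'); first by rewrite lt_min d0.
move=> y; apply: (modulus_mulz (b := b)) => [z _|s|].
- exact: Fb.
- rewrite lt_min => /andP[_ /d'P]; rewrite ler_pdivlMr; last lra.
  have := rnorm_ge0 (turn s - 1 : Cx R); nra.
- apply: (modulus_le (d := d)); first by rewrite ge_min lexx.
  exact: (orbit_unif_modulus (D := setT)).
Qed.

Lemma Cc_circle_unif F y : Cc F -> circle_unif (fun z => z * F (sig_act z y)).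
Proof. by move=> CF e /(Cc_modulus CF)[d d0 Fd]; exists d. Qed.

(** The integral of z^-1 mu_z(F) over the circle, that is the Fourier component of
    degree one for the action of the circle. *)
Definition deg1 F : S -> Cx R := fun y => circle_int (fun z => z * F (sig_act z y)).

(** A finite combination of rotations of F, so that the same combination can be
    formed for elements of a completion on which rotations act. *)
Definition deg1_mean n F : S -> Cx R := fun y => root_mean n (fun z => z * F (sig_act z y)).

Lemma deg1_approx F : Cc F -> forall e : R, 0 < e -> exists2 d : R, 0 < d &
  forall n, (0 < n)%N -> n%:R^-1 < d -> forall y, rnorm (deg1 F y - deg1_mean n F y) <= e.
Proof.
move=> CF e e0; have e2 : 0 < e / 2 by lra.
have [d d0 Fd] := Cc_modulus CF e2; exists d => // n n0 nd y.
apply: (le_trans (circle_int_root_mean (Cc_circle_unif y CF) (Fd y) n0 nd)); lra.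
Qed.

Lemma Cc_act F z : circle z -> Cc F -> Cc (fun y => F (sig_act z y)).
Proof.
move=> z1 CF; have [cF _] := CF.
apply: (Cc_Sigma_support _ (gsupp_compact CF)).
  move=> y; apply: (cvg_comp (sig_act z) F _ (cF _)).
  apply: (@cvg_sig_act _ _ _ _ (nbhs y) _ (fun=> z) id) => //; exact: cvg_cst.
by move=> y /gsuppP; rewrite sig_base_act.
Qed.

Lemma Cc_mu_shift F z : circle z -> Cc F -> Cc (mu_shift z F).
Proof. by move=> z1; apply: Cc_act; exact: circleV. Qed.

Lemma deg1_mean_sum n F y : deg1_mean n F y =
  \sum_(j < n) (n%:R^-1 * turn (j%:R / n%:R)) * F (sig_act (turn (j%:R / n%:R)) y).
Proof. by rewrite /deg1_mean /root_mean mulr_sumr; apply: eq_bigr => j _; rewrite mulrA. Qed.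

Lemma Cc_deg1_mean n F : Cc F -> Cc (deg1_mean n F).
Proof.
move=> CF.
have := @Cc_sum R G L n (fun j => n%:R^-1 * turn (j%:R / n%:R))
  (fun j y => F (sig_act (turn (j%:R / n%:R)) y)).
have -> : (fun w : S => \sum_(j < n) n%:R^-1 * turn (j%:R / n%:R) *
    F (sig_act (turn (j%:R / n%:R)) w)) = deg1_mean n F.
  by apply/funext => y; rewrite deg1_mean_sum.
by apply => j; apply: Cc_act => //; exact: circle_turn.
Qed.

Lemma deg1_supp F y : Cc F -> deg1 F y != 0 -> gsupp F (sig_base y).
Proof.
move=> CF; apply: contraNP => ny; apply/eqP; apply: circle_int_cst => z z1.
have -> : F (sig_act z y) = 0; last by rewrite mulr0.
by apply/eqP; apply: contra_notT ny => /gsuppP; rewrite sig_base_act.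
Qed.

Lemma deg1_mean_supp n F y : (0 < n)%N -> Cc F -> deg1_mean n F y != 0 -> gsupp F (sig_base y).
Proof.
move=> n0 CF; apply: contraNP => ny; apply/eqP; apply: root_mean_cst => // z z1.
have -> : F (sig_act z y) = 0; last by rewrite mulr0.
by apply/eqP; apply: contra_notT ny => /gsuppP; rewrite sig_base_act.
Qed.

Lemma Cc_deg1 F : Cc F -> Cc (deg1 F).
Proof.
move=> CF; apply: (Cc_Sigma_support _ (gsupp_compact CF)); last by move=> y; exact: deg1_supp.
move=> y; apply/(@cvg_rnormP R (Cx R) _ (nbhs y) (nbhs_filter y)) => e e0.
have e3 : 0 < e / 4 by lra.
have [d d0 Fd] := deg1_approx CF e3; have [n n0 nd] := small_inv_nat d0.
have [cn _] := Cc_deg1_mean n CF.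
have nR := iffLR (cvg_rnormP _ _) (cn y) _ e3.
near=> w; have h3 : rnorm (deg1_mean n F y - deg1_mean n F w) < e / 4 by near: w; exact: nR.
have := Fd n n0 nd y; have := Fd n n0 nd w.
have := rnorm_distD (deg1_mean n F y) (deg1 F y) (deg1 F w).
have := rnorm_distD (deg1_mean n F w) (deg1_mean n F y) (deg1 F w).
rewrite (rnorm_distC (deg1_mean n F w)); lra.
Unshelve. all: by end_near.
Qed.

Lemma deg1_equivariant F : Cc F -> equivariant (deg1 F).
Proof.
move=> CF; apply/equivariantP => u y u1.
rewrite /deg1 -(circle_int_rot u1 (Cc_circle_unif y CF)) -circle_intZ; last exact: circle_unif_rot (Cc_circle_unif y CF).
apply: eq_circle_int => z z1.
by rewrite sig_actA// [z * u]mulrC !mulrA mulVf ?mul1r// circle_neq0.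
Qed.

Lemma deg1_id F : equivariant F -> deg1 F = F.
Proof.
move=> /equivariantP eF; apply/funext => y; apply: circle_int_cst => z z1.
by rewrite eF// mulrA divff ?mul1r// circle_neq0.
Qed.

Lemma deg1_lin c F H : Cc F -> Cc H -> deg1 (c *: F + H) = c *: deg1 F + deg1 H.
Proof.
move=> CF CH; apply/funext => y.
rewrite [RHS](_ : _ = c * deg1 F y + deg1 H y)// -circle_intZD; try exact: Cc_circle_unif.
by apply: eq_circle_int => z _; rewrite /= mulrDr; congr (_ + _); rewrite mulrCA.
Qed.

Lemma Cc_sig_inv F : Cc F -> Cc (fun y => F (sig_inv y)).
Proof.
move=> CF; have [cF _] := CF.
apply: (@Cc_Sigma_support _ _ _ _ (@ginv G @` gsupp F)).
- move=> y; apply: (cvg_comp (@sig_inv R G L) F _ (cF _)); exact: (@cvg_sig_inv _ _ _ _ (nbhs y) _ id y cvg_id).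
- apply: continuous_compact; last exact: gsupp_compact.
  by apply: continuous_subspaceT; exact: Defs.inv_continuous.
- move=> y /gsuppP Fy; exists (sig_base (sig_inv y)) => //.
  by rewrite -sig_base_inv sig_invK.
Qed.

Lemma Cc_sig_star F : Cc F -> Cc (sig_star F).
Proof.
move=> CF; have [cF kF] := Cc_sig_inv CF; split.
  move=> y; apply/(@cvg_rnormP R (Cx R) _ (nbhs y) (nbhs_filter y)) => e e0.
  apply: filterS (iffLR (cvg_rnormP _ _) (cF y) _ e0) => w.
  by rewrite /sig_star -rmorphB rnorm_conj.
congr (compact (closure _)): kF; apply/seteqP; split => y /=; by rewrite /sig_star conjC_eq0.
Qed.

(** The star of F at z y is the conjugate of F at z^-1 y^-1, so that the two averages
    differ by inversion of the circle; the weight z becomes z^-1 under both. *)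
Lemma deg1_star F : Cc F -> deg1 (sig_star F) = sig_star (deg1 F).
Proof.
move=> CF; apply/funext => y; rewrite /sig_star /deg1.
have CFi := Cc_sig_inv CF.
rewrite -(circle_int_inv (Cc_circle_unif y (Cc_sig_star CF))).
set P := fun z => z * F _; have uP : circle_unif P by exact: Cc_circle_unif.
have -> : Num.conj (circle_int P) = circle_int (fun z => Num.conj (P z)).
  apply/eqP; rewrite -subr_eq0; apply/eqP; apply: rnorm_le_eps => e e0.
  have uP' : circle_unif (fun z => Num.conj (P z)).
    move=> e' /uP[d d0 Pd]; exists d => // s sd z z1.
    by rewrite -rmorphB rnorm_conj; exact: Pd.
  have e2 : 0 < e / 2 by lra.
  have [d d0 Pd] := root_mean_approx uP e2; have [d' d'0 Qd] := root_mean_approx uP' e2.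
  have [n n0 nd] : exists2 n, (0 < n)%N & n%:R^-1 < Num.min d d'.
    by apply: small_inv_nat; rewrite lt_min d0.
  move: nd; rewrite lt_min => /andP[nd nd'].
  have rE : Num.conj (root_mean n P) = root_mean n (fun z => Num.conj (P z)).
    by rewrite /root_mean rmorphM fmorphV rmorph_nat rmorph_sum.
  apply: (le_trans (rnorm_distD (Num.conj (root_mean n P)) _ _)).
  rewrite -rmorphB rnorm_conj rE (rnorm_distC (root_mean n _)).
  have := Pd n n0 nd; have := Qd n n0 nd'; lra.
apply: eq_circle_int => z z1; rewrite /P /sig_star [in RHS]rmorphM/= (circle_conj z1).
rewrite sig_inv_act; last exact: circleV.
by rewrite invrK.
Qed.

(** Rotating the product rotates the second factor, so averaging the product is
    averaging the second factor; the exchange of the mean with the Haar integral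
    is harmless because the means converge uniformly. *)
Lemma deg1_conv_r F H : Cc F -> Cc H -> deg1 (conv F H) = conv F (deg1 H).
Proof.
move=> CF CH; apply/funext => y.
have [a a0 Fa] := Cc_bounded CF.
set m := fine (alpha (rng (sig_base y)) (gsupp F `&` rfiber (rng (sig_base y)))).
have m0 : 0 <= m by rewrite fine_ge0.
have convE z : circle z -> conv F H (sig_act z y) = conv F (fun w => H (sig_act z w)) y.
  move=> z1; rewrite /sig_conv (sig_base_act y z1); apply: eq_sig_haar => w wy.
  have cwy : src (sig_base (sig_inv w)) = rng (sig_base y) by rewrite sig_base_inv src_inv.
  by rewrite (sig_mul_actr z1 cwy).
have convB z H1 H2 : Cc H1 -> Cc H2 -> conv F H1 y - conv F H2 y = conv F (fun w => (-1) * H2 w + H1 w) y.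
  by move=> C1 C2; rewrite (sig_conv_linr alpha (-1) y CF C2 C1) mulN1r addrC.
pose b := 2 * (a * m) + 1; have b0 : 0 < b by rewrite ltr_pwDr// mulr_ge0// mulr_ge0.
have close (H1 H2 : S -> Cx R) e : Cc H1 -> Cc H2 -> 0 <= e -> (forall w, rnorm (H1 w - H2 w) <= e) ->
    rnorm (conv F H1 y - conv F H2 y) <= e * b.
  move=> C1 C2 e0 HH; rewrite (convB 1)//.
  have CD : Cc (fun w => (-1) * H2 w + H1 w) by exact: (Cc_lin (-1) C2 C1).
  have := @rnorm_sig_conv R G alpha L F _ y a e CF CD a0 e0 Fa _.
  rewrite -/m => /(_ _)/le_trans; apply.
    by move=> w; rewrite mulN1r addrC.
  rewrite /b mulrDr mulr1; nra.
pose q z := conv F H (sig_act z y).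
have uq : circle_unif q.
  move=> e e0; have eb : 0 < e / b by rewrite divr_gt0.
  have [d d0 Hd] := Cc_orbit_unif CH eb; exists d => // s sd z z1.
  rewrite /q !convE//; last by apply: circleM => //; exact: circle_turn.
  apply: (@le_trans _ _ (e / b * b)); last by rewrite divfK// gt_eqF.
  apply: close; [|exact: Cc_act|exact: ltW|].
    by apply: Cc_act => //; apply: circleM => //; exact: circle_turn.
  by move=> w; rewrite -sig_actA//; [exact: Hd|exact: circle_turn].
have [bq b_q] : exists bq : R, forall z, circle z -> rnorm (q z) <= bq.
  have [bH bH0 Hb] := Cc_bounded CH.
  exists (2 * (a * bH * m)) => z z1; rewrite /q convE//.
  by apply: rnorm_sig_conv => //; exact: Cc_act.
have uzq : circle_unif (fun z => z * q z).
  move=> e e0; have e2 : 0 < e / 2 by lra.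
  have [d d0 qd] := uq _ e2; have bq0 : 0 <= bq.
    by apply: le_trans (b_q 1 (@circle1 R)); exact: rnorm_ge0.
  have e2b : 0 < e / 2 / (bq + 1) by rewrite divr_gt0//; lra.
  have [d' d'0 d'P] := turn_near1 e2b.
  exists (Num.min d d'); first by rewrite lt_min d0.
  apply: (modulus_mulz (b := bq)) => [z z1|s|]; first exact: b_q.
    rewrite lt_min => /andP[_ /d'P]; rewrite ler_pdivlMr; last lra.
    have := rnorm_ge0 (turn s - 1 : Cx R); nra.
  by apply: (modulus_le (d := d)) => //; rewrite ge_min lexx.
apply/eqP; rewrite -subr_eq0; apply/eqP; apply: rnorm_le_eps => e e0.
have e2 : 0 < e / 2 by lra.
have e2b : 0 < e / 2 / b by rewrite divr_gt0.
have [d d0 qd] := root_mean_approx uzq e2; have [d' d'0 Hd] := deg1_approx CH e2b.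
have [n n0 nd] : exists2 n, (0 < n)%N & n%:R^-1 < Num.min d d'.
  by apply: small_inv_nat; rewrite lt_min d0.
move: nd; rewrite lt_min => /andP[nd nd'].
have rE : root_mean n (fun z => z * q z) = conv F (deg1_mean n H) y.
  have -> : deg1_mean n H = fun w => \sum_(j < n) (n%:R^-1 * turn (j%:R / n%:R)) *
      H (sig_act (turn (j%:R / n%:R)) w) by apply/funext => w; rewrite deg1_mean_sum.
  have CHj (j : nat) : Cc (fun w => H (sig_act (turn (j%:R / n%:R)) w)).
    by apply: Cc_act => //; exact: circle_turn.
  rewrite (@sig_conv_sumr R G alpha L F n (fun j => n%:R^-1 * turn (j%:R / n%:R)) _ y CF CHj).
  rewrite /root_mean mulr_sumr; apply: eq_bigr => j _; by rewrite mulrA /q (convE _ (circle_turn _)).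
have h1 : rnorm (deg1 (conv F H) y - conv F (deg1_mean n H) y) <= e / 2.
  by rewrite -rE; exact: qd.
have h2 : rnorm (conv F (deg1_mean n H) y - conv F (deg1 H) y) <= e / 2 / b * b.
  apply: close; [exact: Cc_deg1_mean|exact: Cc_deg1|exact: ltW|].
  by move=> w; rewrite rnorm_distC; exact: Hd.
rewrite divfK ?gt_eqF// in h2.
apply: (le_trans (rnorm_distD (conv F (deg1_mean n H) y) _ _)); apply: (le_trans (lerD h1 h2)).
by rewrite -splitr.
Qed.

(** By deg1_conv_r only the first factor is left.  Since deg1 H is equivariant, the
    average of F(w) (deg1 H)(w^-1 y) over the orbit of w is the weighted average
    of F that defines deg1 F, times (deg1 H)(w^-1 y). *)
Lemma deg1_conv F H : Cc F -> Cc H -> deg1 (conv F H) = conv (deg1 F) (deg1 H).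
Proof.
move=> CF CH; rewrite (deg1_conv_r CF CH); apply/funext => y.
rewrite /sig_conv /sig_haar; apply: eq_cint => h /= hy.
set w := sig_pt L h; have wh : sig_base w = h by exact: sig_base_pt.
have eH := iffLR (equivariantP _) (deg1_equivariant CH).
have eF := iffLR (equivariantP _) (deg1_equivariant CF).
set u := sig_mul (sig_inv w) y.
have uE z : circle z -> sig_mul (sig_inv (sig_act z w)) y = sig_act z^-1 u.
  move=> z1; rewrite sig_inv_act// sig_mul_actl//; first exact: circleV.
  by rewrite sig_base_inv src_inv wh.
have Dw : rfiber (rng (sig_base y)) (sig_base w) by rewrite wh.
have [_ uP _] := admissible_conv y CF (Cc_deg1 CH).
rewrite -{1}wh (sig_fibre_intE Dw uP).
have -> : sig_fibre_int (fun w => deg1 F w * deg1 H (sig_mul (sig_inv w) y)) h = deg1 F w * deg1 H u.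
  rewrite -{1}wh; apply: sig_fibre_int_inv_cst => w' w'w; have [z z1 ->] := sig_act_span w'w.
  rewrite uE// eF// eH; last exact: circleV.
  by rewrite invrK mulrACA mulVf ?mul1r// circle_neq0.
rewrite [RHS]mulrC -circle_intZ; last exact: Cc_circle_unif.
apply: eq_circle_int => z z1; rewrite uE// eH; last exact: circleV.
by rewrite invrK; ring.
Qed.

End Projection.

(** * Haar measures of compact sets and the I-norm *)
(** Induction over compact sets.  If P K failed, the sets A for which P holds on K
    minus A would form a proper filter containing K, and the locality of P excludes
    a cluster point in K. *)
Lemma compact_local_ind (X : topologicalType) (P : set X -> Prop) :
  P set0 -> (forall A B, P A -> P B -> P (A `|` B)) -> (forall A B : set X, A `<=` B -> P B -> P A) ->
  (forall x : X, exists2 V : set X, nbhs x V & P V) -> forall K : set X, compact K -> P K.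
Proof.
move=> P0 PU PS Ploc K cK; apply: contrapT => nK.
pose F := [set A : set X | P (K `\` A)].
have PF : ProperFilter F.
  split; first by rewrite /F/= setD0.
  split.
  - by rewrite /F/= setDT.
  - by move=> A B FA FB; rewrite /F/= setDIr; exact: PU.
  - by move=> A B AB; apply: PS; apply: setDS.
have FK : F K by rewrite /F/= setDv.
have [x [Kx clx]] := cK F PF FK.
have [V Vx PV] := Ploc x.
have FV : F (~` V) by rewrite /F/= setDE setCK; apply: PS PV; exact: subIsetr.
by have [y []] := clx _ _ FV Vx.
Qed.

Section HaarBound.
Variables (R : realType) (G : lc_groupoid) (alpha : haar_system R G).
Implicit Types (g x : G) (K V : set G).

Let hausG : hausdorff_space G := @groupoid_hausdorff G.

Lemma bump_function g : exists2 f : G -> R,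
  [/\ continuous f, (forall h, 0 <= f h) & f g = 1] &
  exists2 K, compact K & forall h, f h != 0 -> K h.
Proof.
have [U Ug [cU clU]] := @groupoid_locally_compact G g I.
have {}Ug : nbhs g U.
  by have := Ug; rewrite /within/=; apply: filterS => h; apply.
have cr := @locally_compact_completely_regular G R (@groupoid_locally_compact G) hausG.
have clUo : closed (~` U^°) by apply: open_closedC; exact: open_interior.
have nUg : ~ (~` U^°) g by apply.
have /(@uniform_separatorP _ R) [f [cf f01 fg fU]] := cr g (~` U^°) clUo nUg.
exists (fun h => 1 - f h); last first.
  exists U => // h; apply: contraNP => nUh; apply/eqP.
  suff -> : f h = 1 by rewrite subrr.
  by apply: fU; exists h => //= /interior_subset.
split.
- by move=> h; apply: cvgB; [exact: cvg_cst|exact: cf].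
- move=> h; have /f01 : range f (f h) by exists h.
  by rewrite /= in_itv/= subr_ge0 => /andP[].
- have -> : f g = 0 by apply: fg; exists g.
  by rewrite subr0.
Qed.

Lemma continuous_ReC (X : topologicalType) (f : X -> R) :
  continuous f -> continuous (fun h => (f h)%:C%C : Cx R).
Proof. by move=> cf h; apply: cvg_complex; [exact: cf|exact: cvg_cst]. Qed.

(** By the continuity axiom of Haar systems the integral is a continuous function of
    the unit; it vanishes off the compact set of ranges of K. *)
Lemma haar_integral_bounded (f : G -> R) K : continuous f -> compact K ->
  (forall h, f h != 0 -> K h) ->
  exists2 C : R, 0 <= C & forall x, units x ->
    Rintegral (alpha x) (rfiber x) (f : borel G -> R) <= C.
Proof.
move=> cf cK fK; pose F h : Cx R := (f h)%:C%C.
have CF : Cc F.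
  apply: (Cc_of_support (continuous_ReC cf) cK); first exact: (compact_closed hausG).
  by move=> h; rewrite /F => F0; apply: fK; apply: contra_neq F0 => ->.
have hc := @haar_continuous R G alpha F CF.
pose I0 x := complex.Re (cint (alpha x) (rfiber x) F).
have cI : {within @units G, continuous I0}.
  by move=> x; exact: (cvg_comp _ (fun z : Cx R => complex.Re z) (hc x) (@continuous_Re R _)).
have ck : compact (@rng G @` K).
  apply: continuous_compact => //; apply: continuous_subspaceT; exact: rng_continuous.
have cI' : {within @rng G @` K, continuous I0}.
  by apply: continuous_subspaceW cI => _ [h _ <-]; exact: units_rng.
have /compact_bounded [M [_ /(_ (Num.max M 0 + 1))]] := continuous_compact cI' ck.
have -> : M < Num.max M 0 + 1 by rewrite ltr_pwDr// le_max lexx.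
move=> /(_ isT) Mb; have M0 : 0 <= Num.max M 0 by rewrite le_max lexx orbT.
exists (Num.max M 0 + 1); first by rewrite addr_ge0.
move=> x ux; have [[h Kh hx]|nx] := pselect ((@rng G @` K) x).
  by apply: le_trans (ler_norm _) _; apply: Mb; exists x => //; exists h.
suff -> : Rintegral (alpha x) (rfiber x) (f : borel G -> R) = 0 by rewrite addr_ge0.
rewrite (eq_Rintegral _ (g := fun=> 0)); last first.
  move=> h /set_mem hx; apply/eqP; apply: contra_notT nx => f0.
  by exists h => //; exact: fK.
by rewrite Rintegral_cst ?mul0r//; apply: closed_borel; exact: closed_rfiber.
Qed.

(** The measurable superset makes the property pass to arbitrary subsets, as
    compact_local_ind requires. *)
Definition haar_bounded (A : set G) := exists B : set G,
  [/\ measurable (B : set (borel G)), A `<=` B &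
   exists2 C : R, 0 <= C & forall x, units x -> (alpha x (B `&` rfiber x) <= C%:E)%E].

Lemma haar_boundedU A B : haar_bounded A -> haar_bounded B -> haar_bounded (A `|` B).
Proof.
move=> [A' [mA AA [a a0 Aa]]] [B' [mB BB [b b0 Bb]]]; exists (A' `|` B'); split.
- exact: measurableU.
- exact: setUSS.
- exists (a + b); first exact: addr_ge0.
  move=> x ux; rewrite setIUl EFinD.
  have mr : measurable (rfiber x : set (borel G)) by apply: closed_borel; exact: closed_rfiber.
  apply: (le_trans (measureU2 _ _ _)); [exact: measurableI|exact: measurableI|].
  by apply: leeD; [exact: Aa|exact: Bb].
Qed.

(** The Haar measures of the set where a bump function exceeds 1/2 are at most
    twice its integrals. *)
Lemma haar_bounded_local g : exists2 V : set G, nbhs g V & haar_bounded V.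
Proof.
have [f [cf f0 fg] [K cK fK]] := bump_function g.
have [C C0 Cf] := haar_integral_bounded cf cK fK.
have oV : open [set h | 2^-1 < f h].
  apply: (@open_comp _ _ f [set y : R | 2^-1 < y]); first by move=> h _; exact: cf.
  exact: open_gt.
exists [set h | 2^-1 < f h].
  apply: open_nbhs_nbhs; split => //=; rewrite fg; lra.
exists [set h | 2^-1 < f h]; split => //; first exact: open_borel.
exists (2 * C); first by rewrite mulr_ge0.
move=> x ux; set V := [set h | _].
have cr := closed_rfiber (x := x).
have mr : measurable (rfiber x : set (borel G)) by exact: closed_borel.
have mV : measurable (V : set (borel G)) by exact: open_borel.
have fi : (alpha x).-integrable (rfiber x : set (borel G)) (EFin \o (f : borel G -> R)).
  apply: (integrable_cpt hausG (haar_radon alpha ux) cr cK) => //.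
    exact: continuous_subspaceT.
  by move=> h _; exact: fK.
rewrite -integral_indic//.
apply: (@le_trans _ _ (\int[alpha x]_(h in rfiber x) (2 * f h)%:E)%E).
  apply: ge0_le_integral => //.
  - apply/(measurable_EFinP (rfiber x : set (borel G)) (\1_V : borel G -> R)).
    exact: measurable_indic.
  - apply/measurable_EFinP; apply: (@measurable_funM _ _ _ _ (fun=> 2) (f : borel G -> R)); first exact: measurable_cst.
    apply: within_continuous_measurable => //; exact: continuous_subspaceT.
  - move=> h _; rewrite lee_fin indicE; have [hV|hV] := boolP (h \in V).
      by have := set_mem hV; rewrite /V/= => H; rewrite -ler_pdivrMl// mulr1; exact: ltW.
    by rewrite mulr_ge0.
have -> : (\int[alpha x]_(h in rfiber x) (2 * f h)%:E = (2 * Rintegral (alpha x) (rfiber x) (f : borel G -> R))%:E)%E.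
  rewrite EFinM /Rintegral fineK; last exact: integrable_fin_num.
  by rewrite -integralZl//; apply: eq_integral => h _; rewrite EFinM.
by rewrite lee_fin ler_wpM2l// Cf.
Qed.

Lemma haar_bounded_compact K : compact K -> haar_bounded K.
Proof.
move: K; apply: compact_local_ind.
- by exists set0; split => //; exists 0 => // x _; rewrite set0I measure0.
- exact: haar_boundedU.
- by move=> A B AB [B' [mB BB H]]; exists B'; split => //; exact: subset_trans BB.
- exact: haar_bounded_local.
Qed.

Lemma haar_compact_bound K : compact K -> exists2 C : R, 0 <= C & forall x, units x ->
  fine (alpha x (K `&` rfiber x)) <= C.
Proof.
move=> cK; have [B [mB KB [C C0 BC]]] := haar_bounded_compact cK.
exists C => // x ux.
have mr : measurable (rfiber x : set (borel G)) by apply: closed_borel; exact: closed_rfiber.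
have mK : measurable (K : set (borel G)) by apply: closed_borel; exact: (compact_closed hausG).
have KC : (alpha x (K `&` rfiber x) <= C%:E)%E.
  apply: le_trans (BC x ux); apply: le_measure; rewrite ?inE; [exact: measurableI|exact: measurableI|].
  exact: setSI.
rewrite -lee_fin fineK// ge0_fin_numE//; exact: le_lt_trans KC (ltry _).
Qed.

End HaarBound.

Section INorm.
Variables (R : realType) (G : lc_groupoid) (alpha : haar_system R G) (L : fell_line_bundle R G).
Local Notation T := (total_space L).
Local Notation S := (Sigma L).
Implicit Types (y w : S) (z c : Cx R) (g x : G) (F H P Q : S -> Cx R).

Let hausG : hausdorff_space G := @groupoid_hausdorff G.

Lemma norm_fun F : (fun y => `|F y| : Cx R) = (fun y => (rnorm (F y))%:C%C).
Proof. by apply/funext => y; exact: normE. Qed.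

Lemma fine_le_ge0 (e : \bar R) : (0 <= e)%E -> ((fine e)%:E <= e)%E.
Proof. by case: e => [r||]//=; rewrite leey. Qed.

Lemma measurable_rnorm_sect (f : Sect L) (D : set G) : continuous (fun g => pt (f g)) -> closed D ->
  measurable_fun (D : set (borel G)) (fun g : borel G => (rnorm (f g))%:E).
Proof.
move=> cf cD; apply/measurable_EFinP; apply: (within_continuous_measurable (f := fun g => rnorm (f g))) => //.
apply: continuous_subspaceT => g.
have -> : (fun g => rnorm (f g)) = (fun g => tnorm (pt (f g))).
  by apply/funext => h; rewrite tnorm_pt.
exact: (@cvg_tnorm _ _ _ _ (nbhs g) _ _ (cf g)).
Qed.

Lemma sect_integral_inv (f : Sect L) x : continuous (fun g => pt (f g)) ->
  (\int[haar_tilde alpha x]_(g in sfiber x) (rnorm (f g))%:E =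
   \int[alpha x]_(g in rfiber x) (rnorm (f (ginv g)))%:E)%E.
Proof.
move=> cf; have cs : closed (sfiber x : set G).
  apply: (@closed_comp _ _ (@src G) [set x]).
    by move=> g _; exact: src_continuous.
  by apply: accessible_closed_set1; exact: hausdorff_accessible.
have minv : measurable_fun setT (@ginv G : borel G -> borel G).
  apply: (@measurability _ _ (borel G) (borel G) setT _ (@open G)) => //.
  move=> _ [U oU <-]; rewrite setTI; apply: open_borel.
  by apply: open_comp => // g _; exact: Defs.inv_continuous.
rewrite /haar_tilde ge0_integral_pushforward//.
- congr (integral _ _ _); apply/seteqP; split => g /=; by rewrite /sfiber/= src_inv.
- exact: closed_borel.
- exact: measurable_rnorm_sect.
- by move=> g _; rewrite lee_fin rnorm_ge0.
Qed.

(** Only an inequality: the real-valued integral on the left is 0 by convention when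
    the one on the right is infinite. *)
Lemma sig_haar_cst_le x (P : S -> Cx R) (n : G -> R) : (forall g, 0 <= n g) ->
  (forall y, rng (sig_base y) = x -> P y = (n (sig_base y))%:C%C) ->
  ((complex.Re (sig_haar alpha x P))%:E <= \int[alpha x]_(g in rfiber x) (n g)%:E)%E.
Proof.
move=> n0 Pn; rewrite /sig_haar /cint/=.
rewrite (eq_Rintegral _ (g := (n : borel G -> R))).
  by apply: fine_le_ge0; apply: integral_ge0 => g _; rewrite lee_fin.
move=> g /set_mem gx; have -> // : sig_fibre_int P g = (n g)%:C%C.
have gx' : rng g = x by [].
rewrite -(sig_base_pt L g); apply: sig_fibre_int_inv_cst => w wg.
by rewrite Pn// wg sig_base_pt.
Qed.

(** The transform preserves norms pointwise, so the circle integrals are trivial. *)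
Lemma sig_Inorm_tilde (f : Sect L) : Cc_sect f ->
  (sig_Inorm alpha (tilde f) <= sect_Inorm alpha f)%E.
Proof.
move=> [cf _]; rewrite /sig_Inorm /sect_Inorm ge_max; apply/andP; split; rewrite le_max; apply/orP.
- left; apply: ge_ereal_sup => _ [x ux <-]; rewrite norm_fun.
  apply: le_trans (ereal_sup_ubound _); last by exists x.
  apply: sig_haar_cst_le => [g|y _]; first exact: rnorm_ge0.
  by rewrite rnorm_tilde.
- right; apply: ge_ereal_sup => _ [x ux <-]; rewrite (norm_fun (fun y => tilde f (sig_inv y))).
  apply: le_trans (ereal_sup_ubound _); last by exists x.
  rewrite sect_integral_inv//.
  apply: (sig_haar_cst_le (n := fun g => rnorm (f (ginv g)))) => [g|y _]; first exact: rnorm_ge0.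
  by rewrite rnorm_tilde sig_base_inv.
Qed.

Lemma le_sig_haar x (P : S -> Cx R) (n : G -> R) : units x -> admissible (rfiber x) P ->
  measurable_fun (rfiber x : set (borel G)) (fun g : borel G => (n g)%:E) -> (forall g, 0 <= n g) ->
  (forall g, rng g = x -> n g <= complex.Re (sig_fibre_int P g)) ->
  (\int[alpha x]_(g in rfiber x) (n g)%:E <= (complex.Re (sig_haar alpha x P))%:E)%E.
Proof.
move=> ux gP mn n0 nP; have [iP _] := sig_haar_integrable alpha ux gP.
have mr : measurable (rfiber x : set (borel G)) by apply: closed_borel; exact: closed_rfiber.
rewrite /sig_haar /cint/= /Rintegral fineK; last exact: integrable_fin_num.
apply: ge0_le_integral => //.
- by move=> g _; rewrite lee_fin.
- by case/integrableP: iP.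
Qed.

Lemma rnorm_deg1_le F y : Cc F ->
  rnorm (deg1 F y) <= complex.Re (sig_fibre_int (fun w => (rnorm (F w))%:C%C) (sig_base y)).
Proof.
move=> CF; have [_ u _] := admissible_norm (admissible_Cc setT CF).
rewrite (sig_fibre_intE (D := setT) (y := y) I u).
apply: (le_trans (rnorm_circle_int (Cc_circle_unif y CF))).
rewrite (eq_circle_int (Q := fun z => (rnorm (F (sig_act z y)))%:C%C))//.
by move=> z /circleP z1; rewrite rnormM z1 mul1r.
Qed.

Lemma rnorm_untilde F g : rnorm (untilde F g) = rnorm (F (sig_pt L g)).
Proof.
by rewrite -tnorm_pt pt_fib_at ?base_tscale ?base_val ?sig_base_pt// tnorm_tscale tnorm_val mulr1.
Qed.

(** Averaging over the circle does not increase the integral of the norm.  The half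
    of the I-norm that involves inverses reduces to the same fact for the star of
    F. *)
Lemma sect_Inorm_deg1 F : Cc F -> (sect_Inorm alpha (untilde (deg1 F)) <= sig_Inorm alpha F)%E.
Proof.
move=> CF; have C1 := Cc_deg1 CF; have eq1 := deg1_equivariant CF.
have [cf _] := Cc_untilde C1 eq1.
have rE y : rnorm (untilde (deg1 F) (sig_base y)) = rnorm (deg1 F y).
  by rewrite -rnorm_tilde tilde_untilde.
rewrite /sig_Inorm /sect_Inorm ge_max; apply/andP; split; rewrite le_max; apply/orP.
- left; apply: ge_ereal_sup => _ [x ux <-]; rewrite norm_fun.
  apply: le_trans (ereal_sup_ubound _); last by exists x.
  apply: le_sig_haar => //.
  + exact: admissible_norm (admissible_Cc _ CF).
  + by apply: measurable_rnorm_sect => //; exact: closed_rfiber.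
  + by move=> g; exact: rnorm_ge0.
  + move=> g _; rewrite rnorm_untilde -[g in sig_fibre_int _ g](sig_base_pt L g).
    exact: rnorm_deg1_le.
- right; apply: ge_ereal_sup => _ [x ux <-]; rewrite (norm_fun (fun y => F (sig_inv y))).
  apply: le_trans (ereal_sup_ubound _); last by exists x.
  have CFi := Cc_sig_inv CF.
  have nE g : rnorm (untilde (deg1 F) (ginv g)) = rnorm (deg1 (sig_star F) (sig_pt L g)).
    rewrite deg1_star// /sig_star rnorm_conj -rE sig_base_inv.
    by move: (sig_base _) (sig_base_pt L g) => h ->.
  rewrite sect_integral_inv//; apply: le_sig_haar => //.
  + exact: admissible_norm (admissible_Cc _ CFi).
  + have cfs := (Cc_untilde (Cc_deg1 (Cc_sig_star CF)) (deg1_equivariant (Cc_sig_star CF))).1.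
    have := measurable_rnorm_sect cfs (closed_rfiber (x := x)).
    congr (measurable_fun _ _); apply/funext => g; congr (_%:E).
    by rewrite nE rnorm_untilde.
  + by move=> g; exact: rnorm_ge0.
  + move=> g _; rewrite nE; apply: (le_trans (rnorm_deg1_le _ (Cc_sig_star CF))).
    rewrite sig_base_pt (_ : (fun w => (rnorm (sig_star F w))%:C%C) = (fun w => (rnorm (F (sig_inv w)))%:C%C))//.
    by apply/funext => w; rewrite /sig_star rnorm_conj.
Qed.

(** The means converge to the projection in the I-norm, being uniformly close to
    it on a fixed set that is compact modulo the circle. *)
Lemma sig_Inorm_approx F (e : R) : Cc F -> 0 < e -> exists2 n, (0 < n)%N &
  (sig_Inorm alpha (deg1 F - deg1_mean n F)%R <= e%:E)%E.
Proof.
move=> CF e0; have cK := gsupp_compact CF.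
(* the second half of the I-norm sees the support through the inversion *)
have cK' : compact (@ginv G @` gsupp F).
  apply: continuous_compact => //.
  by apply: continuous_subspaceT; exact: Defs.inv_continuous.
have [C C0 CK] := haar_compact_bound alpha (compactU cK cK').
have eC : 0 < e / (2 * (C + 1)) by rewrite divr_gt0//; lra.
have [d d0 Fd] := deg1_approx CF eC; have [n n0 nd] := small_inv_nat d0.
exists n => //; set D := deg1 F - deg1_mean n F.
have DE y : D y = deg1 F y - deg1_mean n F y by [].
have CD : Cc D.
  have -> : D = (-1) *: deg1_mean n F + deg1 F by rewrite scaleN1r addrC.
  by apply: Cc_lin; [exact: Cc_deg1_mean|exact: Cc_deg1].
have De y : rnorm (D y) <= e / (2 * (C + 1)) by rewrite DE; exact: Fd.
have DK y : D y != 0 -> gsupp F (sig_base y).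
  rewrite DE; have [->|p0 _] := eqVneq (deg1 F y) 0; last exact: deg1_supp.
  by rewrite sub0r oppr_eq0; exact: deg1_mean_supp.
have key (P : S -> Cx R) x : units x -> Cc P -> (forall y, rnorm (P y) <= e / (2 * (C + 1))) ->
    (forall y, P y != 0 -> (gsupp F `|` @ginv G @` gsupp F) (sig_base y)) ->
    complex.Re (sig_haar alpha x (fun y => (rnorm (P y))%:C%C)) <= e.
  move=> ux CP Pe PK; apply: le_trans (ler_norm _) _; apply: le_trans (le_Re_rnorm _) _.
  have := @rnorm_sig_haar_le R G alpha L x (fun y => (rnorm (P y))%:C%C)
    (gsupp F `|` @ginv G @` gsupp F) (e / (2 * (C + 1))) ux
    (admissible_norm (admissible_Cc _ CP)) (compactU cK cK') (ltW eC) _ _.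
  move=> /(_ _ _)/le_trans; apply.
  - by move=> y _; rewrite rnorm_real ger0_norm ?rnorm_ge0.
  - by move=> y _ Py; apply: PK; apply: contra_neq Py => ->; rewrite rnorm0.
  - have := CK x ux; set m := fine _ => mC.
    have m0 : 0 <= m by exact: fine_ge0.
    have h : e / (2 * (C + 1)) * m <= e / (2 * (C + 1)) * (C + 1).
      by rewrite ler_wpM2l ?ltW//; lra.
    have h2 : e / (2 * (C + 1)) * (C + 1) = e / 2.
      by field; lra.
    lra.
rewrite /sig_Inorm ge_max; apply/andP; split; apply: ge_ereal_sup => _ [x ux <-]; rewrite lee_fin.
- rewrite norm_fun; apply: key => // y Dy; left; exact: DK.
- rewrite (norm_fun (fun y => D (sig_inv y))); apply: key => //; first exact: Cc_sig_inv.
  move=> y Dy; right; exists (sig_base (sig_inv y)); first exact: DK.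
  by rewrite -sig_base_inv sig_invK.
Qed.

End INorm.

(** * Completions *)
Section DenseExtension.
Variable R : realType.

Lemma dense_rnorm (V : normedModType (Cx R)) (D : set V) (v : V) (e : R) : dense D -> 0 < e ->
  exists2 w, D w & rnorm (v - w) < e.
Proof.
move=> dD e0; have e0' : 0 < e%:C%C :> Cx R by rewrite (_ : 0 = 0%:C%C)// ltcR.
have [|w [we Dw]] := dD (ball v (e%:C%C)) _ (ball_open _ _).
  by exists v; exact: ballxx.
exists w => //; move: we; rewrite -ball_normE/= normE.
by rewrite ltcR.
Qed.

Lemma continuous_dense_eq (V W : normedModType (Cx R)) (D : set V) (u v : V -> W) : dense D ->
  continuous u -> continuous v -> (forall a, D a -> u a = v a) -> u = v.
Proof.
move=> dD cu cv uv; apply/funext => a; apply/eqP; rewrite -subr_eq0; apply/eqP.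
apply: rnorm_le_eps => e e0; have e2 : 0 < e / 2 by lra.
have H : nbhs a [set b | rnorm (u a - u b) < e / 2 /\ rnorm (v a - v b) < e / 2].
  apply: filterI; first exact: (iffLR (cvg_rnormP _ _) (cu a) _ e2).
  exact: (iffLR (cvg_rnormP _ _) (cv a) _ e2).
move: H; rewrite nbhsE => -[W' [oW Wa] WH].
have [|b [Wb Db]] := dD W' _ oW; first by exists a.
have [h1 h2] := WH b Wb; apply: (le_trans (rnorm_distD (u b) _ _)).
rewrite (uv b Db) in h1 *; rewrite (rnorm_distC (v b)); lra.
Qed.

Lemma lipschitz_cont (V W : normedModType (Cx R)) (u : V -> W) (C : R) :
  (forall a b, rnorm (u a - u b) <= C * rnorm (a - b)) -> continuous u.
Proof.
move=> uC a; apply/(@cvg_rnormP R W _ (nbhs a) (nbhs_filter a)) => e e0.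
have C1 : 0 < `|C| + 1 by rewrite ltr_pwDr.
have eC : 0 < e / (`|C| + 1) by rewrite divr_gt0.
apply: filterS (near_rnorm a eC) => b ab; apply: (le_lt_trans (uC _ _)).
have h : C * rnorm (a - b) <= (`|C| + 1) * rnorm (a - b).
  by rewrite ler_wpM2r ?rnorm_ge0// (le_trans (ler_norm C))// lerDl.
by apply: (le_lt_trans h); rewrite mulrC -ltr_pdivlMr.
Qed.

(** Completeness transfers approximability along a contraction: if b is a limit
    of values of j, the corresponding values of i converge. *)
Lemma complete_transfer (P : Type) (D : set P) (A : completeNormedModType (Cx R))
    (B : normedModType (Cx R)) (i : P -> A) (j : P -> B) (b : B) :
  (forall f g, D f -> D g -> rnorm (i f - i g) <= rnorm (j f - j g)) ->
  (forall e : R, 0 < e -> exists2 f, D f & rnorm (b - j f) <= e) ->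
  exists a, forall e : R, 0 < e ->
    exists f, [/\ D f, rnorm (a - i f) <= e & rnorm (b - j f) <= e].
Proof.
move=> ij bj; have en (n : nat) : 0 < (n.+1%:R^-1 : R) by rewrite invr_gt0.
pose f n := sval (cid2 (bj _ (en n))).
have Df n : D (f n) by rewrite /f; case: cid2.
have bf n : rnorm (b - j (f n)) <= n.+1%:R^-1 by rewrite /f; case: cid2.
have small (e : R) : 0 < e -> exists N, forall n, (N <= n)%N -> n.+1%:R^-1 <= e.
  move=> e0; have [N N0 Ne] := small_inv_nat e0; exists N => n Nn.
  apply: le_trans (ltW Ne); rewrite lef_pV2 ?posrE ?ltr0n// ler_nat.
  exact: leq_trans Nn (leqnSn _).
have iE n m (e : R) : n.+1%:R^-1 <= e -> m.+1%:R^-1 <= e -> rnorm (i (f n) - i (f m)) <= 2 * e.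
  move=> ne me; apply: (le_trans (ij _ _ (Df _) (Df _))).
  apply: (le_trans (rnorm_distD b _ _)); rewrite (rnorm_distC (j _)).
  rewrite mulr_natl mulr2n; apply: lerD; [exact: le_trans (bf n) ne|exact: le_trans (bf m) me].
have cu : cvg ((fun n => i (f n)) @ \oo).
  apply/cauchy_cvgP/cauchy_exP => e; rewrite ltcE/= => /andP[/eqP ie re].
  have e4 : 0 < complex.Re e / 4 by lra.
  have [N NP] := small _ e4; exists (i (f N)); exists N => // n /= Nn.
  rewrite -ball_normE/= normE ltcE/= ie eqxx/=.
  apply: (le_lt_trans (iE _ _ _ (NP N (leqnn _)) (NP n Nn))); lra.
exists (lim ((fun n => i (f n)) @ \oo)) => e e0.
have lE := iffLR (cvg_rnormP _ _) cu _ e0.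
have [N _ NP] := lE; have [M MP] := small _ e0.
exists (f (maxn N M)); split; first exact: Df.
- by apply: ltW; apply: NP; rewrite /= leq_maxl.
- by apply: (le_trans (bf _)); apply: MP; exact: leq_maxr.
Qed.

(** Approximate a by elements of the dense image, transfer the approximations to B
    and use its completeness. *)
Lemma isometric_extension (P : Type) (D : set P) (A : normedModType (Cx R))
    (B : completeNormedModType (Cx R)) (i : P -> A) (j : P -> B) :
  dense (i @` D) ->
  (forall f g, D f -> D g -> rnorm (j f - j g) = rnorm (i f - i g)) ->
  exists2 M : A -> B, forall f, D f -> M (i f) = j f &
    forall a b, rnorm (M a - M b) = rnorm (a - b).
Proof.
move=> di ij.
have ap a : exists b, forall e : R, 0 < e ->
    exists f, [/\ D f, rnorm (b - j f) <= e & rnorm (a - i f) <= e].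
  apply: complete_transfer => [f g Df Dg|e e0]; first by rewrite ij.
  have [_ [f Df <-] /ltW fe] := dense_rnorm a di e0; by exists f.
exists (fun a => sval (cid (ap a))).
  move=> f Df; case: cid => b /= bP; apply/eqP; rewrite -subr_eq0; apply/eqP.
  apply: rnorm_le_eps => e e0; have e2 : 0 < e / 2 by lra.
  have [g [Dg h1 h2]] := bP _ e2; apply: (le_trans (rnorm_distD (j g) _ _)).
  rewrite ij// (rnorm_distC (i g)); lra.
move=> a b; case: cid => a' /= aP; case: cid => b' /= bP.
apply/eqP; rewrite -subr_eq0 -normr_le0; apply/ler_addgt0Pr => e e0; rewrite add0r.
have e4 : 0 < e / 4 by lra.
have [f [Df f1 f2]] := aP _ e4; have [g [Dg g1 g2]] := bP _ e4.
have h1 := rnorm_dist_dist (a' - b') (j f - j g).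
have h2 := rnorm_dist_dist (a - b) (i f - i g).
have E (V : normedModType (Cx R)) (x y z t : V) : x - y - (z - t) = (x - z) - (y - t).
  by rewrite !opprD !opprK addrACA.
rewrite E ij// in h1; rewrite E in h2.
have k1 := rnormB (a' - j f) (b' - j g); have k2 := rnormB (a - i f) (b - i g).
move: h1 h2; rewrite !ler_norml => /andP[? ?] /andP[? ?]; apply/andP; split; lra.
Qed.

End DenseExtension.

Section CStarFacts.
Variables (R : realType) (A : cstar_algebra R).
Implicit Types (a b : A) (c : Cx R).

Lemma ca_mulBl a a' b : ca_mul (a - a') b = ca_mul a b - ca_mul a' b.
Proof.
by have := ca_mul_linear_l (-1) a' a b; rewrite !scaleN1r addrC => ->; rewrite addrC.
Qed.

Lemma ca_mulBr a b b' : ca_mul a (b - b') = ca_mul a b - ca_mul a b'.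
Proof.
by have := ca_mul_linear_r (-1) a b' b; rewrite !scaleN1r addrC => ->; rewrite addrC.
Qed.

Lemma ca_starB a b : ca_star (a - b) = ca_star a - ca_star b.
Proof.
by have := ca_star_conj_linear (-1) b a; rewrite rmorphN1 !scaleN1r addrC => ->; rewrite addrC.
Qed.

Lemma rnorm_ca_mul a b : rnorm (ca_mul a b) <= rnorm a * rnorm b.
Proof.
have := ca_mul_norm a b; rewrite !normE -rmorphM/= lecR//.
Qed.

Lemma rnorm_ca_star_mul a : rnorm (ca_mul (ca_star a) a) = rnorm a ^+ 2.
Proof. by have := ca_star_norm a; rewrite !normE -rmorphXn/= => /complexI. Qed.

Lemma rnorm_ca_star a : rnorm (ca_star a) = rnorm a.
Proof.
have le b : rnorm b <= rnorm (ca_star b).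
  have [->|b0] := eqVneq (rnorm b) 0; first exact: rnorm_ge0.
  have b0' : 0 < rnorm b by rewrite lt0r b0 rnorm_ge0.
  by rewrite -(ler_pM2r b0') -expr2 -rnorm_ca_star_mul; exact: rnorm_ca_mul.
by apply/eqP; rewrite eq_le le andbT -{2}(ca_starK a) le.
Qed.

End CStarFacts.

Section StarHom.
Variable R : realType.
Implicit Types P Q : star_algebra R.

Lemma star_hom0 P Q (phi : P -> Q) : star_hom phi -> sa_dom P 0 -> phi 0 = 0.
Proof.
move=> [_ lin _ _] d0; have := lin 1 0 0 d0 d0; rewrite !scale1r addr0.
by move=> /(congr1 (fun v => v - phi 0)); rewrite subrr addrK.
Qed.

Lemma star_homB P Q (phi : P -> Q) f g : star_hom phi -> sa_dom P f -> sa_dom P g ->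
  phi ((-1) *: g + f) = phi f - phi g.
Proof. by move=> [_ lin _ _] df dg; rewrite lin// scaleN1r addrC. Qed.

(** The seminorms to which the maximality of a completion is applied arise by pulling
    back along a homomorphism that does not increase the I-norm. *)
Lemma bounded_seminorm_comp P Q (IP : P -> \bar R) (IQ : Q -> \bar R) (phi : P -> Q) (N : Q -> R) :
  star_hom phi -> sa_dom P 0 -> (forall f, sa_dom P f -> sa_dom P (sa_star f)) -> (forall f, sa_dom P f -> (IQ (phi f) <= IP f)%E) ->
  bounded_cstar_seminorm IQ N -> bounded_cstar_seminorm IP (fun f => N (phi f)).
Proof.
move=> hphi d0 ds Iphi [[N0 ND NZ NM NS] NI]; have phi0 := star_hom0 hphi d0.
have [dom lin mul star] := hphi; split; last first.
  by move=> f df; apply: le_trans (Iphi f df); apply: NI; exact: dom.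
split.
- by move=> f df; apply: N0; exact: dom.
- move=> f g df dg; have := lin 1 f g df dg; rewrite !scale1r => ->.
  by apply: ND; exact: dom.
- move=> c f df; have := lin c f 0 df d0; rewrite !addr0 phi0 addr0 => ->.
  by apply: NZ; exact: dom.
- by move=> f g df dg; rewrite mul//; apply: NM; exact: dom.
- by move=> f df; rewrite -NS ?mul ?star//; [exact: ds|exact: dom].
Qed.

End StarHom.

(** * Continuity of convolutions *)
Section CompactTietze.
Variables (R : realType) (X : topologicalType).
Hypothesis hausX : hausdorff_space X.
Hypothesis lcX : locally_compact [set: X].

Lemma compact_interior_nbhs (K : set X) : compact K ->
  exists K1 : set X, [/\ compact K1, closed K1 & K `<=` K1^°].
Proof.
move: K; apply: compact_local_ind.
- by exists set0; split => //; [exact: compact0|exact: closed0].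
- move=> A B [A1 [cA clA AA]] [B1 [cB clB BB]]; exists (A1 `|` B1); split.
  + exact: compactU.
  + exact: closedU.
  + move=> x [/AA|/BB]; apply: interiorS; [exact: subsetUl|exact: subsetUr].
- by move=> A B AB [B1 [cB clB BB]]; exists B1; split => //; exact: subset_trans BB.
- move=> x; have [U Ux [cU clU]] := @lcX x I.
  have {}Ux : nbhs x U by have := Ux; rewrite /within/=; apply: filterS => h; apply.
  exists U^°; first by apply: open_nbhs_nbhs; split; [exact: open_interior|].
  by exists U; split.
Qed.

(** Tietze extension with compact support, applied in the one-point
    compactification to the closed set formed by D, by the complement of a
    compact neighbourhood of the support, and by the point at infinity. *)
Lemma tietze_compact (D K : set X) (phi : X -> R) : closed D -> compact K ->
  {within D, continuous phi} -> (forall x, D x -> phi x != 0 -> K x) ->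
  exists Phi : X -> R, [/\ continuous Phi, (forall x, D x -> Phi x = phi x) &
    exists2 K1, compact K1 & forall x, Phi x != 0 -> K1 x].
Proof.
move=> cD cK cphi phiK.
have [K1 [cK1 clK1 KK1]] := compact_interior_nbhs cK.
have clK := compact_closed hausX cK.
pose opc := one_point_compactification X.
have nopc : normal_space opc.
  apply: compact_normal; first exact: one_point_compactification_hausdorff.
  exact: one_point_compactification_compact.
pose A : set opc := ~` (Some @` (K1^° `&` ~` D)).
have cA : closed A.
  apply: open_closedC; apply: one_point_compactification_open_some.
  by apply: openI; [exact: open_interior|exact: closed_openC].
pose f (u : opc) : R := if u is Some x then (if pselect (D x) then phi x else 0) else 0.
have fD x : D x -> f (Some x) = phi x by rewrite /f; case: pselect.
have fnK x : ~ K x -> f (Some x) = 0.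
  move=> nKx; rewrite /f; case: pselect => // Dx; apply/eqP.
  by apply: contra_notT nKx; exact: phiK.
have AD x : A (Some x) -> K1^° x -> D x.
  by move=> Ax K1x; apply: contrapT => nDx; apply: Ax; exists x.
have [M M0 fM] : exists2 M : R, 0 < M & forall u, A u -> `|f u| <= M.
  have cDK : compact (D `&` K).
    by apply: (subclosed_compact _ cK); [exact: closedI|exact: subIsetr].
  have cf' : {within D `&` K, continuous phi} by apply: continuous_subspaceW cphi; exact: subIsetl.
  have /compact_bounded [M [_ /(_ (Num.max M 0 + 1))]] := continuous_compact cf' cDK.
  have -> : M < Num.max M 0 + 1 by rewrite ltr_pwDr// le_max lexx.
  have M0 : 0 <= Num.max M 0 by rewrite le_max lexx orbT.
  move=> /(_ isT) Mb; exists (Num.max M 0 + 1); first by lra.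
  move=> [x|] _; last by rewrite normr0; lra.
  rewrite /f; case: pselect => Dx; last by rewrite normr0; lra.
  have [->|p0] := eqVneq (phi x) 0; first by rewrite normr0; lra.
  by apply: Mb; exists x => //; split => //; exact: phiK.
have cf : {within A, continuous f}.
  apply/subspace_continuousP => -[x|] Au.
    have [Kx|nKx] := pselect (K x).
      have Dx := AD _ Au (KK1 _ Kx); rewrite [from_subspace _ _ (Some x)](fD x Dx).
      have /subspace_continuousP/(_ x Dx) cx := cphi.
      move=> B /cx HB; have : nbhs x [set y | D y -> B (phi y)] by exact: HB.
      have : nbhs x (K1^°) by apply: open_nbhs_nbhs; split; [exact: open_interior|exact: KK1].
      move=> n1 n2; have n3 : nbhs x (K1^° `&` [set y | D y -> B (phi y)]) by exact: filterI.
      change (@nbhs _ opc (Some x) [set u | A u -> B (f u)]).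
      apply: (@filterS _ _ (@nbhs_filter opc (Some x)) _ _ _ (one_point_compactification_some_nbhs _ _ n3)) => _ [y [K1y Dy] <-] Ay.
      by have Dy' := AD _ Ay K1y; change (B (f (Some y))); rewrite fD//; exact: Dy.
    rewrite [from_subspace _ _ (Some x)](fnK _ nKx) => B /nbhs_singleton B0.
    have n1 : nbhs x (~` K) by apply: open_nbhs_nbhs; split => //; exact: closed_openC.
    change (@nbhs _ opc (Some x) [set u | A u -> B (f u)]).
    apply: (@filterS _ _ (@nbhs_filter opc (Some x)) _ _ _ (one_point_compactification_some_nbhs _ _ n1)) => _ [y nKy <-] _.
    by change (B (f (Some y))); rewrite fnK.
  move=> B /nbhs_singleton B0; change (@nbhs _ opc None [set u | A u -> B (f u)]).
  exists K1; first by split.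
  move=> _ [[y nK1y <-]|->] _; last exact: B0.
  change (B (f (Some y))); rewrite fnK// => /KK1 /interior_subset; exact: nK1y.
have [g [gf cg _]] := continuous_bounded_extension nopc cA M0 cf fM.
exists (fun x => g (Some x)); split.
- move=> x; exact: (cvg_comp _ _ (@one_point_compactification_some_continuous X x) (cg (Some x))).
- move=> x Dx; rewrite -gf ?fD// inE => -[y [_ nDy] [yx]]; apply: nDy; by rewrite yx.
- exists K1 => // x; apply: contraNP => nK1x.
  rewrite -gf ?fnK//.
  + by move=> /KK1/interior_subset.
  + by rewrite inE => -[y [K1y _] [yx]]; apply: nK1x; rewrite -yx; exact: interior_subset.
Qed.

End CompactTietze.

Section ConvolutionSupport.
Variables (R : realType) (G : lc_groupoid) (alpha : haar_system R G) (L : fell_line_bundle R G).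
Local Notation S := (Sigma L).
Local Notation conv := (@sig_conv R G alpha L).
Implicit Types (y w : S) (g h x : G) (F H : S -> Cx R).

Let hausG : hausdorff_space G := @groupoid_hausdorff G.

(** Away from the pairs with equal ranges nothing has to be estimated, provided that
    this is an open condition. *)
Lemma near_neq (X : topologicalType) (f g : X -> G) (x : X) :
  {for x, continuous f} -> {for x, continuous g} -> f x <> g x ->
  \forall u \near x, f u <> g u.
Proof.
move=> cf cg /eqP fg; move: hausG; rewrite open_hausdorff => /(_ _ _ fg).
move=> [[A B]] /= [/set_mem fA /set_mem gB] [oA oB /eqP AB].
have nA : \forall u \near x, A (f u) by apply: cf; exact: open_nbhs_nbhs.
have nB : \forall u \near x, B (g u) by apply: cg; exact: open_nbhs_nbhs.
near=> u => fgu; have Au : A (f u) by near: u.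
have Bu : B (g u) by near: u.
have : (A `&` B) (f u) by split => //; rewrite fgu.
by rewrite AB.
Unshelve. all: by end_near.
Qed.

Lemma closed_composable : closed [set p : G * G | src p.1 = rng p.2].
Proof.
rewrite -[X in closed X]setCK; apply: open_closedC; rewrite openE => p np.
apply: (near_neq (f := fun p : G * G => src p.1) (g := fun p : G * G => rng p.2)) => //.
  by apply: continuous_comp; [exact: cvg_fst|exact: src_continuous].
by apply: continuous_comp; [exact: cvg_snd|exact: rng_continuous].
Qed.

(** Composability is a closed condition, by the Hausdorff property. *)
Lemma compact_gcomp (K K' : set G) : compact K -> compact K' ->
  compact [set gcomp p.1 p.2 | p in [set p : G * G | src p.1 = rng p.2] `&` (K `*` K')].
Proof.
move=> cK cK'; apply: (@continuous_compact _ _ (fun p : G * G => gcomp p.1 p.2)).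
  by apply: continuous_subspaceW (@comp_continuous G); exact: subIsetl.
apply: (subclosed_compact _ (compact_setX cK cK')); last exact: subIsetr.
apply: closedI; first exact: closed_composable.
have -> : K `*` K' = fst @^-1` K `&` snd @^-1` K' by apply/seteqP; split.
apply: closedI; apply: closed_comp => [p _|].
- exact: cvg_fst.
- exact: (compact_closed hausG).
- exact: cvg_snd.
- exact: (compact_closed hausG).
Qed.

Section Integrand.
Variables F H : S -> Cx R.
Hypotheses (CF : Cc F) (CH : Cc H) (eF : equivariant F) (eH : equivariant H).

(** With the fibre integral taken, the integrand lives on the groupoid, where the
    Haar system and its continuity axiom apply. *)
Definition conv_integrand y h := sig_fibre_int (fun w => F w * H (sig_mul (sig_inv w) y)) h.

Lemma conv_integrandE y w : rng (sig_base w) = rng (sig_base y) ->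
  conv_integrand y (sig_base w) = F w * H (sig_mul (sig_inv w) y).
Proof.
move=> wy; apply: sig_fibre_int_inv_cst => w' /sig_act_span[z z1 ->].
have zV := circleV z1.
rewrite sig_inv_act// (sig_mul_actl zV); last by rewrite sig_base_inv src_inv.
rewrite (iffLR (equivariantP F) eF)// (iffLR (equivariantP H) eH)//.
by rewrite invrK mulrACA mulVf ?mul1r// circle_neq0.
Qed.

(** By equivariance the point over h can be chosen along a section continuous at h,
    which makes the integrand a product of continuous functions. *)
Lemma conv_integrand_continuous y h : rng h = rng (sig_base y) ->
  (fun p : G * S => conv_integrand p.2 p.1) @
    within [set p : G * S | rng p.1 = rng (sig_base p.2)] (nbhs (h, y)) --> conv_integrand y h.
Proof.
move=> hy; have [s sb sc] := section_at L h.
set E := [set p : G * S | _].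
have WF : Filter (within E (nbhs (h, y))) by exact: within_filter.
have nE : \forall p \near within E (nbhs (h, y)), E p by exact: withinT.
have c1 : (fun p : G * S => s p.1) @ within E (nbhs (h, y)) --> s h.
  apply: (cvg_trans (cvg_app _ (cvg_within _))).
  exact: (@cvg_comp _ _ _ fst s _ (nbhs h) _ cvg_fst sc).
have c2 : (fun p : G * S => p.2) @ within E (nbhs (h, y)) --> y.
  exact: (cvg_trans (cvg_app _ (cvg_within _)) cvg_snd).
have [cF _] := CF; have [cH _] := CH.
have shy : rng (sig_base (s h)) = rng (sig_base y) by rewrite sb.
have -> : conv_integrand y h = F (s h) * H (sig_mul (sig_inv (s h)) y).
  by rewrite -{1}(sb h) conv_integrandE.
have C : (fun p : G * S => F (s p.1) * H (sig_mul (sig_inv (s p.1)) p.2)) @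
    within E (nbhs (h, y)) --> F (s h) * H (sig_mul (sig_inv (s h)) y).
  apply: cvgM; first exact: (cvg_comp _ F c1 (cF _)).
  apply: (cvg_comp (fun p : G * S => sig_mul (sig_inv (s p.1)) p.2) H _ (cH _)).
  apply: cvg_sig_mul => //.
  - by apply: filterS nE => p; rewrite /E/= sig_base_inv src_inv sb.
  - by rewrite sig_base_inv src_inv.
  - exact: cvg_sig_inv.
apply: cvg_near_eq C; apply: filterS nE => p Ep.
by rewrite -[in RHS](sb p.1) conv_integrandE ?sb.
Qed.

Lemma conv_integrand_cpt_cont y : cpt_cont (rfiber (rng (sig_base y))) (conv_integrand y).
Proof. exact: sig_fibre_int_cpt_cont (admissible_conv y CF CH). Qed.

Lemma conv_integrand_supp y h : rng h = rng (sig_base y) -> conv_integrand y h != 0 ->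
  gsupp F h.
Proof.
move=> hy; rewrite -(sig_base_pt L h) conv_integrandE ?sig_base_pt//.
rewrite mulf_eq0 negb_or => /andP[Fw _].
by rewrite -(sig_base_pt L h); exact: gsuppP.
Qed.

Lemma conv_supp y : conv F H y != 0 ->
  [set gcomp p.1 p.2 | p in [set p : G * G | src p.1 = rng p.2] `&` (gsupp F `*` gsupp H)] (sig_base y).
Proof.
apply: contraNP => ny; apply/eqP; set x := rng (sig_base y).
rewrite -(cint0 (alpha x) (closed_rfiber (x := x))); apply: eq_cint => h hx.
apply/eqP; apply: contra_notT ny => n0.
have hy : rng h = rng (sig_base y) by [].
have Fh := conv_integrand_supp hy n0.
have wh := sig_base_pt L h; set w := sig_pt L h in wh.
have : conv_integrand y h != 0 by [].
rewrite -{1}wh conv_integrandE ?wh// mulf_eq0 negb_or => /andP[_ /gsuppP].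
have cwy : src (sig_base (sig_inv w)) = rng (sig_base y) by rewrite sig_base_inv src_inv wh.
rewrite sig_base_mul// sig_base_inv wh => Hh.
exists (h, gcomp (ginv h) (sig_base y)) => /=; last first.
  by rewrite Defs.compA ?rng_inv ?src_inv// comp_inv_r hy comp_rng.
by split => //=; rewrite rng_gcomp ?rng_inv// src_inv.
Qed.

(** Near a point the integrand is uniformly close to a fixed compactly supported
    function on the groupoid, whose integrals vary continuously by the axiom of
    Haar systems. *)
Lemma conv_continuous : continuous (conv F H).
Proof.
move=> y0; set x0 := rng (sig_base y0); have ux y : units (rng (sig_base y)) by exact: units_rng.
have [cq [K0 cK0 qK0]] := conv_integrand_cpt_cont y0.
have crf := closed_rfiber (x := x0).
have cRe : {within rfiber x0, continuous (fun h => complex.Re (conv_integrand y0 h))}.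
  by move=> h; exact: (cvg_comp _ (fun z : Cx R => complex.Re z) (cq h) (@continuous_Re R _)).
have cIm : {within rfiber x0, continuous (fun h => complex.Im (conv_integrand y0 h))}.
  by move=> h; exact: (cvg_comp _ (fun z : Cx R => complex.Im z) (cq h) (@continuous_Im R _)).
have lcG := @groupoid_locally_compact G.
have [|Pr [cPr PrE [K1 cK1 PrK]]] := tietze_compact hausG lcG crf cK0 cRe.
  by move=> h hx q0; apply: qK0 => //; apply: contra_neq q0 => ->.
have [|Pi [cPi PiE [K2 cK2 PiK]]] := tietze_compact hausG lcG crf cK0 cIm.
  by move=> h hx q0; apply: qK0 => //; apply: contra_neq q0 => ->.
pose P h : Cx R := (Pr h +i* Pi h)%C.
have cP : continuous P by move=> h; apply: cvg_complex; [exact: cPr|exact: cPi].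
have PE h : rng h = x0 -> P h = conv_integrand y0 h.
  by move=> hx; apply: Cx_ext; rewrite /= ?PrE ?PiE.
have PK h : P h != 0 -> (K1 `|` K2) h.
  move=> P0; have [r0|r0] := eqVneq (Pr h) 0; last by left; exact: PrK.
  right; apply: PiK; apply: contra_neq P0 => i0; by rewrite /P r0 i0.
have cK12 : compact (K1 `|` K2) by exact: compactU.
have CP : Cc P by apply: (Cc_of_support cP cK12) PK; exact: compact_closed.
pose K := gsupp F `|` (K1 `|` K2).
have cK : compact K by apply: compactU => //; exact: gsupp_compact.
have [C C0 KC] := haar_compact_bound alpha cK.
apply/(@cvg_rnormP R (Cx R) _ (nbhs y0) (nbhs_filter y0)) => e e0.
have e2 : 0 < e / 2 by lra.
have eC : 0 < e / 2 / (2 * (C + 1)) by rewrite divr_gt0//; lra.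
have close : \forall y \near y0, K `<=` (fun h => rng h = rng (sig_base y) ->
    rnorm (conv_integrand y h - P h) <= e / 2 / (2 * (C + 1))).
  apply: (iffLR (compact_near_coveringP K) cK S (nbhs y0)
    (fun y h => rng h = rng (sig_base y) ->
      rnorm (conv_integrand y h - P h) <= e / 2 / (2 * (C + 1))) _) => h0 _.
  have c1 : {for (h0, y0), continuous (fun p : G * S => rng p.1)}.
    by apply: continuous_comp; [exact: cvg_fst|exact: rng_continuous].
  have c2 : {for (h0, y0), continuous (fun p : G * S => rng (sig_base p.2))}.
    apply: (@cvg_comp _ _ _ (fun p : G * S => sig_base p.2) (@rng G)); last exact: rng_continuous.
    exact: (@cvg_comp _ _ _ snd (@sig_base R G L) _ (nbhs y0) _ cvg_snd (@continuous_sig_base _ _ L y0)).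
  have [hy|hy] := pselect (rng h0 = x0); last first.
    have nn : \forall p \near (h0, y0), rng p.1 <> rng (sig_base p.2) by exact: near_neq.
    by near=> p => pe; exfalso; move: pe; near: p.
  have qc := conv_integrand_continuous hy.
  set E := [set p : G * S | _] in qc.
  have WF : Filter (within E (nbhs (h0, y0))) by exact: within_filter.
  have eC2 : 0 < e / 2 / (2 * (C + 1)) / 2 by rewrite divr_gt0.
  have n1 := iffLR (cvg_rnormP _ _) qc _ eC2.
  have cP1 : (fun p : G * S => P p.1) @ nbhs (h0, y0) --> P h0.
    exact: (@cvg_comp _ _ _ fst P _ (nbhs h0) _ cvg_fst (cP h0)).
  have n2 := iffLR (cvg_rnormP _ _) cP1 _ eC2.
  have n1' : \forall p \near (h0, y0), E p ->
    rnorm (conv_integrand y0 h0 - conv_integrand p.2 p.1) < e / 2 / (2 * (C + 1)) / 2 by exact: n1.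
  near=> p => pe.
  have h1 : rnorm (conv_integrand p.2 p.1 - conv_integrand y0 h0) < e / 2 / (2 * (C + 1)) / 2.
    by rewrite rnorm_distC; move: pe; near: p; exact: n1'.
  have h2 : rnorm (P h0 - P p.1) < e / 2 / (2 * (C + 1)) / 2.
    by near: p; exact: n2.
  rewrite PE// in h2.
  rewrite [leRHS]splitr.
  exact: (ltW (le_lt_trans (rnorm_distD (conv_integrand y0 h0) _ _) (ltrD h1 h2))).
have hc := @haar_continuous R G alpha P CP.
have hcy : (fun y : S => cint (alpha (rng (sig_base y))) (rfiber (rng (sig_base y))) P) @ y0 -->
    cint (alpha x0) (rfiber x0) P.
  apply: (cvg_within_comp (A := @units G) (f := fun x => cint (alpha x) (rfiber x) P)
    (h := fun y : S => rng (sig_base y)) hc (ux y0)).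
  - exact: (nbhs_filter y0).
  - exact: (cvg_comp _ _ (@continuous_sig_base _ _ L y0) (@rng_continuous G _)).
  - by apply: filterS filterT => y _; exact: ux.
have n3 := iffLR (cvg_rnormP _ _) hcy _ e2.
have E0 : conv F H y0 = cint (alpha x0) (rfiber x0) P.
  by apply: eq_cint => h hx; rewrite PE.
near=> y; rewrite E0.
have h3 : rnorm (cint (alpha x0) (rfiber x0) P -
    cint (alpha (rng (sig_base y))) (rfiber (rng (sig_base y))) P) < e / 2.
  by near: y; exact: n3.
have cl : K `<=` (fun h => rng h = rng (sig_base y) ->
    rnorm (conv_integrand y h - P h) <= e / 2 / (2 * (C + 1))).
  by near: y; exact: close.
set x := rng (sig_base y) in h3 cl.
have crx := closed_rfiber (x := x).
have ra := haar_radon alpha (ux y).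
have iq := cpt_cont_integrable hausG ra crx (conv_integrand_cpt_cont y).
have ccP : cpt_cont (rfiber x) P.
  split; first exact: (continuous_subspaceT cP).
  by exists (K1 `|` K2) => // h _; exact: PK.
have iP := cpt_cont_integrable hausG ra crx ccP.
have DE : conv F H y - cint (alpha x) (rfiber x) P =
    cint (alpha x) (rfiber x) (fun h => (-1) * P h + conv_integrand y h).
  rewrite (cint_lin crx (-1) iP iq) mulN1r [RHS]addrC; congr (_ + _).
have DK h : rfiber x h -> (-1) * P h + conv_integrand y h != 0 -> K h.
  move=> hx; have [p0|p0 _] := eqVneq (P h) 0; last by right; exact: PK.
  by rewrite p0 mulr0 add0r => q0; left; exact: conv_integrand_supp q0.
have cd : cpt_cont (rfiber x) (fun h => (-1) * P h + conv_integrand y h).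
  split; last by exists K.
  have [ccq _] := conv_integrand_cpt_cont y; move=> h; apply: cvgD; last exact: ccq.
  by apply: cvgM; [exact: cvg_cst|exact: (continuous_subspaceT cP)].
have bd h : rfiber x h -> rnorm ((-1) * P h + conv_integrand y h) <= e / 2 / (2 * (C + 1)).
  move=> hx; have [->|n0] := eqVneq ((-1) * P h + conv_integrand y h) 0.
    by rewrite rnorm0 ltW.
  rewrite mulN1r addrC; exact: (cl h (DK h hx n0) hx).
have [muK _ _] := ra.
have := rnorm_cint_le hausG crx (cpt_cont_integrable hausG ra crx cd) cK (muK _ cK) (ltW eC) bd DK.
rewrite -DE => h4.
have h5 : 2 * (e / 2 / (2 * (C + 1)) * fine (alpha x (K `&` rfiber x))) <=
    2 * (e / 2 / (2 * (C + 1)) * C).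
  rewrite ler_wpM2l//; apply: ler_wpM2l; [exact: ltW|exact: (KC x (ux y))].
have h6 : 2 * (e / 2 / (2 * (C + 1)) * C) <= e / 2.
  have -> : 2 * (e / 2 / (2 * (C + 1)) * C) = e / 2 * (C / (C + 1)) by field; lra.
  by rewrite ler_piMr ?(ltW e2)// ler_pdivrMr; lra.
have h7 := le_trans h4 (le_trans h5 h6); rewrite rnorm_distC in h7.
rewrite [ltRHS]splitr.
exact: (le_lt_trans (rnorm_distD (cint (alpha x) (rfiber x) P) _ _) (ltr_leD h3 h7)).
Unshelve. all: by end_near.
Qed.

Lemma Cc_conv : Cc (conv F H).
Proof.
apply: (Cc_Sigma_support conv_continuous (compact_gcomp (gsupp_compact CF) (gsupp_compact CH))).
exact: conv_supp.
Qed.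

End Integrand.

End ConvolutionSupport.

(** * The isomorphism *)
Section StarAlgebras.
Variables (R : realType) (G : lc_groupoid) (alpha : haar_system R G) (L : fell_line_bundle R G).
Local Notation S := (Sigma L).
Local Notation PL := (CcGL alpha L).
Local Notation PS := (CcSigma alpha L).
Implicit Types (f g : Sect L) (F H : S -> Cx R) (z c : Cx R).

Lemma Cc_sect_lin c f g : Cc_sect f -> Cc_sect g -> Cc_sect (c *: f + g).
Proof.
move=> Cf Cg; rewrite -(untildeK (c *: f + g)); apply: Cc_untilde => [|z z1].
  by rewrite tilde_lin; apply: Cc_lin; exact: Cc_tilde.
exact: tilde_equiv.
Qed.

Lemma Cc_sect0 : Cc_sect (0 : Sect L).
Proof.
rewrite -(untildeK 0); apply: Cc_untilde => [|z z1]; last exact: tilde_equiv.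
have -> : tilde (0 : Sect L) = fun=> 0; last exact: Cc0.
by apply/funext => y; apply: rnorm_eq0; rewrite rnorm_tilde rnorm0.
Qed.

Lemma Cc_sect_star f : Cc_sect f -> Cc_sect (sect_star f).
Proof.
move=> Cf; rewrite -(untildeK (sect_star f)); apply: Cc_untilde => [|z z1].
  by rewrite tilde_star; exact/Cc_sig_star/Cc_tilde.
exact: tilde_equiv.
Qed.

Lemma Cc_sect_conv f g : Cc_sect f -> Cc_sect g -> Cc_sect (sect_conv alpha f g).
Proof.
move=> Cf Cg; rewrite -(untildeK (sect_conv alpha f g)); apply: Cc_untilde => [|z z1].
  have ef : equivariant (tilde f) by move=> z; exact: tilde_equiv.
  have eg : equivariant (tilde g) by move=> z; exact: tilde_equiv.
  by rewrite (tilde_conv alpha Cf Cg); exact: (Cc_conv alpha (Cc_tilde Cf) (Cc_tilde Cg) ef eg).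
exact: tilde_equiv.
Qed.

Lemma tilde_hom : star_hom (P := PL) (Q := PS) (@tilde R G L).
Proof.
split.
- by move=> f; exact: Cc_tilde.
- by move=> c f g _ _; exact: tilde_lin.
- by move=> f g; exact: tilde_conv.
- by move=> f _; exact: tilde_star.
Qed.

Lemma untilde_lin c F H : equivariant F -> equivariant H ->
  untilde (c *: F + H) = c *: untilde F + untilde H :> Sect L.
Proof.
move=> eF eH; apply: (@tilde_inj R G L); rewrite tilde_lin !tilde_untilde// => z z1.
apply/funext => y; have := congr1 (fun K => K y) (eF z z1); have := congr1 (fun K => K y) (eH z z1).
rewrite /mu_shift /= => hH hF.
have -> : (c *: F + H) (sig_act z^-1 y) = c * F (sig_act z^-1 y) + H (sig_act z^-1 y) by [].
by rewrite hF hH [LHS]addrC [RHS]scalerDr addrC; congr (_ + _); rewrite /= mulrCA.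
Qed.

Lemma untilde_deg1_hom : star_hom (P := PS) (Q := PL) (fun F => untilde (deg1 F)).
Proof.
split.
- by move=> F CF; apply: Cc_untilde; [exact: Cc_deg1|exact: deg1_equivariant].
- move=> c F H CF CH; rewrite /= deg1_lin//.
  by rewrite untilde_lin//; exact: deg1_equivariant.
- move=> F H CF CH; have eF := deg1_equivariant CF; have eH := deg1_equivariant CH.
  rewrite [LHS](_ : _ = untilde (deg1 (sig_conv alpha F H)))// (deg1_conv alpha CF CH).
  rewrite -{1}(tilde_untilde eF) -{1}(tilde_untilde eH) -tilde_conv ?untildeK//.
    by apply: Cc_untilde => //; exact: Cc_deg1.
  by apply: Cc_untilde => //; exact: Cc_deg1.
- move=> F CF; have eF := deg1_equivariant CF.
  rewrite [LHS](_ : _ = untilde (deg1 (sig_star F)))// (deg1_star CF).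
  by rewrite -{1}(tilde_untilde eF) -tilde_star untildeK.
Qed.

Lemma tilde_iso : star_iso (P := PL) (Q := CcSigma1 alpha L) (@tilde R G L).
Proof.
have [_ lin mul star] := tilde_hom; split; first split => //.
  by move=> f Cf; split; [exact: Cc_tilde|exact: tilde_equiv].
split.
- by move=> f Cf; split; [exact: Cc_tilde|exact: tilde_equiv].
- by move=> f g _ _; exact: tilde_inj.
- move=> F [CF eF]; exists (untilde F); first exact: Cc_untilde.
  exact: tilde_untilde.
Qed.

Lemma sig_fibre_int_act F z (x : G) : circle z ->
  sig_fibre_int (fun y => F (sig_act z y)) x = sig_fibre_int F x.
Proof.
move=> z1; congr xget; apply/seteqP; split => c [y yg ->].
  exists (sig_act z y); first by rewrite sig_base_act.
  by apply: eq_circle_int => u u1; rewrite !sig_actA// mulrC.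
have zV := circleV z1; exists (sig_act z^-1 y); first by rewrite sig_base_act.
apply: eq_circle_int => u u1; rewrite !sig_actA//; last exact: circleM.
by rewrite mulrAC divff ?mul1r// circle_neq0.
Qed.

(** Rotation is given by a central unitary multiplier: in (mu_z F)^* mu_z F the two
    phases cancel.  By the C*-identity every C*-norm is then invariant under
    rotations. *)
Lemma sig_conv_mu_shift F z : circle z ->
  sig_conv alpha (sig_star (mu_shift z F)) (mu_shift z F) = sig_conv alpha (sig_star F) F.
Proof.
move=> z1; have zV := circleV z1; apply/funext => y; rewrite /sig_conv /sig_haar.
apply: eq_cint => h hy.
rewrite -[RHS](sig_fibre_int_act _ _ z1); apply: sig_fibre_int_eq => w wh.
have cwy : src (sig_base (sig_inv w)) = rng (sig_base y).
  by rewrite sig_base_inv src_inv wh.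
by rewrite /sig_star /mu_shift sig_inv_act// (sig_mul_actl zV cwy).
Qed.

End StarAlgebras.

Section Completions.
Variables (R : realType) (G : lc_groupoid) (alpha : haar_system R G) (L : fell_line_bundle R G).
Local Notation S := (Sigma L).
Local Notation PL := (CcGL alpha L).
Local Notation PS := (CcSigma alpha L).
Implicit Types (f g : Sect L) (F H : S -> Cx R) (z c : Cx R).
Variable B : cstar_completion (P := PS) (@sig_Inorm R G alpha L).

Local Notation mu_B := (@Defs.mu_ext R G alpha L B).

Let eB : PS -> B := embed B.
Let hB : star_hom (P := PS) (Q := cstar_sub [set: B]) eB := @embed_hom _ _ _ B.

Lemma rnorm_embed_mu_shift z F : circle z -> Cc F -> rnorm (eB (mu_shift z F)) = rnorm (eB F).
Proof.
move=> z1 CF; have [_ _ mul _] := hB; have [[_ _ _ _ NS] _] := @embed_seminorm _ _ _ B.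
have := NS F CF; have := NS _ (Cc_mu_shift z1 CF).
rewrite /= (sig_conv_mu_shift alpha F z1) => -> /eqP.
by rewrite eqrXn2 ?rnorm_ge0// => /eqP.
Qed.

(** The extension is defined by choice.  Rotations are isometric on a dense set, so
    an extension exists, and density makes it unique, hence isometric. *)
Lemma mu_extP z : circle z ->
  [/\ forall a b : B, rnorm (mu_B z a - mu_B z b) = rnorm (a - b) &
      forall F, Cc F -> mu_B z (eB F) = eB (mu_shift z F)].
Proof.
move=> z1; have [_ lin _ _] := hB.
have iso F H : Cc F -> Cc H ->
    rnorm (eB (mu_shift z F) - eB (mu_shift z H)) = rnorm (eB F - eB H).
  move=> CF CH; rewrite -(star_homB hB (Cc_mu_shift z1 CF) (Cc_mu_shift z1 CH)).
  rewrite -(star_homB hB CF CH) -(rnorm_embed_mu_shift z1 (Cc_lin (-1) CH CF)).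
  by [].
have [M ME MI] := isometric_extension (@embed_dense _ _ _ B) iso.
have cM : continuous M.
  by apply: (@lipschitz_cont _ _ _ _ 1) => a b; rewrite MI mul1r.
pose Q := [set m : B -> B | continuous m /\
    forall F, sa_dom PS F -> m (embed B F) = embed B (mu_shift z F)].
have [cm mE] : Q (mu_B z) by apply: (@xgetPex _ _ Q); exists M.
have -> : mu_B z = M.
  apply: (continuous_dense_eq (@embed_dense _ _ _ B) cm cM) => _ [F CF <-].
  by rewrite mE// ME.
by [].
Qed.

(** By assumption b is the mean of z mu_z^-1(b) over the n-th roots of unity.  If F
    approximates b, the same mean of F is deg1_mean n F; it approximates b as well,
    and for large n it is close to deg1 F, a transform. *)
Lemma CstarSigma1_approx (b : B) : (forall z, circle z -> mu_B z b = z *: b) ->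
  forall e : R, 0 < e -> exists2 f, Cc_sect f & rnorm (b - eB (tilde f)) <= e.
Proof.
move=> bz e e0; have e2 : 0 < e / 2 by lra.
have [_ [F CF <-] bF] := dense_rnorm b (@embed_dense _ _ _ B) e2.
have [n n0 Dn] := sig_Inorm_approx alpha CF e2.
have C1 := Cc_deg1 CF; have eq1 := deg1_equivariant CF; have Cn := Cc_deg1_mean n CF.
exists (untilde (deg1 F)); first exact: Cc_untilde.
rewrite tilde_untilde//.
have [_ lin _ _] := hB.
have h1 : rnorm (eB (deg1 F) - eB (deg1_mean n F)) <= e / 2.
  rewrite -(star_homB hB)//.
  have DE : (-1) *: deg1_mean n F + deg1 F = (deg1 F - deg1_mean n F)%R by rewrite scaleN1r addrC.
  have [_ NI] := @embed_seminorm _ _ _ B.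
  have := NI _ (Cc_lin (-1) Cn C1); rewrite -lee_fin => /le_trans; apply.
  by rewrite DE.
have nn0 : (n%:R : Cx R) != 0 by rewrite pnatr_eq0 -lt0n.
pose zz (j : nat) : Cx R := turn (j%:R / n%:R).
have zz1 j : circle (zz j) by exact: circle_turn.
have sumE m : eB (fun w => \sum_(j < m) (n%:R^-1 * zz j) * F (sig_act (zz j) w)) =
    \sum_(j < m) (n%:R^-1 * zz j) *: mu_B (zz j)^-1 (eB F).
  elim: m => [|m IH].
    rewrite big_ord0 -(star_hom0 hB); last exact: (Cc0 L).
    by congr eB; apply/funext => w; rewrite big_ord0.
  rewrite big_ord_recr/= addrC -IH.
  have [_ ->//] := mu_extP (circleV (zz1 m)).
  rewrite -lin.
  - congr eB; apply/funext => w; rewrite big_ord_recr/= addrC; congr (_ + _).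
    by rewrite /mu_shift invrK.
  - exact: Cc_mu_shift (circleV _) CF.
  - apply: (@Cc_sum _ _ _ m (fun j => n%:R^-1 * zz j) (fun j w => F (sig_act (zz j) w))).
    by move=> j; exact: Cc_act.
have bE : b = \sum_(j < n) (n%:R^-1 * zz j) *: mu_B (zz j)^-1 b.
  rewrite (eq_bigr (fun=> n%:R^-1 *: b)); last first.
    move=> j _; rewrite bz; last exact: circleV.
    by rewrite scalerA mulfK// circle_neq0.
  by rewrite sumr_const card_ord -scaler_nat scalerA divff// scale1r.
have h2 : rnorm (b - eB (deg1_mean n F)) <= e / 2.
  have -> : deg1_mean n F = fun w => \sum_(j < n) (n%:R^-1 * zz j) * F (sig_act (zz j) w).
    by apply/funext => w; rewrite deg1_mean_sum.
  rewrite sumE {1}bE -sumrB.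
  apply: (@le_trans _ _ (\sum_(j < n) n%:R^-1 * (e / 2))).
    elim/big_ind2 : _ => [|a x a' x' ax ax'|j _]; first by rewrite rnorm0.
      by apply: (le_trans (rnormD _ _)); exact: lerD.
    rewrite -scalerBr rnormZ rnormM (iffLR (circleP _) (zz1 j)) mulr1 rnormV rnorm_nat.
    have [-> _] := mu_extP (circleV (zz1 j)).
    by rewrite ler_wpM2l ?invr_ge0//; exact: ltW.
  rewrite sumr_const card_ord -[X in X <= _]mulr_natl mulrA divff ?mul1r//.
  by rewrite pnatr_eq0 -lt0n.
apply: (le_trans (rnorm_distD (eB (deg1_mean n F)) _ _)).
rewrite (rnorm_distC (eB (deg1_mean n F))); lra.
Qed.

Variable A : cstar_completion (P := PL) (@sect_Inorm R G alpha L).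
Let eA : PL -> A := embed A.
Let hA : star_hom (P := PL) (Q := cstar_sub [set: A]) eA := @embed_hom _ _ _ A.

(** Each norm is the largest bounded one.  So that of A dominates the pullback of the
    norm of B along the transform, and that of B dominates the pullback of the norm
    of A along deg1 followed by the inverse transform. *)
Lemma rnorm_embed_tilde f : Cc_sect f -> rnorm (eB (tilde f)) = rnorm (eA f).
Proof.
move=> Cf; apply/eqP; rewrite eq_le; apply/andP; split.
  apply: (@embed_largest _ _ _ A (fun f => rnorm (eB (tilde f)))) => //.
  apply: (@bounded_seminorm_comp R PL PS _ (@sig_Inorm R G alpha L) (@tilde R G L)
    (fun F => rnorm (eB F)) (@tilde_hom R G alpha L)).
  - exact: Cc_sect0.
  - exact: Cc_sect_star.
  - by move=> g Cg; exact: sig_Inorm_tilde.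
  - exact: embed_seminorm.
have := @embed_largest _ _ _ B (fun F => rnorm (eA (untilde (deg1 F)))) _ (tilde f) (Cc_tilde Cf).
rewrite deg1_id; last by move=> z z1; exact: tilde_equiv.
rewrite untildeK; apply.
apply: (@bounded_seminorm_comp R PS PL _ (@sect_Inorm R G alpha L) (fun F => untilde (deg1 F))
    (fun g => rnorm (eA g)) (@untilde_deg1_hom R G alpha L)).
- exact: (Cc0 L).
- exact: Cc_sig_star.
- by move=> F CF; exact: sect_Inorm_deg1.
- exact: embed_seminorm.
Qed.

(** The isometric extension of the transform.  Its algebraic properties are equations
    between continuous maps that agree on a dense set, one variable at a time.  It
    is onto because approximations of b by transforms are Cauchy in A as well. *)
Lemma completion_iso : exists Phi : A -> B,
  star_iso (P := cstar_sub [set: A]) (Q := CstarSigma1 B) Phi /\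
  forall f, sa_dom PL f -> Phi (embed A f) = embed B (tilde f).
Proof.
have ht := @tilde_hom R G alpha L.
have [_ linA mulA starA] := hA; have [_ linB mulB starB] := hB.
have iso f g : Cc_sect f -> Cc_sect g ->
    rnorm (eB (tilde f) - eB (tilde g)) = rnorm (eA f - eA g).
  move=> Cf Cg; rewrite -(star_homB hB) -?(star_homB hA)//; try exact: Cc_tilde.
  by rewrite -tilde_lin rnorm_embed_tilde//; exact: Cc_sect_lin.
have dA : dense (eA @` sa_dom PL) := @embed_dense _ _ _ A.
have [Phi PhiE PhiI] := isometric_extension dA iso.
have cPhi : continuous Phi.
  by apply: (@lipschitz_cont _ _ _ _ 1) => a b; rewrite PhiI mul1r.
have add_cont (V : normedModType (Cx R)) (a : V) : continuous (fun b => b + a).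
  by apply: (@lipschitz_cont _ _ _ _ 1) => b b'; rewrite mul1r opprD addrACA subrr addr0.
have scale_cont (V : normedModType (Cx R)) c : continuous (fun b : V => c *: b).
  by apply: (@lipschitz_cont _ _ _ _ (rnorm c)) => b b'; rewrite -scalerBr rnormZ.
have mull_cont (D : cstar_algebra R) (a : D) : continuous (ca_mul a).
  by apply: (@lipschitz_cont _ _ _ _ (rnorm a)) => b b'; rewrite -ca_mulBr; exact: rnorm_ca_mul.
have mulr_cont (D : cstar_algebra R) (a : D) : continuous (fun b => ca_mul b a).
  apply: (@lipschitz_cont _ _ _ _ (rnorm a)) => b b'; rewrite -ca_mulBl mulrC; exact: rnorm_ca_mul.
have star_cont (D : cstar_algebra R) : continuous (@ca_star _ D).
  by apply: (@lipschitz_cont _ _ _ _ 1) => b b'; rewrite -ca_starB rnorm_ca_star mul1r.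
have comp_cont (U V W : normedModType (Cx R)) (u : U -> V) (v : V -> W) :
    continuous u -> continuous v -> continuous (fun x => v (u x)).
  by move=> cu cv x; apply: continuous_comp; [exact: cu|exact: cv].
have PhiL c a b : Phi (c *: a + b) = c *: Phi a + Phi b.
  have H1 g : Cc_sect g -> (fun a => Phi (c *: a + eA g)) = (fun a => c *: Phi a + Phi (eA g)).
    move=> Cg; apply: (continuous_dense_eq dA).
    - exact: (comp_cont _ _ _ _ _ (comp_cont _ _ _ _ _ (scale_cont _ c) (add_cont _ _)) cPhi).
    - exact: (comp_cont _ _ _ _ _ (comp_cont _ _ _ _ _ cPhi (scale_cont _ c)) (add_cont _ _)).
    - move=> _ [f Cf <-]; rewrite -linA// PhiE; last exact: Cc_sect_lin.
      by rewrite tilde_lin linB ?PhiE//; exact: Cc_tilde.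
  have H2 : (fun b => Phi (c *: a + b)) = (fun b => c *: Phi a + Phi b).
    apply: (continuous_dense_eq dA).
    - under eq_fun do rewrite addrC; exact: (comp_cont _ _ _ _ _ (add_cont _ _) cPhi).
    - under eq_fun do rewrite addrC; exact: (comp_cont _ _ _ _ _ cPhi (add_cont _ _)).
    - by move=> _ [g Cg <-]; have := congr1 (fun u => u a) (H1 g Cg).
  exact: (congr1 (fun u => u b) H2).
have PhiM a b : Phi (ca_mul a b) = ca_mul (Phi a) (Phi b).
  have H1 g : Cc_sect g -> (fun a => Phi (ca_mul a (eA g))) = (fun a => ca_mul (Phi a) (Phi (eA g))).
    move=> Cg; apply: (continuous_dense_eq dA).
    - exact: (comp_cont _ _ _ _ _ (mulr_cont _ _) cPhi).
    - exact: (comp_cont _ _ _ _ _ cPhi (mulr_cont _ _)).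
    - move=> _ [f Cf <-].
      have -> : ca_mul (eA f) (eA g) = eA (sect_conv alpha f g) by rewrite [RHS]mulA.
      rewrite !PhiE//; last exact: Cc_sect_conv.
      by rewrite (tilde_conv alpha Cf Cg) [LHS]mulB//; exact: Cc_tilde.
  have H2 : (fun b => Phi (ca_mul a b)) = (fun b => ca_mul (Phi a) (Phi b)).
    apply: (continuous_dense_eq dA).
    - exact: (comp_cont _ _ _ _ _ (mull_cont _ _) cPhi).
    - exact: (comp_cont _ _ _ _ _ cPhi (mull_cont _ _)).
    - by move=> _ [g Cg <-]; have := congr1 (fun u => u a) (H1 g Cg).
  exact: (congr1 (fun u => u b) H2).
have PhiS a : Phi (ca_star a) = ca_star (Phi a).
  have H : (fun a => Phi (ca_star a)) = (fun a => ca_star (Phi a)).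
    apply: (continuous_dense_eq dA).
    - exact: (comp_cont _ _ _ _ _ (star_cont _) cPhi).
    - exact: (comp_cont _ _ _ _ _ cPhi (star_cont _)).
    - move=> _ [f Cf <-].
      have -> : ca_star (eA f) = eA (sect_star f) by rewrite [RHS]starA.
      rewrite !PhiE//; last exact: Cc_sect_star.
      by rewrite tilde_star [LHS]starB//; exact: Cc_tilde.
  exact: (congr1 (fun u => u a) H).
have PhiB a z : circle z -> mu_B z (Phi a) = z *: Phi a.
  move=> z1; have [mI mE] := mu_extP z1.
  have H : (fun a => mu_B z (Phi a)) = (fun a => z *: Phi a).
    apply: (continuous_dense_eq dA).
    - apply: (comp_cont _ _ _ _ _ cPhi); apply: (@lipschitz_cont _ _ _ _ 1) => b b'.
      by rewrite mI mul1r.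
    - exact: (comp_cont _ _ _ _ _ cPhi (scale_cont _ z)).
    - move=> _ [f Cf <-]; rewrite PhiE// mE; last exact: Cc_tilde.
      rewrite tilde_equiv//; have := linB z _ 0 (Cc_tilde Cf) (Cc0 L).
      by rewrite !addr0 (star_hom0 hB (Cc0 L)) addr0.
  exact: (congr1 (fun u => u a) H).
exists Phi; split; last by move=> f Cf; exact: PhiE.
split; [split|split].
- by move=> a _ z z1; exact: PhiB.
- by move=> c a b _ _; exact: PhiL.
- by move=> a b _ _; exact: PhiM.
- by move=> a _; exact: PhiS.
- by move=> a _ z z1; exact: PhiB.
- move=> a b _ _ ab; apply/eqP; rewrite -subr_eq0; apply/eqP; apply: rnorm_eq0.
  by rewrite -PhiI ab subrr rnorm0.
- move=> b bz; have [||a aP] := @complete_transfer R _ (sa_dom PL) A B eA (fun f => eB (tilde f)) b.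
  + by move=> f g Cf Cg; rewrite iso.
  + exact: CstarSigma1_approx.
  exists a => //; apply/eqP; rewrite -subr_eq0; apply/eqP; apply: rnorm_le_eps => e e0.
  have e2 : 0 < e / 2 by lra.
  have [f [Cf f1 f2]] := aP _ e2.
  apply: (le_trans (rnorm_distD (eB (tilde f)) _ _)).
  rewrite -{1}(PhiE f Cf) PhiI (rnorm_distC (eB _)); lra.
Qed.

End Completions.

Theorem theorem11p4 (R : realType) (G : lc_groupoid) (alpha : haar_system R G)
    (L : fell_line_bundle R G) :
  star_iso (P := CcGL alpha L) (Q := CcSigma1 alpha L) (@tilde R G L) /\
  forall (A : cstar_completion (P := CcGL alpha L) (@sect_Inorm R G alpha L))
         (B : cstar_completion (P := CcSigma alpha L) (@sig_Inorm R G alpha L)),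
    exists Phi : A -> B,
      star_iso (P := cstar_sub [set: A]%classic) (Q := CstarSigma1 B) Phi /\
      forall f, sa_dom (CcGL alpha L) f -> Phi (embed A f) = embed B (tilde f).
Proof.
split; first exact: tilde_iso.
by move=> A B; exact: completion_iso.
Qed.
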